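(* Let $R$ be a commutative Noetherian ring with $1\neq 0$ such that every nonzero proper ideal of $R$ is a vertex of $\mathbb{AG}(R)$ and $\gamma(\mathbb{AG}(R))<\infty$. If $R$ is not local, then $R$ is an Artinian ring with only finitely many ideals. If $R$ is local with maximal ideal $\mathfrak{m}$, then one of the following two alternatives holds: (A) $(R,\mathfrak{m})$ is a Gorenstein ring such that $\mathfrak{m}^n\neq \mathfrak{m}^{n+1}$ for every positive integer $n$, $\mathbb{AG}(R)$ is a subgraph of Figure 1, and $\gamma(\mathbb{AG}(R))=0$; or (B) $R$ is a local Artinian ring with $\mathfrak{m}^{t}\neq (0)$ and $\mathfrak{m}^{t+1}=(0)$ for some integer $t\ge 0$, and the following hold: (a) If $t=1$, then $R$ is either finite or a special principal ideal ring. (b) If $t=2$, then one of the following holds: (b.1) $R$ is finite; (b.2) $R$ is a special principal ideal ring; (b.3) $\dim_{R/\mathfrak{m}}\mathfrak{m}^{2}/\mathfrak{m}^{3}=1$, $\dim_{R/\mathfrak{m}}\mathfrak{m}/\mathfrak{m}^{2}=2$, $R$ has infinitely many ideals, $\mathbb{AG}(R)$ is a subgraph of Figure 2, and $\gamma(\mathbb{AG}(R))=0$. (c) If $t=3$, then one of the following holds: (c.1) $R$ is finite; (c.2) $R$ is a special principal ideal ring; (c.3) $\dim_{R/\mathfrak{m}}\mathfrak{m}/\mathfrak{m}^{2}=2$, $\dim_{R/\mathfrak{m}}\mathfrak{m}^{2}/\mathfrak{m}^{3}=\dim_{R/\mathfrak{m}}\mathfrak{m}^{3}/\mathfrak{m}^{4}=1$,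 $R$ has infinitely many ideals, $\mathbb{AG}(R)$ is a subgraph of Figure 3, and $\gamma(\mathbb{AG}(R))=0$. (d) If $t\geq 4$, then $R$ is either finite or a special principal ideal ring. (The graphs called Figure 1, Figure 2 and Figure 3 are described in the context.)
   Context: Annihilating-ideal graph: an ideal $I$ of a commutative ring $R$ is an annihilating-ideal if there is a nonzero ideal $J$ of $R$ with $IJ=(0)$. The annihilating-ideal graph $\mathbb{AG}(R)$ is the simple undirected graph whose vertices are the nonzero annihilating-ideals of $R$, two distinct vertices $I\neq J$ being adjacent if and only if $IJ=(0)$. Genus: $S_k$ denotes the oriented surface of genus $k$ (the sphere with $k$ handles), $k\ge 0$. The genus $\gamma(G)$ of a graph $G$ is the minimal integer $n\geq 0$ such that $G$ can be embedded in $S_n$ (i.e. drawn in $S_n$ so that edges intersect only at common vertices). An infinite graph $G$ has infinite genus, $\gamma(G)=\infty$, if for every natural number $n$ there is a finite subgraph $G_n$ of $G$ with $\gamma(G_n)=n$. Rings: a local ring is a commutative ring with a unique maximal ideal; $\mathfrak{m}^0=R$. $\mathrm{Ann}(X)=\{a\in R: aX=0\}$. A special principal ideal ring is a local Artinian principal ideal ring. A Noetherian local ring $(R,\mathfrak{m})$ is here called Gorenstein if $\dim_{R/\mathfrak{m}}\mathrm{Ann}(\mathfrak{m})=1$ (for Artinian local rings this is the usual notion; the ring is not required to be Artinian). Figures: ''$\mathbb{AG}(R)$ is a subgraph of Figure $i$'' means that $\mathbb{AG}(R)$ is isomorphic to a subgraph of a graph of the shape described below, in which each family of unlabelled vertices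 may have any (possibly infinite) number of members, with labelled vertices corresponding to the ideals that label them. Figure 1: two adjacent vertices, $c$ (labelled $\mathrm{Ann}(\mathfrak{m})$) and $d$ (labelled $Rx$, a principal ideal of $R$); a family of further vertices each adjacent exactly to $c$ and $d$; and a family of further vertices each adjacent only to $c$. Figure 2: a vertex $c$ (labelled $\mathrm{Ann}(\mathfrak{m})$); a family of disjoint pairs $\{a,b\}$ of further vertices, with $a$ and $b$ adjacent to each other and to $c$ and to no other vertex; and a family of further vertices each adjacent only to $c$. Figure 3: two adjacent vertices, $c$ (labelled $\mathrm{Ann}(\mathfrak{m})=\mathfrak{m}^3$) and $d$ (labelled $\mathfrak{m}^2$); a family of disjoint pairs $\{a,b\}$ of further vertices, with $a$ and $b$ adjacent to each other and to both $c$ and $d$ and to no other vertex; a family of further vertices each adjacent exactly to $c$ and $d$; and a family of further vertices each adjacent only to $c$. *)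

(* Defs.v *)
From mathcomp Require Import all_boot all_order all_algebra.
From mathcomp Require Import all_classical all_reals all_analysis.

Set Implicit Arguments.
Unset Strict Implicit.
Unset Printing Implicit Defensive.

Import Order.TTheory GRing.Theory Num.Theory.
Import numFieldNormedType.Exports.

Local Open Scope classical_set_scope.
Local Open Scope ring_scope.

Section Ideals.
Variable R : comNzRingType.
Implicit Types (I J m : set R) (x : R).

(* The unit ideal is allowed, unlike in [idealr_closed] of ring_quotient. *)
Definition is_ideal I : Prop :=
  [/\ I 0, forall x y, I x -> I y -> I (x + y) & forall a x, I x -> I (a * x)].

Definition principal x : set R := [set a * x | a in [set: R]].

Definition annihilator (X : set R) : set R :=
  [set a | forall x, X x -> a * x = 0].

Definition ideal_mul I J : set R :=
  [set x | exists n (a b : 'I_n -> R),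
     (forall i, I (a i) /\ J (b i)) /\ x = \sum_(i < n) a i * b i].

Fixpoint ideal_pow I (n : nat) : set R :=
  if n is k.+1 then ideal_mul I (ideal_pow I k) else [set: R].

Definition maximal_ideal m : Prop :=
  [/\ is_ideal m, m <> [set: R] &
      forall I, is_ideal I -> m `<=` I -> I <> [set: R] -> I = m].

Definition local_with m : Prop :=
  maximal_ideal m /\ forall m', maximal_ideal m' -> m' = m.

Definition is_local : Prop := exists m, local_with m.

Definition noetherian : Prop :=
  forall F : nat -> set R, (forall n, is_ideal (F n)) ->
    (forall n, F n `<=` F n.+1) ->
    exists N, forall n, (N <= n)%N -> F n = F N.

Definition artinian : Prop :=
  forall F : nat -> set R, (forall n, is_ideal (F n)) ->
    (forall n, F n.+1 `<=` F n) ->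
    exists N, forall n, (N <= n)%N -> F n = F N.

Definition principal_ideal_ring : Prop :=
  forall I, is_ideal I -> exists x, I = principal x.

Definition special_principal_ideal_ring : Prop :=
  [/\ is_local, artinian & principal_ideal_ring].

(* dim_{R/m} I/J = n, for m maximal and ideals J <= I with m I <= J: the
   classes mod J of e_0, ..., e_{n-1} form a basis of the R/m-vector space
   I/J. *)
Definition residue_dim m I J (n : nat) : Prop :=
  exists e : 'I_n -> R,
    [/\ forall i, I (e i),
        forall x, I x -> exists a : 'I_n -> R, J (x - \sum_(i < n) a i * e i)
      & forall a : 'I_n -> R, J (\sum_(i < n) a i * e i) -> forall i, m (a i)].

(* Not necessarily Artinian. *)
Definition gorenstein m : Prop :=
  [/\ noetherian, local_with m & residue_dim m (annihilator m) [set 0] 1].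

Definition annihilating_ideal I : Prop :=
  is_ideal I /\ exists J, [/\ is_ideal J, J <> [set 0] & ideal_mul I J = [set 0]].

Lemma ideal_mulC I J : ideal_mul I J = ideal_mul J I.
Proof.
have sub A B : ideal_mul A B `<=` ideal_mul B A.
  move=> x [n [a [b [AB ->]]]]; exists n, b, a; split.
    by move=> i; have [] := AB i.
  by apply: eq_bigr => i _; rewrite mulrC.
by apply/seteqP; split; exact: sub.
Qed.

End Ideals.

Record graph := Graph {
  vertex : Type;
  adj : vertex -> vertex -> Prop;
  adj_sym : forall u v, adj u v -> adj v u;
  adj_irrefl : forall u, ~ adj u u
}.

Definition finite_graph (G : graph) : Prop := finite_set [set: vertex G].

Definition subgraph_map (H G : graph) (f : vertex H -> vertex G) : Prop :=
  injective f /\ forall u v, adj u v -> adj (f u) (f v).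

(* H is isomorphic to a (not necessarily induced) subgraph of G *)
Definition subgraph (H G : graph) : Prop :=
  exists f : vertex H -> vertex G, subgraph_map f.

Section Genus.
Variable K : realType.

(* The closed orientable surface of genus g as the smooth surface
     z^2 = ((3g+1)^2 - x^2 - y^2) * prod_(i < g) ((x - 3i)^2 + y^2 - 1)
   of K^3.  The right-hand side is nonnegative exactly on the closed disc of
   centre 0 and radius 3g+1 deprived of the g disjoint open unit discs of
   centres (3i, 0), and vanishes exactly on the boundary of this region: the
   surface is the double of a disc with g holes, i.e. a sphere with g handles.
   For g = 0 it is the unit sphere. *)
Definition surface (g : nat) : set (K * K * K) :=
  [set p | let: (x, y, z) := p in
     z ^+ 2 = ((3 * g + 1)%:R ^+ 2 - x ^+ 2 - y ^+ 2) *
              \prod_(i < g) ((x - (3 * i)%:R) ^+ 2 + y ^+ 2 - 1)].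

Definition is_arc (A : set (K * K * K)) (p q : K * K * K) : Prop :=
  exists f : K -> K * K * K,
    [/\ {within `[0, 1], continuous f}, set_inj `[0, 1] f,
        f 0 = p, f 1 = q & A = f @` `[0, 1]].

(* A drawing: distinct points for the vertices and, for each edge, an arc on
   the surface joining its ends and containing no other vertex; the arcs of two
   distinct edges meet only at common ends. *)
Definition drawable (G : graph) (g : nat) : Prop :=
  exists (pt : vertex G -> K * K * K)
         (arc : vertex G -> vertex G -> set (K * K * K)),
    [/\ injective pt,
        forall v, surface g (pt v),
        forall u v, adj u v ->
          [/\ is_arc (arc u v) (pt u) (pt v), arc u v `<=` surface g,
              arc u v = arc v u &
              forall w, arc u v (pt w) -> w = u \/ w = v] &
        forall u v u' v', adj u v -> adj u' v' ->
          [set u; v] <> [set u'; v'] ->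
          arc u v `&` arc u' v' `<=` pt @` ([set u; v] `&` [set u'; v'])].

(* For finite G this is [drawable G g], by [embeds_finite].  For infinite G it
   is tested on finite subgraphs: a graph with more vertices than the continuum
   has no drawing at all, although all its finite subgraphs may be planar. *)
Definition embeds (G : graph) (g : nat) : Prop :=
  forall H : graph, finite_graph H -> subgraph H G -> drawable H g.

Definition has_genus (G : graph) (g : nat) : Prop :=
  embeds G g /\ forall h, embeds G h -> (g <= h)%N.

(* The negation says that the genera of the finite subgraphs of G are unbounded.
   Since adding an edge raises the genus by at most one, every n is then the
   genus of some finite subgraph of G: G has infinite genus. *)
Definition finite_genus (G : graph) : Prop := exists g, has_genus G g.

Lemma drawable_subgraph (H G : graph) (g : nat) :
  subgraph H G -> drawable G g -> drawable H g.
Proof.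
move=> [f [f_inj f_adj]] [pt [arc [pt_inj ptS arcP meet]]].
exists (pt \o f), (fun u v => arc (f u) (f v)); split.
- exact: inj_comp.
- by move=> v; exact: ptS.
- move=> u v uv; have [Auv AS Asym Aw] := arcP _ _ (f_adj _ _ uv).
  split=> // w /Aw[] /f_inj ->; [by left|by right].
- move=> u v u' v' uv uv' neq p Ap.
  have im a b : f @` [set a; b] = [set f a; f b].
    by rewrite image_setU !image_set1.
  have fneq : [set f u; f v] <> [set f u'; f v'].
    rewrite -!im => E; apply: neq; apply/seteqP; split=> w ww.
      have : (f @` [set u; v]) (f w) by exists w.
      by rewrite E => -[w' w'P /f_inj <-].
    have : (f @` [set u'; v']) (f w) by exists w.
    by rewrite -E => -[w' w'P /f_inj <-].
  have [w [wl wr] <-] := meet _ _ _ _ (f_adj _ _ uv) (f_adj _ _ uv') fneq _ Ap.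
  move: wl wr; rewrite -!im => -[a aP <-] [b bP /f_inj ba].
  by exists a => //; split=> //; rewrite -ba.
Qed.

Lemma embeds_finite (G : graph) (g : nat) :
  finite_graph G -> (embeds G g <-> drawable G g).
Proof.
move=> fG; split=> [|dG H _ HG]; last exact: drawable_subgraph HG dG.
by apply=> //; exists id; split.
Qed.

End Genus.

Section AnnihilatingIdealGraph.
Variable R : comNzRingType.

Definition AG_vertex (I : set R) : Prop :=
  annihilating_ideal I /\ I <> [set 0].

Definition AG_adj (I J : {I : set R | AG_vertex I}) : Prop :=
  I <> J /\ ideal_mul (sval I) (sval J) = [set 0].

Lemma AG_adj_sym I J : AG_adj I J -> AG_adj J I.
Proof. by case=> neq IJ; split; [exact: nesym|rewrite ideal_mulC]. Qed.

Lemma AG_adj_irrefl I : ~ AG_adj I I.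
Proof. by case. Qed.

Definition AG : graph := Graph AG_adj_sym AG_adj_irrefl.

End AnnihilatingIdealGraph.

(* In the figures below the type parameters index the families of unlabelled
   vertices; the two members of the i-th pair are [pair i true] and
   [pair i false]. *)

Inductive fig1_vertex (A B : Type) :=
  | F1c | F1d | F1cd of A | F1leaf of B.
Arguments F1c {A B}.
Arguments F1d {A B}.

Definition fig1_adj (A B : Type) (u v : fig1_vertex A B) : Prop :=
  match u, v with
  | F1c, F1c => False
  | F1c, _ | _, F1c => True
  | F1d, F1cd _ | F1cd _, F1d => True
  | _, _ => False
  end.

Inductive fig2_vertex (A B : Type) :=
  | F2c | F2pair of A & bool | F2leaf of B.
Arguments F2c {A B}.

Definition fig2_adj (A B : Type) (u v : fig2_vertex A B) : Prop :=
  match u, v with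
  | F2c, F2c => False
  | F2c, _ | _, F2c => True
  | F2pair i s, F2pair j t => i = j /\ s <> t
  | _, _ => False
  end.

Inductive fig3_vertex (A B C : Type) :=
  | F3c | F3d | F3pair of A & bool | F3cd of B | F3leaf of C.
Arguments F3c {A B C}.
Arguments F3d {A B C}.

Definition fig3_adj (A B C : Type) (u v : fig3_vertex A B C) : Prop :=
  match u, v with
  | F3c, F3c => False
  | F3c, _ | _, F3c => True
  | F3d, F3pair _ _ | F3pair _ _, F3d => True
  | F3d, F3cd _ | F3cd _, F3d => True
  | F3pair i s, F3pair j t => i = j /\ s <> t
  | _, _ => False
  end.

Lemma fig1_adj_sym A B (u v : fig1_vertex A B) : fig1_adj u v -> fig1_adj v u.
Proof. by case: u v => [||?|?] [||?|?]. Qed.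

Lemma fig1_adj_irrefl A B (u : fig1_vertex A B) : ~ fig1_adj u u.
Proof. by case: u => //= *; case. Qed.

Lemma fig2_adj_sym A B (u v : fig2_vertex A B) : fig2_adj u v -> fig2_adj v u.
Proof.
by case: u v => [|??|?] [|??|?] //= [-> ne]; split=> // /esym.
Qed.

Lemma fig2_adj_irrefl A B (u : fig2_vertex A B) : ~ fig2_adj u u.
Proof. by case: u => [|i s|b] //= [_]. Qed.

Lemma fig3_adj_sym A B C (u v : fig3_vertex A B C) :
  fig3_adj u v -> fig3_adj v u.
Proof.
by case: u v => [||??|?|?] [||??|?|?] //= [-> ne]; split=> // /esym.
Qed.

Lemma fig3_adj_irrefl A B C (u : fig3_vertex A B C) : ~ fig3_adj u u.
Proof. by case: u => [||i s|b|l] //= [_]. Qed.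

Definition fig1 (A B : Type) : graph :=
  Graph (@fig1_adj_sym A B) (@fig1_adj_irrefl A B).
Definition fig2 (A B : Type) : graph :=
  Graph (@fig2_adj_sym A B) (@fig2_adj_irrefl A B).
Definition fig3 (A B C : Type) : graph :=
  Graph (@fig3_adj_sym A B C) (@fig3_adj_irrefl A B C).

Section Figures.
Variables (R : comNzRingType) (m : set R).

(* The ideal I is a vertex of AG(R), sent by f to w. *)
Definition labels (G : graph) (f : vertex (AG R) -> vertex G) (I : set R)
    (w : vertex G) : Prop :=
  exists v : vertex (AG R), sval v = I /\ f v = w.

Definition AG_in_fig1 : Prop :=
  exists (A B : Type) (f : vertex (AG R) -> vertex (fig1 A B)) (x : R),
    [/\ subgraph_map f, labels f (annihilator m) F1c &
        labels f (principal x) F1d].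

Definition AG_in_fig2 : Prop :=
  exists (A B : Type) (f : vertex (AG R) -> vertex (fig2 A B)),
    subgraph_map f /\ labels f (annihilator m) F2c.

Definition AG_in_fig3 : Prop :=
  exists (A B C : Type) (f : vertex (AG R) -> vertex (fig3 A B C)),
    [/\ subgraph_map f, annihilator m = ideal_pow m 3,
        labels f (annihilator m) F3c & labels f (ideal_pow m 2) F3d].

End Figures.

(* Main.v *)
Require Import Defs.
From mathcomp Require Import all_boot all_order all_algebra.
From mathcomp Require Import all_classical all_reals all_analysis.
From mathcomp Require Import ring lra zify.
From Stdlib Require Btauto.

(** Bounded genus enters through a single obstruction: for each genus there is an
    n such that no graph of that genus contains K_{3,n}, not even with its edges
    replaced by connected pieces of which only those of disjoint edges have to be
    disjoint (embeds_links_bound).  Everything else is commutative algebra that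
    produces such configurations in AG(R), or shows that none is left.

    The obstruction is a computation modulo 2.  On the explicit surface, each point
    q has a curve (its ray) running from q to a fixed point, and the crossings of a
    small step p p' with the ray of q are given by a formula in the coordinates
    (ray).  Moving q along a second path changes this number in two ways only: when
    the two paths pass over each other in the slices x = constant, which is
    recorded by the lexicographic order of their points, and when one path goes
    through a hole while the other one crosses the axis to the left of it, which
    is the intersection form of the surface (ray_identity).  Adding up over two
    disjoint paths leaves the ray counts and the order of their ends on one side
    and a bilinear form in 2g bits attached to each path on the other
    (ray_count_identity).  In K_{3,n} with n large, three vertices of the second
    class have the same bits; in the resulting K_{3,3} the sum of these identities
    over the eighteen pairs of disjoint edges is 9 = 0 (K33_parity).

    Algebraically, three distinct nonzero ideals killing infinitely many ideals
    are therefore impossible (three_killers).  If R is not local, with maximal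
    ideals M and N, the annihilators of M and of N and their sum kill all ideals
    inside the intersection of M and N, which are thus finitely many; an ideal is
    determined by its trace on this intersection together with whether it lies in
    M and in N.  If R is local with socle S = Ann(m) of dimension at least 2, three
    lines of S kill all ideals inside m, whence R is finite.  So let S = Rs.  When
    the powers of m decrease strictly, an edge of AG(R) has an end with fewer than
    three nonzero subideals; only S and at most one other ideal are of that kind,
    and this is fig1.  Otherwise m is nilpotent.  If R is infinite so is R/m, and pencils
    of ideals J + R(a + rb) are infinite families for three_killers.  With m not
    principal, such pencils rule out t >= 4 and, for t = 3, a quotient m/m^2 of
    dimension at least 3; for t = 2 and dimension at least 3 the graph AG(R)
    contains a subdivided K_{3,n} instead (no_three_dimensions).  In the remaining
    cases, dim m/m^2 = 2, adjacent ideals other than S (and m^2 when t = 3) are the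
    annihilators of each other, so that the rest of the graph is a matching:
    fig2 and fig3.

    The three figures are subgraphs of fig3, whose finite subgraphs are drawn
    on the sphere with the two centres at the poles and the pairs on the equator
    (book_drawable). *)

Set Implicit Arguments.
Unset Strict Implicit.
Unset Printing Implicit Defensive.

Import Order.TTheory GRing.Theory Num.Theory.
Import numFieldNormedType.Exports.

Local Open Scope classical_set_scope.
Local Open Scope ring_scope.

(** * The shape of the surface *)

Section SurfaceGeometry.
Variable K : realType.
Implicit Types (p q : K * K * K) (x y : K).

Definition px p : K := p.1.1.
Definition py p : K := p.1.2.
Definition pz p : K := p.2.

Definition nearby (e : K) p q : Prop :=
  [/\ `|px p - px q| < e, `|py p - py q| < e & `|pz p - pz q| < e].

Definition ctr (i : nat) : K := (3 * i)%:R.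
Definition outer_rad (g : nat) : K := (3 * g + 1)%:R.
Definition disc_fun (g : nat) x y : K := outer_rad g ^+ 2 - x ^+ 2 - y ^+ 2.
Definition hole_fun (i : nat) x y : K := (x - ctr i) ^+ 2 + y ^+ 2 - 1.

Lemma surfaceE g p : surface g p <->
  pz p ^+ 2 = disc_fun g (px p) (py p) * \prod_(i < g) hole_fun i (px p) (py p).
Proof. by case: p => [[x y] z]; split. Qed.

Lemma ctr_sep i j : (i < j)%N -> ctr i + 3 <= ctr j.
Proof.
move=> ij; rewrite /ctr -natrD ler_nat -[X in (_ + X)%N](muln1 3) -mulnDr addn1.
by rewrite leq_mul2l.
Qed.

Lemma ctr_rad i g : (i < g)%N -> ctr i + 4 <= outer_rad g.
Proof.
move=> /ctr_sep; rewrite /outer_rad natrD -/(ctr g) mulr1n => ?.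
lra.
Qed.

Lemma ctr_ge0 i : 0 <= ctr i. Proof. exact: ler0n. Qed.

Lemma rad_ge1 g : 1 <= outer_rad g.
Proof. by rewrite /outer_rad natrD lerDr ler0n. Qed.

(** The bound 5 / 4 means distance less than 3 / 2 from the centre of the hole:
    the discs of this radius around the centres, which are 3 apart, are disjoint. *)
Lemma hole_fun_other i j x y :
  i != j -> hole_fun i x y < 5 / 4 -> 5 / 4 <= hole_fun j x y.
Proof.
rewrite /hole_fun neq_ltn => /orP[] /ctr_sep ij hi.
  have : x - ctr i < 3 / 2 by nra.
  by move=> ?; nra.
have : x - ctr i > - (3 / 2) by nra.
by move=> ?; nra.
Qed.

Lemma disc_fun_near g i x y :
  (i < g)%N -> hole_fun i x y < 5 / 4 -> 1 <= disc_fun g x y.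
Proof.
rewrite /hole_fun /disc_fun => /ctr_rad ir hi.
have c0 := ctr_ge0 i.
have x1 : x - ctr i < 3 / 2 by nra.
have : outer_rad g ^+ 2 >= (ctr i + 4) ^+ 2 by nra.
by nra.
Qed.

Lemma prod_ge1 (I : finType) (P : pred I) (F : I -> K) :
  (forall i, P i -> 1 <= F i) -> 1 <= \prod_(i | P i) F i.
Proof.
move=> F1; elim/big_rec : _ => // i z Pi z1.
by rewrite -[1]mulr1 ler_pM // F1.
Qed.

(** Inside the open disc of a hole the other factors of the equation are positive,
    so that z^2 would be negative. *)
Lemma hole_fun_ge0 g p (i : 'I_g) :
  surface g p -> 0 <= hole_fun i (px p) (py p).
Proof.
move=> /surfaceE S; rewrite leNgt; apply/negP => hi.
have hi' : hole_fun i (px p) (py p) < 5 / 4 by lra.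
have d1 := disc_fun_near (ltn_ord i) hi'.
have pr1 : 1 <= \prod_(j < g | j != i) hole_fun j (px p) (py p).
  apply: prod_ge1 => j ji.
  suff : 5 / 4 <= hole_fun j (px p) (py p) by lra.
  by apply: hole_fun_other hi'; rewrite eq_sym.
rewrite (bigD1 i) //= in S.
have : pz p ^+ 2 >= 0 by exact: sqr_ge0.
rewrite S => H.
have : disc_fun g (px p) (py p) * \prod_(j < g | j != i) hole_fun j (px p) (py p) > 0.
  by apply: mulr_gt0; lra.
by nra.
Qed.

Lemma disc_fun_ge0 g p : surface g p -> 0 <= disc_fun g (px p) (py p).
Proof.
move=> S; rewrite leNgt; apply/negP => d0.
have : 0 < \prod_(j < g) hole_fun j (px p) (py p).
  apply: prodr_gt0 => j _.
  rewrite ltNge; apply/negP => hj.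
  have hj' : hole_fun j (px p) (py p) < 5 / 4 by lra.
  by have := disc_fun_near (ltn_ord j) hj'; lra.
move/surfaceE: S => S.
have : pz p ^+ 2 >= 0 by exact: sqr_ge0.
by rewrite S; nra.
Qed.

(** Near a hole the other factors are at least 1, so that z^2 bounds the distance
    to the circle of the hole. *)
Lemma hole_fun_le_sqr g p (i : 'I_g) : surface g p ->
  hole_fun i (px p) (py p) < 5 / 4 -> hole_fun i (px p) (py p) <= pz p ^+ 2.
Proof.
move=> S hi; have h0 := hole_fun_ge0 i S.
have d1 := disc_fun_near (ltn_ord i) hi.
have pr1 : 1 <= \prod_(j < g | j != i) hole_fun j (px p) (py p).
  apply: prod_ge1 => j ji.
  suff : 5 / 4 <= hole_fun j (px p) (py p) by lra.
  by apply: hole_fun_other hi; rewrite eq_sym.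
move/surfaceE: S; rewrite (bigD1 i) //= => ->.
set h := hole_fun _ _ _ in h0 hi *; set Q := \prod_(_ < _ | _) _ in pr1 *.
set d := disc_fun _ _ _ in d1 *.
have : 1 <= d * Q by nra.
by nra.
Qed.

(** Away from the holes it is the distance to the outer circle that z^2 bounds. *)
Lemma disc_fun_le_sqr g p : surface g p ->
  (forall i : 'I_g, 5 / 4 <= hole_fun i (px p) (py p)) ->
  disc_fun g (px p) (py p) <= pz p ^+ 2.
Proof.
move=> S hi; have d0 := disc_fun_ge0 S.
have pr1 : 1 <= \prod_(j < g) hole_fun j (px p) (py p).
  by apply: prod_ge1 => j _; have := hi j; lra.
by move/surfaceE: S => ->; nra.
Qed.

Definition lipschitz_on_box (r : K) (F : K -> K -> K) : Prop :=
  exists2 C : K, 0 <= C & forall x y x' y',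
    `|x| <= r -> `|y| <= r -> `|x'| <= r -> `|y'| <= r ->
    `|F x y| <= C /\ `|F x y - F x' y'| <= C * (`|x - x'| + `|y - y'|).

Lemma lipschitz_const r c : lipschitz_on_box r (fun _ _ => c).
Proof.
exists `|c| => // x y x' y' *; split=> //; rewrite subrr normr0.
by rewrite mulr_ge0 // addr_ge0.
Qed.

Lemma lipschitz_add r F G : lipschitz_on_box r F -> lipschitz_on_box r G ->
  lipschitz_on_box r (fun x y => F x y + G x y).
Proof.
move=> [C C0 FC] [D D0 GD]; exists (C + D); first exact: addr_ge0.
move=> x y x' y' hx hy hx' hy'.
have [f1 f2] := FC _ _ _ _ hx hy hx' hy'.
have [g1 g2] := GD _ _ _ _ hx hy hx' hy'.
split; first by rewrite (le_trans (ler_normD _ _)) // lerD.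
rewrite opprD addrACA mulrDl (le_trans (ler_normD _ _)) // lerD //.
Qed.

Lemma lipschitz_mul r F G : lipschitz_on_box r F -> lipschitz_on_box r G ->
  lipschitz_on_box r (fun x y => F x y * G x y).
Proof.
move=> [C C0 FC] [D D0 GD]; exists (2 * C * D + C * D); first by nra.
move=> x y x' y' hx hy hx' hy'.
have [f1 f2] := FC _ _ _ _ hx hy hx' hy'.
have [g1 g2] := GD _ _ _ _ hx hy hx' hy'.
have [g1' _] := GD _ _ _ _ hx' hy' hx hy.
split.
  rewrite normrM (le_trans (ler_pM _ _ f1 g1)) //.
  by have := mulr_ge0 C0 D0; lra.
have -> : F x y * G x y - F x' y' * G x' y' =
  F x y * (G x y - G x' y') + (F x y - F x' y') * G x' y' by ring.
have t0 : 0 <= `|x - x'| + `|y - y'| by rewrite addr_ge0.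
have e1 := ler_pM (normr_ge0 (F x y)) (normr_ge0 _) f1 g2.
have e2 := ler_pM (normr_ge0 _) (normr_ge0 _) f2 g1'.
rewrite (le_trans (ler_normD _ _)) // !normrM (le_trans (lerD e1 e2)) //.
by have := mulr_ge0 (mulr_ge0 C0 D0) t0; lra.
Qed.

Lemma lipschitz_ext r F G : (forall x y, F x y = G x y) ->
  lipschitz_on_box r F -> lipschitz_on_box r G.
Proof.
move=> FG [C C0 FC]; exists C => // x y x' y'; rewrite -!FG; exact: FC.
Qed.

Lemma lipschitz_x r : 0 <= r -> lipschitz_on_box r (fun x _ => x).
Proof.
move=> r0; exists (r + 1); first by lra.
move=> x y x' y' * /=; split; first by lra.
by have := normr_ge0 (x - x'); have := normr_ge0 (y - y'); nra.
Qed.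

Lemma lipschitz_y r : 0 <= r -> lipschitz_on_box r (fun _ y => y).
Proof.
move=> r0; exists (r + 1); first by lra.
move=> x y x' y' * /=; split; first by lra.
by have := normr_ge0 (x - x'); have := normr_ge0 (y - y'); nra.
Qed.

Lemma lipschitz_surface g :
  lipschitz_on_box (outer_rad g)
    (fun x y => disc_fun g x y * \prod_(i < g) hole_fun i x y).
Proof.
have r0 : 0 <= outer_rad g by have := rad_ge1 g; lra.
have LX := lipschitz_x r0; have LY := lipschitz_y r0.
have LC := lipschitz_const (outer_rad g).
apply: lipschitz_mul.
  apply: (@lipschitz_ext _
    (fun x y => outer_rad g ^+ 2 + (-1) * (x * x) + (-1) * (y * y))).
    by move=> x y; rewrite /disc_fun; ring.
  by do ![apply: lipschitz_add|apply: lipschitz_mul].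
have LH (i : nat) : lipschitz_on_box (outer_rad g) (hole_fun i).
  apply: (@lipschitz_ext _ (fun x y =>
      (x + - ctr i) * (x + - ctr i) + y * y + - 1)).
    by move=> x y; rewrite /hole_fun; ring.
  by do ![apply: lipschitz_add|apply: lipschitz_mul].
elim: g {r0 LX LY} (outer_rad g) LC LH => [|n IHn] r LC LH.
  by apply: lipschitz_ext (LC 1) => x y; rewrite big_ord0.
apply: (lipschitz_ext (F := fun x y =>
    (\prod_(i < n) hole_fun i x y) * hole_fun n x y)).
  by move=> x y; rewrite big_ord_recr.
exact: lipschitz_mul (IHn _ LC LH) (LH n).
Qed.

Lemma surface_box g p : surface g p ->
  `|px p| <= outer_rad g /\ `|py p| <= outer_rad g.
Proof.
move=> /disc_fun_ge0; rewrite /disc_fun => d.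
have r1 := rad_ge1 g.
by split; rewrite ler_norml; apply/andP; split; nra.
Qed.

Definition on_top p : bool := 0 <= pz p.

(** z^2 is a Lipschitz function of (x, y) on the box that contains the surface;
    hence z is determined by (x, y) up to a small error once its sign is fixed, or
    when z itself is small, where the two sheets are close to each other. *)
Lemma near_of_projection g (d : K) : 0 < d ->
  exists2 e, 0 < e & forall p q, surface g p -> surface g q ->
    `|px p - px q| <= e -> `|py p - py q| <= e ->
    on_top p = on_top q \/ `|pz p| <= e -> nearby d p q.
Proof.
move=> d0; have [C C0 lipC] := lipschitz_surface g.
have m0 : 0 < Num.min 1 (Num.min (d / 2) (d ^+ 2 / (5 + 4 * C))).
  rewrite !lt_min ltr01 divr_gt0 //= divr_gt0 ?exprn_gt0 //.
  by lra.
exists (Num.min 1 (Num.min (d / 2) (d ^+ 2 / (5 + 4 * C)))) => //.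
set e := Num.min _ _ in m0 *.
have [e1 e2 e3] : [/\ e <= 1, e <= d / 2 & e * (5 + 4 * C) <= d ^+ 2].
  split; rewrite /e.
  - by rewrite ge_min lexx.
  - by rewrite !ge_min lexx orbT.
  - by rewrite -ler_pdivlMr; [rewrite !ge_min lexx !orbT|lra].
move=> p q Sp Sq xpq ypq sgn.
have [[bp1 bp2] [bq1 bq2]] := (surface_box Sp, surface_box Sq).
have [_] := lipC _ _ _ _ bp1 bp2 bq1 bq2.
move/surfaceE: Sp => <-; move/surfaceE: Sq => <- zz.
have {}zz : `|pz p ^+ 2 - pz q ^+ 2| <= 2 * C * e.
  by apply: (le_trans zz); nra.
have key : (pz p - pz q) ^+ 2 <= (4 + 4 * C) * e.
  move: zz; rewrite ler_norml => /andP[zz1 zz2].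
  case: sgn => [|zp].
    rewrite /on_top; case: (leP 0 (pz p)); case: (leP 0 (pz q)) => //= zq zp _.
      by case: (leP (pz p) (pz q)) => ?; nra.
    by case: (leP (pz p) (pz q)) => ?; nra.
  have : pz p ^+ 2 <= e.
    move: zp; rewrite ler_norml => /andP[? ?]; nra.
  by have := sqr_ge0 (pz p + pz q); nra.
split; [lra|lra|].
have lt : (pz p - pz q) ^+ 2 < d ^+ 2 by lra.
by rewrite ltr_norml; apply/andP; split; nra.
Qed.

End SurfaceGeometry.

(** * Crossing numbers modulo 2 *)

Section Cochains.
Variables (K : realType) (g : nat).
Implicit Types (p q : K * K * K).

Definition lex p q : bool :=
  (px p < px q) || (px p == px q) &&
  ((py p < py q) || (py p == py q) && (pz p < pz q)).

(** The slice of the surface by the plane x = px q is run through along the bottom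
    sheet for decreasing y, then along the top sheet for increasing y; slice p q
    holds when p comes after q, for p and q of nearly equal abscissas. *)
Definition slice p q : bool :=
  if on_top p then ~~ on_top q || (py q < py p) else ~~ on_top q && (py p < py q).

Definition at_hole p : bool :=
  [exists i : 'I_g, hole_fun i (px p) (py p) < 5 / 4].

Definition switch p p' : bool := on_top p (+) on_top p'.

(** A step p p' that switches sheets goes through the outer circle or through the
    circle of a hole.  The second factor selects one side of the former and, for q
    in the lower half, the whole of the latter; see switch_order. *)
Definition jump q p p' : bool :=
  switch p p' && (if at_hole p then py q < 0 else 0 < py p).

(** The crossings modulo 2 of the step p p' with the ray of q: the part of the
    slice of q that comes after q, completed on the right of q by the arc of the
    outer circle with y > 0 and, when q is in the lower half, by the circles of the
    holes.  These pieces form a curve from q to the point (outer_rad, 0, 0), up to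
    full circles of holes. *)
Definition ray q p p' : bool :=
  ((lex q p (+) lex q p') && slice p' q) (+) (lex q p && jump q p p').

Definition hole_cross (i : nat) p p' : bool :=
  switch p p' && (hole_fun i (px p) (py p) < 5 / 4).

Definition axis_cross (i : nat) q q' : bool :=
  ((py q < 0) (+) (py q' < 0)) && (px q < ctr K i).

(** The circles of the holes and the curves cut out by the half-planes y = 0,
    x < ctr i form a symplectic basis of the homology modulo 2; this is the
    intersection form in that basis. *)
Definition handle_form p p' q q' : bool :=
  \big[addb/false]_(i < g)
     ((hole_cross i p p' && axis_cross i q q') (+)
      (axis_cross i p p' && hole_cross i q q')).

Lemma lex_anti p q : p <> q -> lex p q = ~~ lex q p.
Proof.
case: p q => [[x y] z] [[x' y'] z']; rewrite /lex /px /py /pz /= => pq.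
case: (ltgtP x x') => //= xx; case: (ltgtP y y') => //= yy.
case: (ltgtP z z') => //= zz.
by case: pq; rewrite xx yy zz.
Qed.

Lemma handle_formC p p' q q' : handle_form p p' q q' = handle_form q q' p p'.
Proof.
by apply: eq_bigr => i _; rewrite addbC ![_ && hole_cross _ _ _]andbC
   ![hole_cross _ _ _ && _]andbC.
Qed.

(** Here d is a distance kept between two paths, h a bound on the steps into which
    they are cut, and e an intermediate scale: two points that are d-far but whose
    abscissas differ by at most e have ordinates more than e apart. *)
Definition scale_ok (d e h : K) : Prop :=
  [/\ 0 < h, 5 * h <= e, 4 * h <= 1,
      h * (16 * outer_rad K g + 20) <= e ^+ 2 / 4 &
      forall p q, surface g p -> surface g q ->
        `|px p - px q| <= e -> `|py p - py q| <= e ->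
        on_top p = on_top q \/ `|pz p| <= e -> nearby d p q].

Lemma switch_small h p p' : 0 < h -> nearby h p p' -> switch p p' ->
  `|pz p| < h /\ `|pz p'| < h.
Proof.
move=> h0 [_ _]; rewrite /switch /on_top !ltr_norml => /andP[a b].
by case: (leP 0 (pz p)); case: (leP 0 (pz p')) => //= *; split; apply/andP; lra.
Qed.

Lemma y_far d e h p q : scale_ok d e h -> surface g p -> surface g q -> ~ nearby d p q ->
    `|px p - px q| <= e -> on_top p = on_top q \/ `|pz p| <= e ->
  e < `|py p - py q|.
Proof.
move=> [_ _ _ _ eP] Sp Sq npq xpq sg.
by rewrite ltNge; apply/negP => ypq; exact/npq/eP.
Qed.

Lemma hole_cross_le h (i : 'I_g) p p' : 0 < h -> surface g p -> nearby h p p' ->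
  hole_cross i p p' -> hole_fun i (px p) (py p) <= h ^+ 2.
Proof.
move=> h0 Sp pp' /andP[sw hi].
have [] := switch_small h0 pp' sw; rewrite ltr_norml => /andP[? ?] _.
have := hole_fun_le_sqr Sp hi; nra.
Qed.

(** At a switch p lies on a circle where the sheets meet.  On the outer circle it is
    an end of its slice, the upper one when py p > 0.  On the circle of a hole,
    every point of the slice that is far from p lies below p when it lies below
    the hole. *)
Lemma switch_order d e h p p' q : scale_ok d e h -> surface g p -> surface g q ->
  nearby h p p' -> switch p p' -> ~ nearby d p q -> `|px p - px q| <= 4 * h ->
  (py q < py p) = if at_hole p then py q < 0 else 0 < py p.
Proof.
move=> ok Sp Sq pp' sw npq xpq; have [h0 he h1 hR _] := ok.
have [zp _] := switch_small h0 pp' sw.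
have yf : e < `|py p - py q|.
  by apply: (y_far ok Sp Sq npq); [lra|right; lra].
have R1 := rad_ge1 K g.
have [] := surface_box Sp; have [] := surface_box Sq.
rewrite !ler_norml => /andP[xq1 xq2] /andP[yq1 yq2] /andP[xp1 xp2] /andP[yp1 yp2].
move: xpq zp; rewrite ler_norml ltr_norml => /andP[xx1 xx2] /andP[z1 z2].
have zsq : pz p ^+ 2 <= h ^+ 2 by nra.
have hh : h ^+ 2 <= h by nra.
have e0 : 0 < e by lra.
have e2 : 0 < e ^+ 2 by nra.
case: ifP => [/existsP[i hi]|/negbT /existsPn nh].
  have hp : hole_fun i (px p) (py p) <= h ^+ 2.
    by have := hole_fun_le_sqr Sp hi; lra.
  have hq := hole_fun_ge0 i Sq.
  have c0 := ctr_ge0 K i; have cR := ctr_rad K (ltn_ord i).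
  have yy : py p ^+ 2 <= py q ^+ 2 + e ^+ 2 / 4.
    rewrite /hole_fun in hp hq.
    have : (px q - ctr K i) ^+ 2 - (px p - ctr K i) ^+ 2 <= 16 * h * outer_rad K g.
      have -> : (px q - ctr K i) ^+ 2 - (px p - ctr K i) ^+ 2 =
        (px q - px p) * (px q + px p - 2 * ctr K i) by ring.
      have l1 : `|px q - px p| <= 4 * h by rewrite ler_norml; lra.
      have l2 : `|px q + px p - 2 * ctr K i| <= 4 * outer_rad K g.
        by rewrite ler_norml; lra.
      rewrite (le_trans (ler_norm _)) // normrM.
      by rewrite (le_trans (ler_pM _ _ l1 l2)) //; lra.
    by nra.
  case: (ltP (py q) 0) => yq.
    rewrite ltNge; apply/negP => ypq.
    rewrite ler0_norm in yf; last by lra.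
    by nra.
  apply/negbTE; rewrite -leNgt leNgt; apply/negP => ypq.
  rewrite gtr0_norm in yf; last by lra.
  by nra.
have dp : disc_fun g (px p) (py p) <= h ^+ 2.
  apply: (le_trans (disc_fun_le_sqr Sp _)) => // i.
  by have := nh i; rewrite -leNgt.
have dq := disc_fun_ge0 Sq.
have yy : py q ^+ 2 <= py p ^+ 2 + e ^+ 2 / 4.
  rewrite /disc_fun in dp dq.
  have : px p ^+ 2 - px q ^+ 2 <= 8 * h * outer_rad K g.
    have -> : px p ^+ 2 - px q ^+ 2 = (px p - px q) * (px p + px q) by ring.
    have l1 : `|px p - px q| <= 4 * h by rewrite ler_norml; lra.
    have l2 : `|px p + px q| <= 2 * outer_rad K g by rewrite ler_norml; lra.
    rewrite (le_trans (ler_norm _)) // normrM.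
    by rewrite (le_trans (ler_pM _ _ l1 l2)) //; lra.
  by nra.
case: (ltP 0 (py p)) => yp.
  rewrite ltNge; apply/negP => ypq.
  rewrite ler0_norm in yf; last by lra.
  by nra.
apply/negbTE; rewrite -leNgt leNgt; apply/negP => ypq.
rewrite gtr0_norm in yf; last by lra.
by nra.
Qed.

Lemma far_ltC (a b e : K) : 0 < e -> e < `|a - b| -> (a < b) = ~~ (b < a).
Proof.
move=> e0 ab; rewrite -leNgt lt_neqAle andb_idl // => _.
by apply/eqP => abE; move: ab; rewrite abE subrr normr0 ltNge (ltW e0).
Qed.

Lemma far_lt_stable (a a' b e : K) :
  e < `|a - b| -> `|a - a'| <= e -> (b < a) = (b < a').
Proof.
rewrite ltr_normr ler_norml => /orP[] ab /andP[? ?].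
  have ba : b < a by lra.
  have ba' : b < a' by lra.
  by rewrite ba ba'.
have ab1 : a <= b by lra.
have ab2 : a' <= b by lra.
by rewrite !ltNge ab1 ab2.
Qed.

(** As long as p keeps to its sheet its order with a far point q cannot change, for
    this would require equal ordinates; at a switch the change is the one described
    by switch_order. *)
Lemma slice_jump d e h p p' q : scale_ok d e h ->
  surface g p -> surface g p' -> surface g q ->
  nearby h p p' -> ~ nearby d p q -> ~ nearby d p' q ->
  `|px p - px q| <= 4 * h ->
  slice p q (+) slice p' q = jump q p p'.
Proof.
move=> ok Sp Sp' Sq pp' npq np'q xpq; have [h0 he h1 hR _] := ok.
rewrite /jump.
have [xx yy _] := pp'.
have e0 : 0 < e by lra.
have {}yy : `|py p - py p'| <= e by lra.
have xpq' : `|px p - px q| <= e by lra.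
have xp'q : `|px p' - px q| <= e.
  by move: xpq xx; rewrite !ler_norml ltr_norml => /andP[? ?] /andP[? ?]; lra.
have far : on_top p = on_top q \/ `|pz p| <= e -> e < `|py p - py q|.
  exact: (y_far ok).
have far' : on_top p' = on_top q \/ `|pz p'| <= e -> e < `|py p' - py q|.
  exact: (y_far ok).
case: (boolP (switch p p')) => [sw|]; last first.
  rewrite /switch; case tp : (on_top p); case tp' : (on_top p') => //= _;
    rewrite /slice tp tp'; case tq : (on_top q) => //=.
    rewrite (far_lt_stable (far _) yy) ?addbb //.
    by left; rewrite tp tq.
  have pf : e < `|py p - py q| by apply: far; left; rewrite tp tq.
  have pf' : e < `|py p' - py q| by apply: far'; left; rewrite tp' tq.
  by rewrite (far_ltC e0 pf) (far_ltC e0 pf') (far_lt_stable pf yy) addbb.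
rewrite -(switch_order ok Sp Sq pp' sw npq xpq) /=.
have [z1 z2] := switch_small h0 pp' sw.
have pf : e < `|py p - py q| by apply: far; right; lra.
have pf' : e < `|py p' - py q| by apply: far'; right; lra.
move: sw; rewrite /switch /slice (far_ltC e0 pf) (far_ltC e0 pf').
rewrite (far_lt_stable pf yy).
by case: (on_top p); case: (on_top p'); case: (on_top q) => //= _;
  case: (_ < _).
Qed.

Lemma lex_lt p q : px p < px q -> lex p q.
Proof. by rewrite /lex => ->. Qed.

Lemma lex_gt p q : px q < px p -> lex p q = false.
Proof. by rewrite /lex => qp; rewrite (lt_gtF qp) (gt_eqF qp). Qed.

(** In the slice of p, which meets the circle of the hole at p, the axis is met only
    inside the hole or near p; the point q is in neither place. *)
Lemma hole_axis_far d e h p p' q q' (i : 'I_g) : scale_ok d e h ->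
  surface g p -> surface g q -> nearby h p p' -> nearby h q q' ->
  ~ nearby d p q -> `|px p - px q| <= 4 * h ->
  hole_cross i p p' -> (py q < 0) (+) (py q' < 0) = false.
Proof.
move=> ok Sp Sq pp' [_ yy _] npq xpq hc; have [h0 he h1 hR _] := ok.
apply/negbTE/negP => yqq.
have hp := hole_cross_le h0 Sp pp' hc.
have hq := hole_fun_ge0 i Sq.
have [zp _] := switch_small h0 pp' (andP hc).1.
have pf : e < `|py p - py q|.
  by apply: (y_far ok Sp Sq npq); [lra|right; lra].
have yq : `|py q| <= h.
  move: yy yqq; rewrite ltr_norml ler_norml => /andP[? ?].
  by case: (ltP (py q) 0); case: (ltP (py q') 0) => //= *; apply/andP; lra.
have [] := surface_box Sp; have [] := surface_box Sq.
rewrite !ler_norml => /andP[xq1 xq2] _ /andP[xp1 xp2] _.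
have c0 := ctr_ge0 K i; have cR := ctr_rad K (ltn_ord i).
rewrite /hole_fun in hp hq.
have : (px q - ctr K i) ^+ 2 - (px p - ctr K i) ^+ 2 <= 16 * h * outer_rad K g.
  have -> : (px q - ctr K i) ^+ 2 - (px p - ctr K i) ^+ 2 =
    (px q - px p) * (px q + px p - 2 * ctr K i) by ring.
  have l1 : `|px q - px p| <= 4 * h by rewrite distrC.
  have l2 : `|px q + px p - 2 * ctr K i| <= 4 * outer_rad K g.
    by rewrite ler_norml; lra.
  rewrite (le_trans (ler_norm _)) // normrM.
  by rewrite (le_trans (ler_pM _ _ l1 l2)) //; lra.
have yq2 : py q ^+ 2 <= h ^+ 2.
  by move: yq; rewrite ler_norml => /andP[? ?]; nra.
have yp2 : (4 / 5 * e) ^+ 2 <= py p ^+ 2.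
  move: yq pf; rewrite ler_norml ltr_normr => /andP[? ?] /orP[?|?].
    have : 4 / 5 * e <= py p by lra.
    by nra.
  have : 4 / 5 * e <= - py p by lra.
  by nra.
have hh : h ^+ 2 <= h by nra.
have e2 : 0 < e ^+ 2 by nra.
by nra.
Qed.

(** On the axis and outside the hole, q is on the left or on the right of the hole,
    and the right is excluded by px q < px p. *)
Lemma axis_left d e h p p' q q' (i : 'I_g) : scale_ok d e h ->
  surface g p -> surface g q -> nearby h p p' -> nearby h q q' ->
  px q + 2 * h < px p ->
  hole_cross i p p' -> (py q < 0) (+) (py q' < 0) -> px q < ctr K i.
Proof.
move=> ok Sp Sq pp' [_ yy _] xpq hc yqq; have [h0 he h1 hR _] := ok.
have hp := hole_cross_le h0 Sp pp' hc.
have hq := hole_fun_ge0 i Sq.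
have yq2 : py q ^+ 2 <= h ^+ 2.
  move: yy yqq; rewrite ltr_norml => /andP[? ?].
  by case: (ltP (py q) 0); case: (ltP (py q') 0) => //= *; nra.
rewrite /hole_fun in hp hq.
rewrite ltNge; apply/negP => cq.
have : 1 - h ^+ 2 <= px q - ctr K i by nra.
have : px p - ctr K i <= 1 + h ^+ 2 by nra.
by nra.
Qed.

Lemma axis_not_right d e h p p' q q' (i : 'I_g) : scale_ok d e h ->
  surface g p -> surface g q -> nearby h p p' -> nearby h q q' ->
  px q + 2 * h < px p ->
  axis_cross i p p' -> hole_cross i q q' = false.
Proof.
move=> ok Sp Sq pp' qq' xpq /andP[ypp cp].
apply/negbTE/negP => hc; have [h0 he h1 hR _] := ok.
have hq := hole_cross_le h0 Sq qq' hc.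
have hp := hole_fun_ge0 i Sp.
have [_ yy _] := pp'.
have yp2 : py p ^+ 2 <= h ^+ 2.
  move: yy ypp; rewrite ltr_norml => /andP[? ?].
  by case: (ltP (py p) 0); case: (ltP (py p') 0) => //= *; nra.
rewrite /hole_fun in hp hq.
have : px p - ctr K i <= - (1 - h ^+ 2) by nra.
have : - (1 + h ^+ 2) <= px q - ctr K i by nra.
by nra.
Qed.

Lemma jumpD p p' q q' :
  jump q p p' (+) jump q' p p' =
  (switch p p' && at_hole p) && ((py q < 0) (+) (py q' < 0)).
Proof.
rewrite /jump; case: (switch p p') => //=.
by case: (at_hole p) => //=; rewrite addbb.
Qed.

(** For q on the left of p only the jumps of p are counted by the rays of q and q',
    and these two rays contain different full circles of holes exactly when the
    step q q' crosses the axis. *)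
Lemma handle_form_lt d e h p p' q q' : scale_ok d e h ->
  surface g p -> surface g q -> nearby h p p' -> nearby h q q' ->
  px q + 2 * h < px p ->
  handle_form p p' q q' = jump q p p' (+) jump q' p p'.
Proof.
move=> ok Sp Sq pp' qq' xpq; rewrite jumpD.
have nr (i : 'I_g) : axis_cross i p p' && hole_cross i q q' = false.
  by apply/negbTE/negP => /andP[/(axis_not_right ok Sp Sq pp' qq' xpq) ->].
case: (boolP (switch p p' && at_hole p)) => [/andP[sw /existsP[i hi]]|ns] /=.
  have hc : hole_cross i p p' by apply/andP.
  rewrite /handle_form (bigD1 i) //= big1 ?addbF => [|j ji].
    rewrite nr addbF hc /axis_cross /=.
    case: (boolP (_ (+) _)) => //= yqq.
    exact: (axis_left ok Sp Sq pp' qq' xpq hc yqq).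
  rewrite nr addbF; apply/negbTE/negP => /andP[/andP[_ hj] _].
  by have := hole_fun_other ji hj; rewrite leNgt hi.
rewrite /handle_form big1 // => i _; rewrite nr addbF.
apply/negbTE/negP => /andP[/andP[sw hi] _]; case/negP: ns.
by rewrite sw; apply/existsP; exists i.
Qed.

(** When the abscissas of p and q are apart, the order lex is constant and the
    identity is handle_form_lt.  When they are close, the right-hand side vanishes
    (hole_axis_far), slice is antisymmetric because far points of a slice have
    distinct ordinates, and slice_jump turns the identity into a tautology in the
    eight values of slice and lex. *)
Lemma ray_identity (d e h : K) p p' q q' : 0 < d -> scale_ok d e h ->
  surface g p -> surface g p' -> surface g q -> surface g q' ->
  nearby h p p' -> nearby h q q' ->
  ~ nearby d p q -> ~ nearby d p' q -> ~ nearby d p q' -> ~ nearby d p' q' ->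
  ray q p p' (+) ray q' p p' (+) (ray p q q' (+) ray p' q q') (+)
  (lex p q (+) lex p' q (+) (lex p q' (+) lex p' q')) = handle_form p p' q q'.
Proof.
move=> d0 ok Sp Sp' Sq Sq' pp' qq' npq np'q npq' np'q'.
have h0 : 0 < h by case: ok.
have he : 5 * h <= e by case: ok.
have [xp _ _] := pp'; have [xq _ _] := qq'.
move: xp xq; rewrite !ltr_norml => /andP[xp1 xp2] /andP[xq1 xq2].
case: (ltP (px q + 2 * h) (px p)) => [qp|pq1].
  rewrite (handle_form_lt ok Sp Sq pp' qq' qp) /ray.
  have [l1 l2] : px q < px p /\ px q < px p' by split; lra.
  have [l3 l4] : px q' < px p /\ px q' < px p' by split; lra.
  by rewrite !(lex_lt l1, lex_lt l2, lex_lt l3, lex_lt l4)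
             !(lex_gt l1, lex_gt l2, lex_gt l3, lex_gt l4) /= !addbF.
case: (ltP (px p + 2 * h) (px q)) => [pq|pq2].
  rewrite handle_formC (handle_form_lt ok Sq Sp qq' pp' pq) /ray.
  have [l1 l2] : px p < px q /\ px p < px q' by split; lra.
  have [l3 l4] : px p' < px q /\ px p' < px q' by split; lra.
  by rewrite !(lex_lt l1, lex_lt l2, lex_lt l3, lex_lt l4)
             !(lex_gt l1, lex_gt l2, lex_gt l3, lex_gt l4) /= !addbF.
have farC (u v : K * K * K) : ~ nearby d u v -> ~ nearby d v u.
  by move=> nuv [a b c]; apply: nuv; split; rewrite distrC.
have x1 : `|px p - px q| <= 4 * h by rewrite ler_norml; lra.
have x2 : `|px p - px q'| <= 4 * h by rewrite ler_norml; lra.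
have x3 : `|px q - px p| <= 4 * h by rewrite ler_norml; lra.
have x4 : `|px q - px p'| <= 4 * h by rewrite ler_norml; lra.
have x5 : `|px p' - px q| <= 4 * h by rewrite ler_norml; lra.
have x6 : `|px p' - px q'| <= 4 * h by rewrite ler_norml; lra.
have -> : handle_form p p' q q' = false.
  rewrite /handle_form big1 // => i _; rewrite /axis_cross.
  case: (boolP (hole_cross i p p')) => [hc|_] /=.
    have -> := hole_axis_far ok Sp Sq pp' qq' npq x1 hc.
    case: (boolP (hole_cross i q q')) => [hc'|_]; last by rewrite andbF.
    by have -> := hole_axis_far ok Sq Sp qq' pp' (farC _ _ npq) x3 hc'.
  case: (boolP (hole_cross i q q')) => [hc'|_]; last by rewrite andbF.
  by have -> := hole_axis_far ok Sq Sp qq' pp' (farC _ _ npq) x3 hc'.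
have j0 : jump q p p' (+) jump q' p p' = false.
  rewrite jumpD; case: (boolP (switch p p' && at_hole p)) => //= /andP[sw /existsP[i hi]].
  by apply: (hole_axis_far ok Sp Sq pp' qq' npq x1 (i := i)); apply/andP.
have sliceC u v : surface g u -> surface g v -> ~ nearby d u v ->
    `|px u - px v| <= 4 * h -> slice v u = ~~ slice u v.
  move=> Su Sv nuv xuv; rewrite /slice.
  case tu : (on_top u); case tv : (on_top v) => //=.
    have f : e < `|py u - py v|.
      by apply: (y_far ok Su Sv nuv); [lra|left; rewrite tu tv].
    by apply: far_ltC f; lra.
  have f : e < `|py u - py v|.
    by apply: (y_far ok Su Sv nuv); [lra|left; rewrite tu tv].
  by rewrite (far_ltC _ f) ?negbK //; lra.
have neq u v : ~ nearby d u v -> u <> v.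
  move=> nuv uv; apply: nuv; rewrite uv; have [_ _ _ _ eP] := ok.
  by split; rewrite subrr normr0.
rewrite /ray.
move: j0.
rewrite -(slice_jump ok Sp Sp' Sq pp' npq np'q x1).
rewrite -(slice_jump ok Sp Sp' Sq' pp' npq' np'q' x2).
rewrite -(slice_jump ok Sq Sq' Sp qq' (farC _ _ npq) (farC _ _ npq') x3).
rewrite -(slice_jump ok Sq Sq' Sp' qq' (farC _ _ np'q) (farC _ _ np'q') x4).
rewrite (sliceC _ _ Sp Sq npq x1) (sliceC _ _ Sp Sq' npq' x2).
rewrite (sliceC _ _ Sp' Sq np'q x5) (sliceC _ _ Sp' Sq' np'q' x6).
rewrite !(lex_anti (nesym (neq _ _ npq)), lex_anti (nesym (neq _ _ np'q)),
          lex_anti (nesym (neq _ _ npq')), lex_anti (nesym (neq _ _ np'q'))).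
do 4!case: (slice _ _) => //=; do 4!case: (lex _ _) => //=.
Qed.

Lemma scale_exists (d : K) : 0 < d -> exists e h : K, scale_ok d e h.
Proof.
move=> d0; have [e e0 eP] := near_of_projection g d0.
have R1 := rad_ge1 K g.
pose c := 16 * outer_rad K g + 20.
have c0 : 0 < c by rewrite /c; lra.
exists e, (Num.min (e / 5) (Num.min (1 / 4) (e ^+ 2 / 4 / c))).
set h := Num.min _ _.
split=> //.
- by rewrite !lt_min !divr_gt0 ?exprn_gt0.
- by have : h <= e / 5 by [rewrite /h ge_min lexx]; lra.
- by have : h <= 1 / 4 by [rewrite /h !ge_min lexx orbT]; lra.
- by rewrite -ler_pdivlMr // /h !ge_min lexx !orbT.
Qed.

End Cochains.

(** * Parity of K_{3,3} *)

Lemma big_addb_telescope (A : nat -> bool) n :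
  \big[addb/false]_(l < n) (A l (+) A l.+1) = A 0%N (+) A n.
Proof.
elim: n => [|n IHn]; first by rewrite big_ord0 addbb.
by rewrite big_ord_recr /= IHn -addbA [A n (+) _]addbA addbb.
Qed.

Lemma three_in_fiber (F : finType) (n : nat) (c : 'I_n -> F) :
  (2 * #|F| < n)%N ->
  exists j0 j1 j2 : 'I_n,
    [/\ j0 != j1, j1 != j2, j2 != j0, c j0 = c j1 & c j0 = c j2].
Proof.
move=> ltn; have [f f3] : exists f, (2 < #|[pred j | c j == f]|)%N.
  apply/existsP; apply: contraLR ltn => /existsPn small.
  rewrite -leqNgt -[X in (X <= _)%N](card_ord n) -sum1_card.
  rewrite (partition_big c predT) //= mulnC -sum_nat_const.
  apply: leq_sum => f _; have := small f; rewrite -leqNgt; apply: leq_trans.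
  by rewrite sum1_card; apply: subset_leq_card; apply/fintype.subsetP => j; rewrite !inE.
have [j0 [j1 [j2 [[]]]]] := card_gt2P f3.
rewrite !inE => /eqP e0 /eqP e1 /eqP e2 [n01 n12 n20].
by exists j0, j1, j2; rewrite e0 e1 e2.
Qed.

Lemma addb_xorb a b : a (+) b = xorb a b. Proof. by case: a b => [] []. Qed.

Section K33.
(** Two classes x_0, x_1, x_2 and y_0, y_1, y_2 of vertices: nx k i j and ny l i j
    are the crossings of the edge x_i y_j with the rays of x_k and of y_l, the
    functions xx, yy, xy and yx compare the vertices in the order lex, and b i k is
    the intersection form on the edges at x_i and x_k, which does not depend on the
    other ends of these edges. *)
Variables (nx ny : nat -> nat -> nat -> bool) (xx yy xy yx b : nat -> nat -> bool).

(** In the sum over the eighteen pairs of disjoint edges, each crossing number and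
    each xy i j occurs an even number of times, each xx i k and each b i k six
    times; rewriting yx by antisymmetry adds 1 eighteen times, and rewriting yy adds
    1 nine times, three for each pair of vertices y_j, y_l. *)
Lemma K33_parity :
  (forall i j k l, (i < k < 3)%N -> (j < 3)%N -> (l < 3)%N -> j != l ->
    nx k i j (+) ny l i j (+) (nx i k l (+) ny j k l) (+)
    (xx i k (+) yx j k (+) (xy i l (+) yy j l)) = b i k) ->
  (forall j l, (j < l < 3)%N -> yy l j = ~~ yy j l) ->
  (forall j k, (j < 3)%N -> (k < 3)%N -> yx j k = ~~ xy k j) -> False.
Proof.
move=> H yyC yxC.
pose pair i j k l := nx k i j (+) ny l i j (+) (nx i k l (+) ny j k l) (+)
  (xx i k (+) ~~ xy k j (+) (xy i l (+) yy j l)) (+) b i k.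
have pair0 i j k l : (i < k < 3)%N -> (j < 3)%N -> (l < 3)%N -> j != l ->
    pair i j k l = false.
  by move=> ik j3 l3 jl; rewrite /pair -(yxC j k) ?(andP ik).2 // H // addbb.
have : (pair 0 0 1 1 (+) pair 0 0 1 2 (+) pair 0 1 1 0 (+) pair 0 1 1 2 (+)
  pair 0 2 1 0 (+) pair 0 2 1 1 (+) pair 0 0 2 1 (+) pair 0 0 2 2 (+)
  pair 0 1 2 0 (+) pair 0 1 2 2 (+) pair 0 2 2 0 (+) pair 0 2 2 1 (+)
  pair 1 0 2 1 (+) pair 1 0 2 2 (+) pair 1 1 2 0 (+) pair 1 1 2 2 (+)
  pair 1 2 2 0 (+) pair 1 2 2 1)%N = true.
  rewrite /pair (yyC 0%N 1%N) // (yyC 0%N 2%N) // (yyC 1%N 2%N) //.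
  rewrite !addb_xorb.
  Btauto.btauto.
by rewrite !pair0.
Qed.
End K33.

(** * Discretized paths *)

Lemma grid_sum M (A B C H : nat -> nat -> bool) :
  (forall k l, (k < M)%N -> (l < M)%N ->
    A k l (+) A k l.+1 (+) (B k l (+) B k.+1 l) (+)
    (C k l (+) C k.+1 l (+) (C k l.+1 (+) C k.+1 l.+1)) = H k l) ->
  \big[addb/false]_(k < M) A k 0%N (+) \big[addb/false]_(k < M) A k M (+)
  (\big[addb/false]_(l < M) B 0%N l (+) \big[addb/false]_(l < M) B M l) (+)
  (C 0%N 0%N (+) C M 0%N (+) (C 0%N M (+) C M M)) =
  \big[addb/false]_(k < M) \big[addb/false]_(l < M) H k l.
Proof.
move=> AH.
transitivity (\big[addb/false]_(k < M) \big[addb/false]_(l < M)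
  (A k l (+) A k l.+1 (+) (B k l (+) B k.+1 l) (+)
    (C k l (+) C k.+1 l (+) (C k l.+1 (+) C k.+1 l.+1)))); last first.
  by apply: eq_bigr => k _; apply: eq_bigr => l _; rewrite AH.
have SA : \big[addb/false]_(k < M) \big[addb/false]_(l < M)
    (A k l (+) A k l.+1) =
    \big[addb/false]_(k < M) A k 0%N (+) \big[addb/false]_(k < M) A k M.
  rewrite -big_split /=; apply: eq_bigr => k _.
  exact: (big_addb_telescope (A k)).
have SB : \big[addb/false]_(k < M) \big[addb/false]_(l < M)
    (B k l (+) B k.+1 l) =
    \big[addb/false]_(l < M) B 0%N l (+) \big[addb/false]_(l < M) B M l.
  rewrite exchange_big -big_split /=; apply: eq_bigr => l _.
  exact: (big_addb_telescope (B^~ l)).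
have SC : \big[addb/false]_(k < M) \big[addb/false]_(l < M)
    (C k l (+) C k.+1 l (+) (C k l.+1 (+) C k.+1 l.+1)) =
    C 0%N 0%N (+) C M 0%N (+) (C 0%N M (+) C M M).
  rewrite exchange_big /=.
  transitivity (\big[addb/false]_(l < M) (C 0%N l (+) C M l (+)
      (C 0%N l.+1 (+) C M l.+1))).
    apply: eq_bigr => l _; rewrite big_split /=.
    by rewrite (big_addb_telescope (C^~ l)) (big_addb_telescope (C^~ l.+1)).
  exact: (big_addb_telescope (fun l => C 0%N l (+) C M l)).
rewrite -SA -SB -SC -big_split -big_split /=; apply: eq_bigr => k _.
by rewrite -!big_split.
Qed.

Section DiscretePaths.
Variables (K : realType) (g : nat).
Implicit Types (P Q : nat -> K * K * K) (v : K * K * K).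

Definition ray_count M v P : bool := \big[addb/false]_(k < M) ray g v (P k) (P k.+1).
Definition hole_count M i P : bool :=
  \big[addb/false]_(k < M) hole_cross i (P k) (P k.+1).
Definition axis_count M i P : bool :=
  \big[addb/false]_(k < M) axis_cross i (P k) (P k.+1).

(** The sum of ray_identity over the grid of all pairs of steps: the terms on the
    left telescope in one direction or in both, and the intersection form, being
    bilinear, becomes a form in the total counts. *)
Lemma ray_count_identity (d e h : K) M P Q : 0 < d -> scale_ok g d e h ->
  (forall k, (k <= M)%N -> surface g (P k)) ->
  (forall k, (k <= M)%N -> surface g (Q k)) ->
  (forall k, (k < M)%N -> nearby h (P k) (P k.+1)) ->
  (forall k, (k < M)%N -> nearby h (Q k) (Q k.+1)) ->
  (forall k l, (k <= M)%N -> (l <= M)%N -> ~ nearby d (P k) (Q l)) ->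
  ray_count M (Q 0%N) P (+) ray_count M (Q M) P (+)
  (ray_count M (P 0%N) Q (+) ray_count M (P M) Q) (+)
  (lex (P 0%N) (Q 0%N) (+) lex (P M) (Q 0%N) (+)
   (lex (P 0%N) (Q M) (+) lex (P M) (Q M))) =
  \big[addb/false]_(i < g)
    ((hole_count M i P && axis_count M i Q) (+)
     (axis_count M i P && hole_count M i Q)).
Proof.
move=> d0 ok SP SQ cP cQ far.
transitivity (\big[addb/false]_(k < M) \big[addb/false]_(l < M)
    handle_form g (P k) (P k.+1) (Q l) (Q l.+1)); last first.
  under [RHS]eq_bigr => i _ do rewrite !big_distrlr /= -big_split /=.
  rewrite [RHS]exchange_big /=; apply: eq_bigr => k _.
  rewrite [LHS]exchange_big /=; apply: eq_bigr => i _.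
  by rewrite -big_split.
rewrite -(@grid_sum M (fun k l => ray g (Q l) (P k) (P k.+1))
  (fun k l => ray g (P k) (Q l) (Q l.+1)) (fun k l => lex (P k) (Q l))
  (fun k l => handle_form g (P k) (P k.+1) (Q l) (Q l.+1))) // => k l kM lM.
have [kM' lM'] := (ltnW kM, ltnW lM).
exact: (ray_identity d0 ok (SP _ kM') (SP _ kM) (SQ _ lM') (SQ _ lM)
  (cP _ kM) (cQ _ lM) (far _ _ kM' lM') (far _ _ kM lM') (far _ _ kM' lM)
  (far _ _ kM lM)).
Qed.

End DiscretePaths.

Section Compactness.
Variable K : realType.
Implicit Types (f : K -> K * K * K) (s t : K).

Lemma lebesgue_number (P : K -> K -> Prop) :
  (forall t r r', r' <= r -> P t r -> P t r') ->
  (forall s, s \in `[0, 1] -> exists2 r : K, 0 < r &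
     forall t, t \in `[0, 1] -> `|s - t| < r -> P t r) ->
  exists2 r : K, 0 < r & forall t, t \in `[0, 1] -> P t r.
Proof.
move=> Pmono Ploc.
have /compact_near_coveringP/near_covering_withinP cov :=
  @segment_compact K 0 1.
have /= := cov K (at_right 0) (fun r t => P t r) _.
case=> [s s01|r /= r0 Pr].
  have [r r0 Pr] := Ploc s s01.
  exists ([set t | `|s - t| < r], [set r' | r' < r]) => /=.
    split; first by exists r.
    by apply: nbhs_right_lt.
  by move=> [t r'] /= [st r'r] t01; apply: Pmono (ltW r'r) _; exact: Pr.
exists (r / 2); first exact: divr_gt0.
move=> t t01; apply: (Pr (r / 2)) => //=; last exact: divr_gt0.
by rewrite sub0r normrN gtr0_norm ?divr_gt0 // ltr_pdivrMr // ltr_pMr // ltrDl.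
Qed.

(** Continuity on the unit interval, in terms of the coordinatewise distance. *)
Definition is_path f : Prop := forall s e, s \in `[0, 1] -> 0 < e ->
  exists2 r : K, 0 < r &
    forall t, t \in `[0, 1] -> `|s - t| < r -> nearby e (f s) (f t).

End Compactness.

Section Paths.
Variable K : realType.
Implicit Types (f : K -> K * K * K) (s t e : K) (p q : K * K * K).

Lemma nearby_sym e p q : nearby e p q -> nearby e q p.
Proof. by move=> [a b c]; split; rewrite distrC. Qed.

Lemma nearby_trans e e' p q (r : K * K * K) :
  nearby e p q -> nearby e' q r -> nearby (e + e') p r.
Proof.
move=> [a b c] [a' b' c']; split.
- exact: (le_lt_trans (ler_distD (px q) _ _) (ltrD a a')).
- exact: (le_lt_trans (ler_distD (py q) _ _) (ltrD b b')).
- exact: (le_lt_trans (ler_distD (pz q) _ _) (ltrD c c')).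
Qed.

Lemma nearby_mono e e' p q : e <= e' -> nearby e p q -> nearby e' p q.
Proof. by move=> ee [a b c]; split; exact: lt_le_trans ee. Qed.

Lemma not_nearby p q : p <> q -> exists2 e : K, 0 < e & ~ nearby e p q.
Proof.
move=> pq.
have [xx|xx] := eqVneq (px p) (px q); last first.
  by exists `|px p - px q|; [rewrite normr_gt0 subr_eq0|case; rewrite ltxx].
have [yy|yy] := eqVneq (py p) (py q); last first.
  by exists `|py p - py q|; [rewrite normr_gt0 subr_eq0|case; rewrite ltxx].
have [zz|zz] := eqVneq (pz p) (pz q); last first.
  by exists `|pz p - pz q|; [rewrite normr_gt0 subr_eq0|case; rewrite ltxx].
by case: pq; case: p q xx yy zz => [[? ?] ?] [[? ?] ?];
  rewrite /px /py /pz /= => -> -> ->.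
Qed.

Lemma is_path_within f : {within `[0, 1], continuous f} -> is_path f.
Proof.
move=> /subspace_continuousP fc s e s01 e0.
have := fc s s01 (nearby e (f s)).
have : nbhs (f s) (nearby e (f s)).
  apply/nbhs_ballP; exists e => //= q [[/= a b] c].
  by split; [exact: a|exact: b|exact: c].
move=> /[swap] /[apply]; rewrite /= nbhs_simpl /within /=.
move=> /nbhs_ballP[r /= r0 H]; exists r => // t t01 st.
by apply: H.
Qed.

Lemma path_mesh f e : is_path f -> 0 < e -> exists2 r : K, 0 < r &
  forall s t, s \in `[0, 1] -> t \in `[0, 1] -> `|s - t| < r ->
    nearby e (f s) (f t).
Proof.
move=> fp e0.
have [||r r0 H] := @lebesgue_number K (fun s r => forall t,
    t \in `[0, 1] -> `|s - t| < r -> nearby e (f s) (f t)).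
- by move=> s r r' rr H t t01 st; apply: H => //; exact: lt_le_trans st rr.
- move=> s s01; have e20 : 0 < e / 2 by exact: divr_gt0.
  have [r r0 H] := fp s (e / 2) s01 e20.
  exists (r / 2); first exact: divr_gt0.
  move=> t t01 st t' t'01 tt.
  rewrite [e]splitr; apply: (@nearby_trans _ _ _ (f s)).
    by apply/nearby_sym/H => //; lra.
  apply: H => //; rewrite (le_lt_trans (ler_distD t _ _)) //.
  by rewrite [r]splitr ltrD.
by exists r => // s t s01 t01; exact: H.
Qed.

Lemma path_separation f f' : is_path f -> is_path f' ->
  (forall s t, s \in `[0, 1] -> t \in `[0, 1] -> f s <> f' t) ->
  exists2 e : K, 0 < e & forall s t, s \in `[0, 1] -> t \in `[0, 1] ->
    ~ nearby e (f s) (f' t).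
Proof.
move=> fp fp' dis.
have [||e e0 H] := @lebesgue_number K (fun s e => forall t,
    t \in `[0, 1] -> ~ nearby e (f s) (f' t)); last first.
- by exists e => // s t s01 t01; exact: H.
- move=> s s01.
  have [||r r0 H] := @lebesgue_number K (fun t r => forall s',
      s' \in `[0, 1] -> `|s - s'| < r -> ~ nearby r (f s') (f' t)).
  + move=> t r r' rr H s' s'01 ss /(nearby_mono rr); apply: H => //.
    exact: lt_le_trans ss rr.
  + move=> t t01; have [e e0 far] := not_nearby (dis _ _ s01 t01).
    have e30 : 0 < e / 3 by exact: divr_gt0.
    have [r1 r10 H1] := fp s (e / 3) s01 e30.
    have [r2 r20 H2] := fp' t (e / 3) t01 e30.
    exists (Num.min r1 (Num.min r2 (e / 3))); first by rewrite !lt_min r10 r20.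
    move=> t' t'01; rewrite !lt_min => /and3P[_ tt _] s' s'01.
    rewrite !lt_min => /and3P[ss _ _] nb; apply: far.
    have -> : e = e / 3 + (e / 3 + e / 3) by lra.
    apply: (nearby_trans (H1 _ s'01 ss)); apply: (nearby_trans _ _).
      by apply: nearby_mono nb; rewrite !ge_min lexx !orbT.
    exact/nearby_sym/H2.
  by exists r => // s' s'01 ss t t01; exact: H.
- by move=> s r r' rr H t t01 /(nearby_mono rr); exact: H.
Qed.

Lemma finite_scale (I : finType) (P : I -> K -> Prop) :
  (forall i r r', r' <= r -> P i r -> P i r') ->
  (forall i, exists2 r, 0 < r & P i r) ->
  exists2 r, 0 < r & forall i, P i r.
Proof.
move=> Pm Pex.
suff [r r0 H] : exists2 r, 0 < r & forall i, i \in enum I -> P i r.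
  by exists r => // i; apply: H; rewrite mem_enum.
elim: (enum I) => [|i s [r r0 IH]]; first by exists 1.
have [r' r'0 Pi] := Pex i.
exists (Num.min r r'); first by rewrite lt_min r0.
move=> j; rewrite inE => /orP[/eqP ->|js].
  by apply: Pm Pi; rewrite ge_min lexx orbT.
by apply: Pm (IH _ js); rewrite ge_min lexx.
Qed.

End Paths.

(** * Large graphs K_{3,n} on a surface *)

Section WeakDrawing.
Variables (K : realType) (g : nat).

(** Only edges without a common end are required to be disjoint: edges may cross
    themselves and their neighbours.  This leaves room for edges that are replaced
    by walks through other vertices. *)
Definition weak_K3n n (gam : 'I_3 -> 'I_n -> K -> K * K * K)
    (X : 'I_3 -> K * K * K) (Y : 'I_n -> K * K * K) : Prop :=
  [/\ forall i j, is_path (gam i j),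
      forall i j (t : K), t \in `[0, 1] -> surface g (gam i j t),
      forall i j, gam i j 0 = X i /\ gam i j 1 = Y j &
      forall i j k l (s t : K), i != k -> j != l -> s \in `[0, 1] -> t \in `[0, 1] ->
        gam i j s <> gam k l t].

(** All edges are cut into the same number of small steps.  Among more than twice as
    many vertices y_j as there are values of the 6g crossing numbers of their edges,
    three have the same values; K33_parity applies to them. *)
Lemma weak_K3n_bound : exists n, forall gam X Y, ~ @weak_K3n n gam X Y.
Proof.
(* for each x_i, the crossings of an edge with the 2g curves of handle_form *)
pose F := {ffun 'I_3 * 'I_g * bool -> bool}.
pose n := (2 * #|{: F}|).+1.
exists n => gam X Y [gp gS ends dis].
have [d d0 far] : exists2 d : K, 0 < d & forall a : 'I_3 * 'I_3 * ('I_n * 'I_n),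
    a.1.1 != a.1.2 -> a.2.1 != a.2.2 ->
    forall s t : K, s \in `[0, 1] -> t \in `[0, 1] ->
    ~ nearby d (gam a.1.1 a.2.1 s) (gam a.1.2 a.2.2 t).
  apply: finite_scale => [a r r' rr H ik jl s t s01 t01 /(nearby_mono rr)|].
    exact: H.
  move=> [[i k] [j l]] /=.
  have [->|ik] := eqVneq i k; first by exists 1.
  have [->|jl] := eqVneq j l; first by exists 1.
  have [|e e0 H] := path_separation (gp i j) (gp k l).
    by move=> s t s01 t01; exact: dis.
  by exists e.
have [e [h ok]] := scale_exists g d0.
have h0 : 0 < h by case: ok.
have [r r0 mesh] : exists2 r : K, 0 < r & forall a : 'I_3 * 'I_n,
    forall s t : K, s \in `[0, 1] -> t \in `[0, 1] -> `|s - t| < r ->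
    nearby h (gam a.1 a.2 s) (gam a.1 a.2 t).
  apply: finite_scale => [a r r' rr H s t s01 t01 st|[i j] /=].
    by apply: H => //; exact: lt_le_trans rr.
  exact: path_mesh.
pose M := (Num.truncn r^-1).+1.
have M0 : 0 < M%:R :> K by rewrite ltr0n.
have Mr : M%:R^-1 < r.
  rewrite invf_plt ?posrE //; exact: truncnS_gt.
pose P i j k : K * K * K := gam i j (k%:R / M%:R).
have in01 k : (k <= M)%N -> k%:R / M%:R \in `[(0 : K), 1].
  move=> kM; rewrite in_itv /= divr_ge0 ?ler0n //=.
  by rewrite ler_pdivrMr // mul1r ler_nat.
have P0 i j : P i j 0%N = X i by rewrite /P mul0r; exact: (ends i j).1.
have PM i j : P i j M = Y j by rewrite /P divff ?gt_eqF //; exact: (ends i j).2.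
have SP i j k : (k <= M)%N -> surface g (P i j k) by move=> kM; exact/gS/in01.
have cP i j k : (k < M)%N -> nearby h (P i j k) (P i j k.+1).
  move=> kM; apply: (mesh (i, j)); rewrite ?in01 ?(ltnW kM) //.
  have -> : k%:R / M%:R - k.+1%:R / M%:R = - M%:R^-1 :> K.
    by rewrite -addn1 natrD mulrDl mul1r opprD addrA subrr add0r.
  by rewrite normrN gtr0_norm ?invr_gt0.
have fP i k j l a b : i != k -> j != l -> (a <= M)%N -> (b <= M)%N ->
    ~ nearby d (P i j a) (P k l b).
  by move=> ik jl aM bM; apply: (far ((i, k), (j, l))) => //; exact: in01.
pose code (j : 'I_n) : F := [ffun a : 'I_3 * 'I_g * bool => if a.2 then hole_count M a.1.2 (P a.1.1 j)
                              else axis_count M a.1.2 (P a.1.1 j)].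
have [j0 [j1 [j2 [n01 n12 n20 c01 c02]]]] := @three_in_fiber F n code (ltnSn _).
pose J (j : nat) := if j is j'.+1 then (if j' is _.+1 then j2 else j1) else j0.
pose I (i : nat) : 'I_3 := inord i.
have Jneq j l : (j < 3)%N -> (l < 3)%N -> j != l -> J j != J l.
  by case: j l => [|[|[|?]]] [|[|[|?]]] //= _ _ _; rewrite // eq_sym.
have Ineq i k : (i < k < 3)%N -> I i != I k.
  move=> /andP[ik k3]; rewrite -val_eqE /= !inordK ?(ltn_trans ik) //.
  by rewrite ltn_eqF.
have codeJ j : code (J j) = code j0 by case: j => [|[|?]] //=.
have holeJ i j a : hole_count M (val (a : 'I_g)) (P i (J j)) = hole_count M a (P i j0).
  by have := codeJ j => /ffunP/(_ (i, a, true)); rewrite !ffunE.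
have axisJ i j a : axis_count M (val (a : 'I_g)) (P i (J j)) = axis_count M a (P i j0).
  by have := codeJ j => /ffunP/(_ (i, a, false)); rewrite !ffunE.
have neq i k j l a b : i != k -> j != l -> (a <= M)%N -> (b <= M)%N ->
    P i j a <> P k l b.
  move=> ik jl aM bM eqP; apply: (fP i k j l a b) => //.
  by rewrite eqP; split; rewrite subrr normr0.
apply: (@K33_parity
  (fun k i j => ray_count g M (X (I k)) (P (I i) (J j)))
  (fun l i j => ray_count g M (Y (J l)) (P (I i) (J j)))
  (fun i k => lex (X (I i)) (X (I k))) (fun j l => lex (Y (J j)) (Y (J l)))
  (fun i l => lex (X (I i)) (Y (J l))) (fun j k => lex (Y (J j)) (X (I k)))
  (fun i k => \big[addb/false]_(a < g)
    ((hole_count M a (P (I i) j0) && axis_count M a (P (I k) j0)) (+)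
     (axis_count M a (P (I i) j0) && hole_count M a (P (I k) j0))))).
- move=> i j k l ik j3 l3 jl.
  have := @ray_count_identity K g d e h M (P (I i) (J j)) (P (I k) (J l)) d0 ok
    (SP _ _) (SP _ _) (cP _ _) (cP _ _).
  rewrite !P0 !PM => ->.
    by apply: eq_bigr => a _; rewrite !holeJ !axisJ.
  by move=> a b aM bM; apply: fP; rewrite ?Ineq ?Jneq.
- move=> j l /andP[jl l3]; apply: lex_anti.
  rewrite -(PM (I 0%N)) -(PM (I 1%N)); apply: neq => //; first exact: Ineq.
  by rewrite eq_sym; apply: Jneq; rewrite ?(ltn_trans jl) ?ltn_eqF.
- move=> j k j3 k3; apply: lex_anti.
  have [i' ik] : exists i', I i' != I k.
    by case: k k3 => [|k] k3; [exists 1%N; rewrite eq_sym|exists 0%N]; apply: Ineq.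
  have [l' jl] : exists l', J j != J l'.
    by case: j j3 => [|j] j3; [exists 1%N|exists 0%N]; apply: Jneq.
  rewrite -(PM (I i')) -(P0 (I k) (J l')); exact: neq.
Qed.

End WeakDrawing.

(** * Subdivided graphs K_{3,n} *)

Section Links.
Variables (K : realType) (G : graph).
Implicit Types (A : set (vertex G)) (u v w : vertex G).

Inductive link A : vertex G -> vertex G -> Prop :=
| link_edge u v of A u & A v & adj u v : link A u v
| link_trans u v w of link A u v & link A v w : link A u w.

Lemma link_ends A u v : link A u v -> A u /\ A v.
Proof. by elim=> // {}u {}v w _ [? _] _ [_ ?]. Qed.

Definition joined (S : set (K * K * K)) p q : Prop :=
  exists f : K -> K * K * K,
    [/\ is_path f, f 0 = p, f 1 = q & forall t, t \in `[0, 1] -> S (f t)].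

Lemma joined_trans S a b c : joined S a b -> joined S b c -> joined S a c.
Proof.
move=> [f [fp f0 f1 fS]] [f' [fp' f'0 f'1 fS']].
pose F t := if t <= 2^-1 then f (2 * t) else f' (2 * t - 1).
have lo (t : K) : t \in `[0, 1] -> t <= 2^-1 -> 2 * t \in `[0, 1].
  by rewrite !in_itv /= => /andP[? ?] ?; apply/andP; lra.
have hi (t : K) : t \in `[0, 1] -> 2^-1 <= t -> 2 * t - 1 \in `[0, 1].
  by rewrite !in_itv /= => /andP[? ?] ?; apply/andP; lra.
have Flo t : t <= 2^-1 -> F t = f (2 * t) by rewrite /F => ->.
have Fhi t : 2^-1 <= t -> F t = f' (2 * t - 1).
  move=> t2; rewrite /F; case: (leP t 2^-1) => // t2'.
  have -> : t = 2^-1 by lra.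
  by rewrite divff ?subrr ?f'0 // f1.
exists F; split.
- move=> s e s01 e0.
  have [r1 r10 H1] : exists2 r : K, 0 < r & forall t, t \in `[0, 1] ->
      s <= 2^-1 -> t <= 2^-1 -> `|s - t| < r -> nearby e (F s) (F t).
    case: (leP s 2^-1) => [s2|_]; last by exists 1.
    have [r r0 H] := fp _ e (lo _ s01 s2) e0.
    exists (r / 2) => [|t t01 _ t2 st]; first exact: divr_gt0.
    rewrite !Flo //; apply: H; first exact: lo.
    by rewrite -mulrBr normrM gtr0_norm //; lra.
  have [r2 r20 H2] : exists2 r : K, 0 < r & forall t, t \in `[0, 1] ->
      2^-1 <= s -> 2^-1 <= t -> `|s - t| < r -> nearby e (F s) (F t).
    case: (leP 2^-1 s) => [s2|_]; last by exists 1.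
    have [r r0 H] := fp' _ e (hi _ s01 s2) e0.
    exists (r / 2) => [|t t01 _ t2 st]; first exact: divr_gt0.
    rewrite !Fhi //; apply: H; first exact: hi.
    have -> : 2 * s - 1 - (2 * t - 1) = 2 * (s - t) by ring.
    by rewrite normrM gtr0_norm //; lra.
  have [s2|s2|s2] := ltgtP s 2^-1.
  + exists (Num.min r1 (2^-1 - s)); first by rewrite lt_min r10 subr_gt0.
    move=> t t01; rewrite lt_min => /andP[st1]; rewrite ltr_norml => /andP[? ?].
    by apply: H1 => //; lra.
  + exists (Num.min r2 (s - 2^-1)); first by rewrite lt_min r20 subr_gt0.
    move=> t t01; rewrite lt_min => /andP[st1]; rewrite ltr_norml => /andP[? ?].
    by apply: H2 => //; lra.
  + exists (Num.min r1 r2); first by rewrite lt_min r10.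
    move=> t t01; rewrite lt_min => /andP[st1 st2].
    case: (leP t 2^-1) => t2; first by apply: H1 => //; rewrite s2.
    by apply: H2 => //; [rewrite s2|exact: ltW].
- by rewrite Flo ?mulr0 // invr_ge0.
- by rewrite Fhi; [have -> : 2 * 1 - 1 = 1 :> K by lra|lra].
- move=> t t01; case: (leP t 2^-1) => t2.
    by rewrite Flo //; apply: fS; exact: lo.
  by rewrite Fhi ?(ltW t2) //; apply: fS'; apply: hi; rewrite ?(ltW t2).
Qed.

End Links.

Lemma link_induced (G : graph) (A B : set (vertex G)) (H : graph)
    (f : vertex H -> vertex G) :
  (forall v, B v -> exists u, f u = v) ->
  injective f -> (forall u v, adj (f u) (f v) -> adj u v) ->
  A `<=` B -> forall u v, link A (f u) (f v) -> link (f @^-1` A) u v.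
Proof.
move=> onto f_inj f_adj AB.
suff lift a b : link A a b ->
    forall u v, f u = a -> f v = b -> link (f @^-1` A) u v.
  by move=> u v /lift; apply.
elim=> {a b} [a b Aa Ab ab u v ea eb|a b c L1 IH1 L2 IH2 u v ea eb].
  by subst a b; apply: link_edge => //; exact: f_adj.
have [w wb] := onto _ (AB _ (link_ends L1).2).
by apply: (@link_trans _ _ _ w); [exact: IH1|exact: IH2].
Qed.

Definition induced (G : graph) (B : set (vertex G)) : graph :=
  @Graph {v | B v} (fun u v => adj (sval u) (sval v))
    (fun u v => @adj_sym G _ _) (fun u => @adj_irrefl G _).

Lemma finite_induced (G : graph) (B : set (vertex G)) :
  finite_set B -> finite_graph (induced B).
Proof.
move=> fB; rewrite /finite_graph.
have -> : [set: vertex (induced B)] = sval @^-1` B.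
  by apply/seteqP; split=> // -[].
by apply: finite_preimage fB => -[u ?] [v ?] _ _ /= uv; exact: eq_exist.
Qed.

Lemma subgraph_induced (G : graph) (B : set (vertex G)) : subgraph (induced B) G.
Proof.
exists sval; split=> // -[u ?] [v ?] /= uv; exact: eq_exist.
Qed.

Section NoK3n.
Variables (K : realType) (G : graph) (g : nat).

Lemma drawable_links_weak_K3n n (x : 'I_3 -> vertex G) (y : 'I_n -> vertex G)
    (A : 'I_3 -> 'I_n -> set (vertex G)) :
  (forall i j, link (A i j) (x i) (y j)) ->
  (forall i j k l, i != k -> j != l -> A i j `&` A k l = set0) ->
  drawable K G g -> exists gam X Y, @weak_K3n K g n gam X Y.
Proof.
move=> lA dA [pt [arc [pt_inj ptS arcP meet]]].
pose region (B : set (vertex G)) : set (K * K * K) :=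
  [set p | exists u v, [/\ B u, B v, adj u v & arc u v p]].
have join (B : set (vertex G)) u v : link B u v -> joined (region B) (pt u) (pt v).
  elim=> {u v} [u v Bu Bv uv|u v w _ H1 _ H2]; last exact: joined_trans H1 H2.
  have [[f [fc _ f0 f1 fA]] _ _ _] := arcP u v uv.
  exists f; split=> //; first exact: is_path_within.
  by move=> t t01; exists u, v; split=> //; rewrite fA; exists t.
have /choice [gam gamP] : forall a : 'I_3 * 'I_n, exists f : K -> K * K * K,
    [/\ is_path f, f 0 = pt (x a.1), f 1 = pt (y a.2) &
        forall t, t \in `[0, 1] -> region (A a.1 a.2) (f t)].
  by move=> [i j]; exact: join.
exists (fun i j => gam (i, j)), (pt \o x), (pt \o y); split.
- by move=> i j; case: (gamP (i, j)).
- move=> i j t t01; have [_ _ _ /(_ t t01)[u [v [_ _ uv]]]] := gamP (i, j).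
  by have [_ aS _ _] := arcP u v uv; exact: aS.
- by move=> i j; case: (gamP (i, j)).
- move=> i j k l s t ik jl s01 t01 eqg.
  have [_ _ _ /(_ s s01)[u [v [Au Av uv arc1]]]] := gamP (i, j).
  have [_ _ _ /(_ t t01)[u' [v' [Au' Av' uv' arc2]]]] := gamP (k, l).
  have dis w : A i j w -> A k l w -> False.
    by move=> Aw Aw'; have := dA i j k l ik jl; rewrite -subset0 => /(_ w); apply.
  have ne : [set u; v] <> [set u'; v'].
    move=> E; have : [set u; v] u by left.
    by rewrite E => -[uu|uu]; apply: (dis u) => //; rewrite uu.
  rewrite -eqg in arc2.
  have [w [wl wr] _] := meet _ _ _ _ uv uv' ne _ (conj arc1 arc2).
  by apply: (dis w); [case: wl => ->|case: wr => ->].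
Qed.

End NoK3n.

(** The drawing of the finite subgraph induced on the union of the links turns each
    link into a path in the union of the arcs of its edges; arcs of disjoint links
    do not meet since they have no end in common. *)
Lemma embeds_links_bound (K : realType) (G : graph) (g : nat) : exists n, embeds K G g ->
  forall (x : 'I_3 -> vertex G) (y : 'I_n -> vertex G)
    (A : 'I_3 -> 'I_n -> set (vertex G)),
  (forall i j, finite_set (A i j)) ->
  (forall i j, link (A i j) (x i) (y j)) ->
  (forall i j k l, i != k -> j != l -> A i j `&` A k l = set0) -> False.
Proof.
have [n nP] := weak_K3n_bound K g.
exists n => emb x y A fA lA dA.
pose B : set (vertex G) := \bigcup_(a in [set: 'I_3 * 'I_n]) A a.1 a.2.
have fB : finite_set B.
  by apply: bigcup_finite => // a _; exact: fA.
have dH := emb _ (finite_induced fB) (subgraph_induced B).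
case: n nP x y A fA lA dA @B fB dH => [|n] nP x y A fA lA dA B fB dH.
  apply: (nP (fun _ _ _ => (0, 0, 0)) (fun _ => (0, 0, 0)) (fun _ => (0, 0, 0))).
  by split=> i [].
have xB i : B (x i) by exists (i, ord0) => //; exact: (link_ends (lA i ord0)).1.
have yB j : B (y j) by exists (ord0, j) => //; exact: (link_ends (lA ord0 j)).2.
have ABj i j : A i j `<=` B by move=> v Av; exists (i, j).
pose hx i : vertex (induced B) := exist _ (x i) (xB i).
pose hy j : vertex (induced B) := exist _ (y j) (yB j).
have [||gam [X [Y]]] := @drawable_links_weak_K3n K (induced B) g n.+1 hx hy
  (fun i j => sval @^-1` A i j) _ _ dH; last exact: nP.
- move=> i j; apply: (@link_induced G (A i j) B) => //.
  + by move=> v Bv; exists (exist _ v Bv).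
  + by move=> [u ?] [v ?] /= uv; exact: eq_exist.
- by move=> i j k l ik jl; rewrite -preimage_setI dA // preimage_set0.
Qed.

(** * Drawing the figures on the sphere *)

Section PlanarDrawing.
Variable K : realType.
Implicit Types (u z : K).

(** The half y >= 0 of the unit sphere, with u constant along meridians and z
    constant along parallels. *)
Definition sph u z : K * K * K :=
  (u * Num.sqrt (1 - z ^+ 2), Num.sqrt (1 - u ^+ 2) * Num.sqrt (1 - z ^+ 2), z).

Lemma sph_surface u z : -1 <= u <= 1 -> -1 <= z <= 1 -> surface 0 (sph u z).
Proof.
move=> /andP[? ?] /andP[? ?]; rewrite /surface /sph /= big_ord0 mulr1.
rewrite muln0 add0n expr1n !exprMn !sqr_sqrtr; [ring|nra|nra].
Qed.

Lemma sph_inj u z u' z' : sph u z = sph u' z' ->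
  z = z' /\ (-1 < z < 1 -> u = u').
Proof.
rewrite /sph => -[uu _ zz]; subst z'; split=> // /andP[? ?].
have s0 : Num.sqrt (1 - z ^+ 2) != 0 by rewrite gt_eqF // sqrtr_gt0; nra.
exact: (mulIf s0 uu).
Qed.

Lemma sph_pole u u' z : z ^+ 2 = 1 -> sph u z = sph u' z.
Proof. by move=> z1; rewrite /sph z1 subrr sqrtr0 !mulr0. Qed.

Lemma continuous_semicircle : continuous (fun z : K => Num.sqrt (1 - z ^+ 2)).
Proof.
move=> z; apply: (@continuous_comp _ _ _ (fun z : K => 1 - z ^+ 2)).
  exact: (cvgB (@cvg_cst _ (1 : K) _ _ _) (@exprn_continuous K 2 z)).
exact: sqrt_continuous.
Qed.

Lemma continuous_pair (T : topologicalType) (U W : topologicalType)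
    (a : T -> U) (b : T -> W) :
  continuous a -> continuous b -> continuous (fun t => (a t, b t)).
Proof. by move=> ca cb t; exact: cvg_pair (ca t) (cb t). Qed.

Lemma sph_continuousr u : continuous (sph u).
Proof.
have cs := continuous_semicircle.
apply: continuous_pair; last by move=> z; exact: cvg_id.
by apply: continuous_pair => z; exact: (cvgM (@cvg_cst _ (_ : K) _ _ _) (cs z)).
Qed.

Lemma sph_continuousl z : continuous (sph^~ z).
Proof.
have cs := continuous_semicircle.
apply: continuous_pair; last by move=> u; exact: cvg_cst.
apply: continuous_pair => u.
  exact: (cvgM (@cvg_id _ _) (@cvg_cst _ (_ : K) _ _ _)).
exact: (cvgM (cs u) (@cvg_cst _ (_ : K) _ _ _)).
Qed.

Lemma arc_param (phi : K -> K * K * K) (a b : K) : continuous phi ->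
  (forall s t, a <= s <= b -> a <= t <= b -> phi s = phi t -> s = t) -> a < b ->
  is_arc (phi @` [set t | a <= t <= b]) (phi a) (phi b) /\
  is_arc (phi @` [set t | a <= t <= b]) (phi b) (phi a).
Proof.
move=> phic inj ab.
suff gen c d : (c = a /\ d = b) \/ (c = b /\ d = a) ->
    is_arc (phi @` [set t | a <= t <= b]) (phi c) (phi d).
  by split; apply: gen; [left|right].
move=> cd; have cd0 : d - c != 0.
  by case: cd => -[-> ->]; rewrite subr_eq0 ?(gt_eqF ab) ?(lt_eqF ab).
have inab t : 0 <= t <= 1 -> a <= c + (d - c) * t <= b.
  by move=> /andP[? ?]; case: cd => -[-> ->]; apply/andP; split; nra.
exists (fun t => phi (c + (d - c) * t)); split.
- apply: continuous_subspaceT => t.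
  apply: (@continuous_comp _ _ _ (fun t => c + (d - c) * t)); last exact: phic.
  exact: (cvgD (@cvg_cst _ c _ _ _) (cvgM (@cvg_cst _ (d - c) _ _ _) (@cvg_id _ _))).
- move=> s t; rewrite !inE /= !in_itv /= => s01 t01 /inj.
  by move=> /(_ (inab _ s01) (inab _ t01)) /addrI /(mulfI cd0).
- by rewrite mulr0 addr0.
- by rewrite mulr1 addrC subrK.
- apply/seteqP; split=> [p [t tab <-]|p [t t01 <-]].
    exists ((t - c) / (d - c)); last by rewrite mulrC divfK // addrC subrK.
    rewrite /= in_itv /=; move: tab => /= /andP[? ?].
    have [dc|dc] : 0 < d - c \/ d - c < 0.
    + by case: (ltgtP (d - c) 0) cd0 => // ?; [right|left].
    + by rewrite ler_pdivlMr // ler_pdivrMr //; case: cd => -[? ?]; subst c d; lra.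
    + by rewrite ler_ndivlMr // ler_ndivrMr //; case: cd => -[? ?]; subst c d; lra.
  exists (c + (d - c) * t) => //=; apply: inab.
  by move: t01; rewrite /= in_itv.
Qed.

(** An increasing sequence in [0, 1[, which leaves the meridian u = -1 free for the
    edge between the two poles. *)
Definition longitude (n : nat) : K := 1 - n.+1%:R^-1.

Lemma longitude_lt n n' : (n < n')%N -> longitude n < longitude n'.
Proof.
by move=> nn; rewrite ltrD2l ltrN2 ltf_pV2 ?posrE ?ltr0n // ltr_nat ltnS.
Qed.

Lemma longitude_le n n' : longitude n <= longitude n' -> (n <= n')%N.
Proof. by rewrite leqNgt; apply: contraL => /longitude_lt; rewrite -ltNge. Qed.

Lemma longitude_inj : injective longitude.
Proof.
by move=> n n' e; apply/eqP; rewrite eqn_leq !longitude_le ?e.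
Qed.

Lemma longitude_itv n : 0 <= longitude n < 1.
Proof.
rewrite /longitude subr_ge0 invf_le1 ?ltr0n // ler1n /=.
by rewrite ltrBlDr ltrDl invr_gt0 ltr0n.
Qed.

Let V := fig3_vertex nat void void.
Local Notation pair k s := (@F3pair nat void void k s).

(** The vertices on the equator, from west to east: the two members of a pair are
    consecutive, so that the edge between them is an arc of the equator. *)
Definition book_node (n : nat) : V := pair n./2 (odd n).

Definition book_pt (v : V) : K * K * K :=
  match v with
  | F3c => sph 0 1
  | F3d => sph 0 (-1)
  | F3pair k s => sph (longitude (s + k.*2)) 0
  | _ => sph 0 0
  end.

Lemma book_pt_node n : book_pt (book_node n) = sph (longitude n) 0.
Proof. by rewrite /= odd_double_half. Qed.

Inductive book_edge := Spine | Upper of nat | Lower of nat | Rung of nat.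

Definition edge_ends (e : book_edge) : V * V :=
  match e with
  | Spine => (F3c, F3d)
  | Upper n => (F3c, book_node n)
  | Lower n => (F3d, book_node n)
  | Rung k => (pair k false, pair k true)
  end.

(** The edges in the coordinates (u, z): segments of meridians or of the equator. *)
Definition edge_cell (e : book_edge) : set (K * K) :=
  match e with
  | Spine => [set c | c.1 = -1 /\ -1 <= c.2 <= 1]
  | Upper n => [set c | c.1 = longitude n /\ 0 <= c.2 <= 1]
  | Lower n => [set c | c.1 = longitude n /\ -1 <= c.2 <= 0]
  | Rung k => [set c | longitude k.*2 <= c.1 <= longitude k.*2.+1 /\ c.2 = 0]
  end.

Definition edge_arc (e : book_edge) : set (K * K * K) :=
  [set sph c.1 c.2 | c in edge_cell e].

Definition edge_of (u v : V) : book_edge :=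
  match u, v with
  | F3c, F3pair k s | F3pair k s, F3c => Upper (s + k.*2)
  | F3d, F3pair k s | F3pair k s, F3d => Lower (s + k.*2)
  | F3pair k _, F3pair _ _ => Rung k
  | _, _ => Spine
  end.

Lemma book_nodeE k (s : bool) : book_node (s + k.*2) = pair k s.
Proof. by rewrite /book_node half_bit_double oddD odd_double addbF oddb. Qed.

Lemma edge_ofP (u v : V) : fig3_adj u v ->
  edge_ends (edge_of u v) = (u, v) \/ edge_ends (edge_of u v) = (v, u).
Proof.
case: u v => [||k s|[]|[]] [||k' s'|[]|[]] //=;
  rewrite ?book_nodeE; do ?[by left|by right].
by case: s s' => [] [] [-> //]; [right|left].
Qed.

Lemma edge_ofC (u v : V) : fig3_adj u v -> edge_of u v = edge_of v u.
Proof. by case: u v => [||k s|[]|[]] [||k' s'|[]|[]] //= [->]. Qed.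

Lemma edge_arc_is_arc e :
  is_arc (edge_arc e) (book_pt (edge_ends e).1) (book_pt (edge_ends e).2) /\
  is_arc (edge_arc e) (book_pt (edge_ends e).2) (book_pt (edge_ends e).1).
Proof.
have vert u (a b : K) (E : set (K * K)) : E = [set c | c.1 = u /\ a <= c.2 <= b] ->
    [set sph c.1 c.2 | c in E] = sph u @` [set t | a <= t <= b].
  move=> ->; apply/seteqP; split=> p.
    by move=> [[? z] [/= -> ?] <-]; exists z.
  by move=> [z ? <-]; exists (u, z).
have inj u (s t : K) : sph u s = sph u t -> s = t by move=> /sph_inj[].
case: e => [|n|n|k]; rewrite /edge_arc.
- rewrite (vert (-1) (-1) 1) //= (@sph_pole 0 (-1) 1) ?expr1n //.
  rewrite (@sph_pole 0 (-1) (-1)) ?sqrrN ?expr1n //.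
  have [] // := arc_param (sph_continuousr (u := -1))
    (fun s t _ _ => inj (-1) s t) (lt_trans (ltrN10 K) ltr01).
- rewrite (vert (longitude n) 0 1) // book_pt_node /=.
  rewrite (@sph_pole 0 (longitude n) 1) ?expr1n //.
  by have [] := arc_param (sph_continuousr (u := longitude n))
    (fun s t _ _ => inj _ s t) ltr01.
- rewrite (vert (longitude n) (-1) 0) // book_pt_node /=.
  rewrite (@sph_pole 0 (longitude n) (-1)) ?sqrrN ?expr1n //.
  by have [] := arc_param (sph_continuousr (u := longitude n))
    (fun s t _ _ => inj _ s t) (ltrN10 K).
- have -> : [set sph c.1 c.2 | c in edge_cell (Rung k)] =
    (sph^~ 0) @` [set t | longitude k.*2 <= t <= longitude k.*2.+1].
    apply/seteqP; split=> p.
      by move=> [[u ?] [/= ? ->] <-]; exists u.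
    by move=> [u ? <-]; exists (u, 0).
  apply: (@arc_param (sph^~ 0)).
  + exact: sph_continuousl.
  + by move=> s t _ _ /sph_inj[_]; apply; lra.
  + exact: longitude_lt.
Qed.

Lemma edge_arc_surface e : edge_arc e `<=` surface 0.
Proof.
move=> _ [[u z] cell <-].
suff [] : -1 <= u <= 1 /\ -1 <= z <= 1 by exact: sph_surface.
have L n : 0 <= longitude n /\ longitude n < 1 by exact/andP/longitude_itv.
case: e cell => [|n|n|k] /= [].
- by move=> -> zz; split=> //; apply/andP; lra.
- move=> -> /andP[? ?]; have [? ?] := L n.
  by split; apply/andP; lra.
- move=> -> /andP[? ?]; have [? ?] := L n.
  by split; apply/andP; lra.
- move=> /andP[? ?] ->; have [? _] := L k.*2; have [_ ?] := L k.*2.+1.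
  by split; apply/andP; lra.
Qed.

Lemma edge_arc_pt e w : edge_arc e (book_pt w) ->
  w = (edge_ends e).1 \/ w = (edge_ends e).2.
Proof.
have L n : -1 < longitude n by have := longitude_itv n; lra.
move=> [[u z] cell]; case: w => [||k s|[]|[]] /= /sph_inj[/= zz uu].
- case: e cell => [|n|n|k] /= [] => [_ _|_ _|_ /andP[? ?]|_ ?]; do ?by left.
    by exfalso; lra.
  by exfalso; lra.
- case: e cell => [|n|n|k] /= [] => [_ _|_ /andP[? ?]|_ _|_ ?];
    do ?[by left|by right].
    by exfalso; lra.
  by exfalso; lra.
have {}uu : u = longitude (s + k.*2) by apply: uu; lra.
case: e cell => [|n|n|k'] /= [].
- by move=> u1; exfalso; have := L (s + k.*2)%N; rewrite -uu; lra.
- by move=> un _; right; rewrite -(@longitude_inj (s + k.*2)%N n) ?book_nodeE // -uu.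
- by move=> un _; right; rewrite -(@longitude_inj (s + k.*2)%N n) ?book_nodeE // -uu.
rewrite uu => /andP[/longitude_le l1 /longitude_le l2] _.
have <- : k = k' by case: s {uu} l1 l2; lia.
by case: (s); [right|left].
Qed.

Lemma edge_arc_meet e e' p : e <> e' -> edge_arc e p -> edge_arc e' p ->
  exists v, [/\ v = (edge_ends e).1 \/ v = (edge_ends e).2,
    v = (edge_ends e').1 \/ v = (edge_ends e').2 & book_pt v = p].
Proof.
move=> ne [[u z] cell <-] [[u' z'] cell'] /= /esym /sph_inj[/esym zz uu].
subst z'; have L n : 0 <= longitude n by case/andP: (longitude_itv n).
have [z1|z1] := eqVneq z 1.
  exists F3c; split; [| |by rewrite z1 /=; apply: sph_pole; rewrite expr1n].
  - by case: e {ne} cell => [|n|n|k] /= [];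
      do ?[by left|move=> _ /andP[? ?]|move=> _ ?]; exfalso; lra.
  - by case: e' {ne} cell' => [|n|n|k] /= [];
      do ?[by left|move=> _ /andP[? ?]|move=> _ ?]; exfalso; lra.
have [z2|z2] := eqVneq z (-1).
  exists F3d; split;
    [| |by rewrite z2 /=; apply: sph_pole; rewrite sqrrN expr1n].
  - by case: e {ne} cell => [|n|n|k] /= [];
      do ?[by left|by right|move=> _ /andP[? ?]|move=> _ ?]; exfalso; lra.
  - by case: e' {ne} cell' => [|n|n|k] /= [];
      do ?[by left|by right|move=> _ /andP[? ?]|move=> _ ?]; exfalso; lra.
have zin : -1 < z < 1.
  have [? ?] : -1 <= z /\ z <= 1.
    case: e {ne} cell => [|n|n|k] /= [].
    + by move=> _ /andP[].
    + by move=> _ /andP[? ?]; split; lra.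
    + by move=> _ /andP[? ?]; split; lra.
    + by move=> _ ->; split; lra.
  by rewrite !lt_neqAle [-1 == _]eq_sym z1 z2; apply/andP.
have {}uu := uu zin; subst u'.
have rung n k : longitude k.*2 <= longitude n <= longitude k.*2.+1 ->
    book_node n = pair k false \/ book_node n = pair k true.
  move=> /andP[/longitude_le l1 /longitude_le l2].
  have [->|->] : n = (false + k.*2)%N \/ n = (true + k.*2)%N by lia.
    by left; exact: book_nodeE.
  by right; exact: book_nodeE.
have node n : u = longitude n -> z = 0 -> book_pt (book_node n) = sph u z.
  by move=> -> ->; exact: book_pt_node.
case: e ne cell => [|n|n|k] ne [/= c1 c2];
  case: e' ne cell' => [|n'|n'|k'] ne [/= c1' c2'] //.
- by exfalso; have := L n'; lra.
- by exfalso; have := L n'; lra.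
- by exfalso; have := L k'.*2; lra.
- by exfalso; have := L n; lra.
- by case: ne; rewrite c1 in c1'; rewrite (longitude_inj c1').
- exists (book_node n); split; first by right.
    by right; rewrite c1 in c1'; rewrite (longitude_inj c1').
  by apply: node => //; lra.
- exists (book_node n); split; [by right|by apply: rung; rewrite -c1|exact: node].
- by exfalso; have := L n; lra.
- exists (book_node n); split; first by right.
    by right; rewrite c1 in c1'; rewrite (longitude_inj c1').
  by apply: node => //; lra.
- by case: ne; rewrite c1 in c1'; rewrite (longitude_inj c1').
- exists (book_node n); split; [by right|by apply: rung; rewrite -c1|exact: node].
- by exfalso; have := L k.*2; lra.
- exists (book_node n'); split; [by apply: rung; rewrite -c1'|by right|exact: node].
- exists (book_node n'); split; [by apply: rung; rewrite -c1'|by right|exact: node].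
- case: ne; congr Rung.
  move: c1 c1' => /andP[a1 a2] /andP[a3 a4].
  have /longitude_le := le_trans a1 a4; have /longitude_le := le_trans a3 a2.
  by lia.
Qed.

Lemma book_pt_inj : injective book_pt.
Proof.
have L n : 0 <= longitude n by case/andP: (longitude_itv n).
move=> [||k s|[]|[]] [||k' s'|[]|[]] //= /sph_inj[zz uu]; do ?by exfalso; lra.
have /longitude_inj kk : longitude (s + k.*2) = longitude (s' + k'.*2).
  by apply: uu; lra.
by rewrite -!book_nodeE kk.
Qed.

(** The poles are joined to each other and to the points of the equator by meridians;
    two of these arcs meet only at a pole, at a point of the equator where an upper
    and a lower half of a meridian join, or at an end of an arc of the equator. *)
Lemma book_drawable : drawable K (fig3 nat void void) 0.
Proof.
exists book_pt, (fun u v : V => edge_arc (edge_of u v)); split.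
- exact: book_pt_inj.
- have L n : 0 <= longitude n /\ longitude n < 1 by exact/andP/longitude_itv.
  move=> [||k s|[]|[]] /=; apply: sph_surface; try (apply/andP; lra).
  by have [? ?] := L (s + k.*2)%N; apply/andP; lra.
- move=> u v uv; split.
  + have [a1 a2] := edge_arc_is_arc (edge_of u v).
    by case: (edge_ofP uv) => E; move: a1 a2; rewrite E.
  + exact: edge_arc_surface.
  + by rewrite edge_ofC.
  + move=> w /edge_arc_pt; case: (edge_ofP uv) => -> /= [] ->;
      by [left|right].
- move=> u v u' v' uv uv' ne p [Ap Ap'].
  have ne' : edge_of u v <> edge_of u' v'.
    move=> E; apply: ne.
    have setC (a b : V) : [set a; b] = [set b; a] by rewrite setUC.
    case: (edge_ofP uv) (edge_ofP uv') => E1 [] E2;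
      move: E1; rewrite E E2 => -[-> ->] //.
  have [w [w1 w2 wp]] := edge_arc_meet ne' Ap Ap'.
  exists w => //; split.
  + by move: w1; case: (edge_ofP uv) => -> /= [] ->; by [left|right].
  + by move: w2; case: (edge_ofP uv') => -> /= [] ->; by [left|right].
Qed.

End PlanarDrawing.

Section PlanarFigures.
Variable K : realType.

Lemma subgraph_trans (G1 G2 G3 : graph) :
  subgraph G1 G2 -> subgraph G2 G3 -> subgraph G1 G3.
Proof.
move=> [f [fi fa]] [h [hi ha]]; exists (h \o f); split; first exact: inj_comp.
by move=> u v /fa/ha.
Qed.

Lemma fig1_fig3 A B : subgraph (fig1 A B) (fig3 void A B).
Proof.
exists (fun v : fig1_vertex A B => match v with
  | F1c => F3c | F1d => F3d | F1cd a => @F3cd void A B a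
  | F1leaf b => @F3leaf void A B b end).
split; first by case=> [||a|b] [||a'|b'] //= [->].
by case=> [||a|b] [||a'|b'].
Qed.

Lemma fig2_fig3 A B : subgraph (fig2 A B) (fig3 A void B).
Proof.
exists (fun v : fig2_vertex A B => match v with
  | F2c => F3c | F2pair a s => @F3pair A void B a s
  | F2leaf b => @F3leaf A void B b end).
split; first by case=> [|a s|b] [|a' s'|b'] //= [] => [-> ->|->].
by case=> [|a s|b] [|a' s'|b'].
Qed.

(** A finite subgraph uses finitely many of the unlabelled vertices, which can be
    numbered; a vertex adjacent to one or both centres only is sent to one member of
    a pair of its own. *)
Lemma fig3_embeds A B C : embeds K (fig3 A B C) 0.
Proof.
move=> H fH [f [f_inj f_adj]].
pose key (v : fig3_vertex A B C) : option (A + B + C) := match v with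
  | F3pair i _ => Some (inl (inl i)) | F3cd b => Some (inl (inr b))
  | F3leaf l => Some (inr l) | _ => None end.
pose S : set (option (A + B + C)) := (key \o f) @` [set: vertex H].
have /finite_set_countable/pcard_injP[nu nuP] : finite_set S by exact: finite_image.
pose side (v : fig3_vertex A B C) := if v is F3pair _ s then s else true.
pose h (v : fig3_vertex A B C) : fig3_vertex nat void void := match v with
  | F3c => F3c | F3d => F3d
  | _ => @F3pair nat void void (nu (key v)) (side v) end.
apply: drawable_subgraph (book_drawable K); exists (h \o f).
have inS v : key (f v) \in S by rewrite inE; exists v.
split=> [u v|u v uv].
  move=> huv; apply: f_inj; move: huv (nuP _ _ (inS u) (inS v)) => /=.
  by case: (f u) (f v) => [||i s|i|i] [||i' s'|i'|i'] //= [];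
    (move=> nn /(_ nn) || move=> nn ss /(_ nn)) => -[] // -> //; rewrite ss.
by move: (f_adj _ _ uv) => /=; case: (f u) (f v) => [||i s|i|i] [||i' s'|i'|i'] //= [-> ?].
Qed.

Lemma planar_of_fig3 A B C G : subgraph G (fig3 A B C) -> has_genus K G 0.
Proof.
move=> sub; split=> // H fH HG; apply: (@fig3_embeds A B C) => //.
exact: subgraph_trans sub.
Qed.

End PlanarFigures.

(** * Ideals of Noetherian local rings *)

Section IdealTheory.
Variable R : comNzRingType.
Implicit Types (I J L M : set R) (a b x y : R) (s : seq R).

Lemma idl0 I : is_ideal I -> I 0. Proof. by case. Qed.

Lemma idlD I x y : is_ideal I -> I x -> I y -> I (x + y).
Proof. by case=> _ + _; apply. Qed.

Lemma idlM I a x : is_ideal I -> I x -> I (a * x).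
Proof. by case=> _ _; apply. Qed.

Lemma idlMr I a x : is_ideal I -> I x -> I (x * a).
Proof. by move=> Ii Ix; rewrite mulrC; exact: idlM. Qed.

Lemma idlN I x : is_ideal I -> I x -> I (- x).
Proof. by move=> Ii Ix; rewrite -mulN1r; exact: idlM. Qed.

Lemma idlB I x y : is_ideal I -> I x -> I y -> I (x - y).
Proof. by move=> Ii Ix Iy; apply: idlD => //; exact: idlN. Qed.

Lemma idl_full I : is_ideal I -> I 1 -> I = [set: R].
Proof.
by move=> Ii I1; apply/seteqP; split=> // x _; rewrite -[x]mulr1; exact: idlM.
Qed.

Lemma is_ideal0 : is_ideal [set (0 : R)].
Proof.
by split=> //= [x y -> ->|a x ->]; rewrite ?addr0 ?mulr0.
Qed.

Lemma is_idealT : is_ideal [set: R].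
Proof. by split. Qed.

Lemma idl_neq0 I : is_ideal I -> I <> [set 0] -> exists2 x, I x & x <> 0.
Proof.
move=> Ii I0; apply: contrapT => H; apply: I0; apply/seteqP; split=> x /=.
  by move=> Ix; apply: contrapT => x0; apply: H; exists x.
by move=> ->; exact: idl0.
Qed.

Lemma neq0_idl I x : I x -> x <> 0 -> I <> [set 0].
Proof. by move=> Ix x0 I0; move: Ix; rewrite I0. Qed.

Lemma is_ideal_principal x : is_ideal (principal x).
Proof.
split; first by exists 0 => //; rewrite mul0r.
  by move=> _ _ [a _ <-] [b _ <-]; exists (a + b); rewrite ?mulrDl.
by move=> a _ [b _ <-]; exists (a * b); rewrite ?mulrA.
Qed.

Lemma principal_self x : principal x x.
Proof. by exists 1; rewrite ?mul1r. Qed.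

Lemma principal_sub I x : is_ideal I -> I x -> principal x `<=` I.
Proof. by move=> Ii Ix _ [a _ <-]; exact: idlM. Qed.

Lemma principal_neq0 x : x <> 0 -> principal x <> [set 0].
Proof. exact: neq0_idl (principal_self x). Qed.

Lemma is_ideal_annihilator (X : set R) : is_ideal (annihilator X).
Proof.
split=> /=; first by move=> x _; rewrite mul0r.
  by move=> a b Ha Hb x Xx; rewrite mulrDl Ha // Hb // addr0.
by move=> a b Hb x Xx; rewrite -mulrA Hb // mulr0.
Qed.

Definition ideal_add I J : set R := [set x + y | x in I & y in J].

Lemma is_ideal_add I J : is_ideal I -> is_ideal J -> is_ideal (ideal_add I J).
Proof.
move=> Ii Ji; split.
- by exists 0; [exact: idl0|exists 0; [exact: idl0|rewrite addr0]].
- move=> _ _ [x Ix [y Jy <-]] [x' Ix' [y' Jy' <-]].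
  exists (x + x'); first exact: idlD.
  by exists (y + y'); [exact: idlD|rewrite addrACA].
- move=> a _ [x Ix [y Jy <-]]; exists (a * x); first exact: idlM.
  by exists (a * y); [exact: idlM|rewrite mulrDr].
Qed.

Lemma ideal_addl I J : is_ideal J -> I `<=` ideal_add I J.
Proof. by move=> Ji x Ix; exists x => //; exists 0; [exact: idl0|rewrite addr0]. Qed.

Lemma ideal_addr I J : is_ideal I -> J `<=` ideal_add I J.
Proof. by move=> Ii x Jx; exists 0; [exact: idl0|exists x => //; rewrite add0r]. Qed.

Lemma ideal_add_sub I J L : is_ideal L ->
  I `<=` L -> J `<=` L -> ideal_add I J `<=` L.
Proof. by move=> Li IL JL _ [x Ix [y Jy <-]]; exact: idlD Li (IL _ Ix) (JL _ Jy). Qed.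

Lemma is_ideal_cap I J : is_ideal I -> is_ideal J -> is_ideal (I `&` J).
Proof.
move=> Ii Ji; split; first by split; exact: idl0.
  by move=> x y [Ix Jx] [Iy Jy]; split; exact: idlD.
by move=> a x [Ix Jx]; split; exact: idlM.
Qed.

Lemma ideal_mul_sub I J L : is_ideal L ->
  (forall a b, I a -> J b -> L (a * b)) -> ideal_mul I J `<=` L.
Proof.
move=> Li H _ [n [a [b [ab ->]]]]; elim/big_ind : _ => [||i _].
- exact: idl0.
- by move=> x y; exact: idlD.
- by apply: H; case: (ab i).
Qed.

Lemma mem_ideal_mul I J a b : I a -> J b -> ideal_mul I J (a * b).
Proof.
by move=> Ia Jb; exists 1%N, (fun=> a), (fun=> b); rewrite big_ord1; split.
Qed.

Lemma is_ideal_mul I J : is_ideal I -> is_ideal (ideal_mul I J).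
Proof.
move=> Ii; split.
- by exists 0%N, (fun=> 0), (fun=> 0); rewrite big_ord0; split=> // -[].
- move=> _ _ [n [a [b [ab ->]]]] [n' [a' [b' [ab' ->]]]].
  exists (n + n')%N,
    (fun i => match fintype.split i with inl j => a j | inr j => a' j end),
    (fun i => match fintype.split i with inl j => b j | inr j => b' j end).
  split; first by move=> i; case: fintype.split.
  rewrite big_split_ord /=; congr (_ + _); apply: eq_bigr => i _.
    by rewrite (unsplitK (inl i)).
  by rewrite (unsplitK (inr i)).
- move=> c _ [n [a [b [ab ->]]]].
  exists n, (fun i => c * a i), b; split; last first.
    by rewrite mulr_sumr; apply: eq_bigr => i _; rewrite mulrA.
  by move=> i; have [? ?] := ab i; split=> //; exact: idlM.
Qed.

Lemma ideal_mul_eq0 I J : (forall a b, I a -> J b -> a * b = 0) ->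
  ideal_mul I J = [set 0].
Proof.
move=> H; apply/seteqP; split.
  by apply: ideal_mul_sub => [|a b Ia Jb]; [exact: is_ideal0|rewrite H].
by move=> _ ->; exists 0%N, (fun=> 0), (fun=> 0); rewrite big_ord0; split=> // -[].
Qed.

Lemma ideal_mul0 I J a b : ideal_mul I J = [set 0] -> I a -> J b -> a * b = 0.
Proof. by move=> E Ia Jb; have := mem_ideal_mul Ia Jb; rewrite E. Qed.

Lemma is_ideal_pow M n : is_ideal M -> is_ideal (ideal_pow M n).
Proof. by move=> Mi; case: n => [|n]; [exact: is_idealT|exact: is_ideal_mul]. Qed.

Lemma ideal_pow1 M : is_ideal M -> ideal_pow M 1 = M.
Proof.
move=> Mi; apply/seteqP; split=> [|x Mx].
  by apply: ideal_mul_sub => // a b Ma _; exact: idlMr.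
by rewrite -[x]mulr1; exact: mem_ideal_mul.
Qed.

Lemma ideal_powSl M n x y : M x -> ideal_pow M n y -> ideal_pow M n.+1 (x * y).
Proof. exact: mem_ideal_mul. Qed.

Lemma ideal_powM M i j x y : is_ideal M -> ideal_pow M i x -> ideal_pow M j y ->
  ideal_pow M (i + j) (x * y).
Proof.
move=> Mi; elim: i x => [|i IHi] x Ix Jy.
  by apply: idlM => //; exact: is_ideal_pow.
have Li : is_ideal [set z | ideal_pow M (i.+1 + j) (z * y)].
  have Pi := is_ideal_pow (i.+1 + j) Mi.
  split=> /= [|u v Hu Hv|a u Hu]; rewrite ?mul0r ?mulrDl -?mulrA.
  - exact: idl0.
  - exact: idlD.
  - exact: idlM.
apply: (ideal_mul_sub Li) Ix => a b Ma Pb /=.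
by rewrite -mulrA; apply: (@ideal_powSl M (i + j)%N) => //; exact: IHi.
Qed.

Lemma ideal_pow_le M n k : is_ideal M -> (n <= k)%N ->
  ideal_pow M k `<=` ideal_pow M n.
Proof.
move=> Mi /subnK <-; elim: (k - n)%N => [//|d IHd].
apply: ideal_mul_sub => [|a b Ma Pb]; first exact: is_ideal_pow.
by apply: idlM; [exact: is_ideal_pow|exact: IHd].
Qed.

Fixpoint comb (C : set R) s : set R :=
  if s is a :: s' then [set c * a + y | c in C & y in comb C s'] else [set 0].

Definition span s : set R := comb [set: R] s.

Lemma comb_ideal C s : is_ideal C -> is_ideal (comb C s).
Proof.
move=> Ci; elim: s => [|a s IH]; first exact: is_ideal0.
split.
- by exists 0; [exact: idl0|exists 0; [exact: idl0|rewrite mul0r addr0]].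
- move=> _ _ [c Cc [y Sy <-]] [c' Cc' [y' Sy' <-]].
  exists (c + c'); first exact: idlD.
  by exists (y + y'); [exact: idlD|rewrite mulrDl addrACA].
- move=> r _ [c Cc [y Sy <-]]; exists (r * c); first exact: idlM.
  by exists (r * y); [exact: idlM|rewrite mulrDr mulrA].
Qed.

Lemma is_ideal_span s : is_ideal (span s).
Proof. exact/comb_ideal/is_idealT. Qed.

Lemma mem_span s x : x \in s -> span s x.
Proof.
elim: s => // a s IH; rewrite inE => /orP[/eqP ->|/IH sx].
  by exists 1 => //; exists 0; [exact: (idl0 (is_ideal_span s))|rewrite mul1r addr0].
by exists 0 => //; exists x => //; rewrite mul0r add0r.
Qed.

Lemma span_sub I s : is_ideal I -> (forall x, x \in s -> I x) -> span s `<=` I.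
Proof.
move=> Ii; elim: s => [|a s IH] sI; first by move=> _ ->; exact: idl0.
move=> _ [c _ [y Sy <-]]; apply: idlD => //.
  by apply: idlM => //; apply: sI; exact: mem_head.
by apply: IH => // x xs; apply: sI; rewrite inE xs orbT.
Qed.

Lemma mul_span_comb C s : is_ideal C -> ideal_mul C (span s) `<=` comb C s.
Proof.
move=> Ci; apply: ideal_mul_sub; first exact: comb_ideal.
move=> a b Ca; elim: s b => [|e s IH] b; first by move=> ->; rewrite mulr0.
move=> [c _ [y Sy <-]]; exists (a * c); first exact: idlMr.
by exists (a * y); [exact: IH|rewrite mulrDr mulrA].
Qed.

End IdealTheory.

(** Dependent choice where each new value may have to satisfy a condition on all the
    earlier ones, listed by h. *)
Lemma history_choice (T : eqType) (P : seq T -> T -> Prop) :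
  (forall s, exists x, P s x) ->
  exists (f : nat -> T) (h : nat -> seq T),
    [/\ h 0%N = [::], forall n, h n.+1 = f n :: h n, forall n, P (h n) (f n) &
        forall i n, (i < n)%N -> f i \in h n].
Proof.
move=> /choice[c cP].
pose h := fix h n := if n is k.+1 then c (h k) :: h k else [::].
exists (c \o h), h; split=> // i; elim=> // n IHn.
by rewrite ltnS leq_eqVlt inE => /orP[/eqP ->|/IHn ->]; rewrite ?eqxx ?orbT.
Qed.

Section Noetherian.
Variables (R : comNzRingType) (noethR : noetherian R).
Implicit Types (I J L M m : set R) (a b x y : R) (s : seq R).

Lemma finitely_generated I : is_ideal I -> exists s, I = span s.
Proof.
move=> Ii; apply: contrapT => nfg.
have [|f [h [h0 hS hP fh]]] := @history_choice R (fun s x =>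
  (forall y, y \in s -> I y) -> I x /\ ~ span s x).
  move=> s; have [sI|] := pselect (forall y, y \in s -> I y); last by exists 0.
  apply: contrapT => H; apply: nfg; exists s; apply/seteqP; split.
    by move=> x Ix; apply: contrapT => sx; apply: H; exists x.
  exact: span_sub.
have hI n y : y \in h n -> I y.
  elim: n y => [|n IHn] y; first by rewrite h0.
  by rewrite hS inE => /orP[/eqP ->|/IHn//]; case: (hP n IHn).
have mono n : span (h n) `<=` span (h n.+1).
  apply: span_sub => [|x xs]; first exact: is_ideal_span.
  by apply: mem_span; rewrite hS inE xs orbT.
have [N NP] := noethR (fun n => is_ideal_span (h n)) mono.
have [_] := hP N (@hI N); apply; rewrite -(NP N.+1) //.
by apply: mem_span; exact: fh.
Qed.

Lemma maximal_above I : is_ideal I -> I <> [set: R] ->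
  exists2 m, maximal_ideal m & I `<=` m.
Proof.
move=> Ii IT; apply: contrapT => nmax.
pose proper := {J : set R | [/\ is_ideal J, J <> [set: R] & I `<=` J]}.
have /choice[next nextP] : forall J : proper, exists J' : proper,
    sval J `<=` sval J' /\ sval J <> sval J'.
  move=> [J [Ji JT IJ]]; apply: contrapT => H; apply: nmax; exists J => //.
  split=> // L Li JL LT; apply: contrapT => LJ; apply: H.
  have PL : [/\ is_ideal L, L <> [set: R] & I `<=` L].
    by split=> //; exact: subset_trans JL.
  by exists (exist _ L PL); split=> /= [|E]; [exact: JL|apply: LJ].
have PI : [/\ is_ideal I, I <> [set: R] & I `<=` I] by split.
pose F n : proper := iter n next (exist _ I PI).
have [|n|N /(_ N.+1 (leqnSn N))] := noethR (F := fun n => sval (F n)).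
- by move=> n; case: (svalP (F n)).
- by case: (nextP (F n)).
- by move=> /esym; case: (nextP (F N)).
Qed.

(** The generators are eliminated one at a time: the coefficient of a on the right
    lies in m and can be moved to the left, where 1 - c is a unit. *)
Lemma nakayama_seq m s J : is_ideal m -> is_ideal J ->
  (forall a, m a -> exists b, b * (1 - a) = 1) ->
  (forall x, x \in s -> ideal_add J (comb m s) x) ->
  forall x, x \in s -> J x.
Proof.
move=> mi Ji unit; elim: s => // a s IH gen.
have [j Jj [_ [c mc [y my <-]] aE]] := gen a (mem_head _ _).
have [b bc] := unit c mc.
have as' : ideal_add J (comb m s) a.
  have -> : a = b * j + b * y.
    rewrite -mulrDr -[LHS]mul1r -bc -mulrA; congr (_ * _).
    by rewrite mulrBl mul1r -{1}aE; ring.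
  exists (b * j); first exact: idlM.
  by exists (b * y) => //; apply: idlM my; exact: comb_ideal.
have sJ : forall x, x \in s -> J x.
  apply: IH => x xs.
  have Ai : is_ideal (ideal_add J (comb m s)).
    by apply: is_ideal_add => //; exact: comb_ideal.
  have [j' Jj' [_ [c' _ [y' my' <-]] <-]] := gen x (mem_behead (s := a :: s) xs).
  apply: idlD => //; first by apply: ideal_addl => //; exact: comb_ideal.
  by apply: idlD => //; [exact: idlM|exact: ideal_addr].
move=> x; rewrite inE => /orP[/eqP -> {x}|/sJ//].
apply: (ideal_add_sub Ji _ _ as') => //.
have : comb m s `<=` span s.
  elim: (s) => //= e s' IH' _ [c' _ [y' my' <-]].
  by exists c' => //; exists y' => //; exact: IH'.
by move=> /subset_trans; apply; exact: span_sub.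
Qed.

Section Local.
Variables (m : set R) (Lm : local_with m).

Lemma local_ideal : is_ideal m. Proof. by case: Lm => -[]. Qed.

Lemma local_proper : ~ m 1.
Proof. by case: Lm => -[mi mT _] _ m1; apply: mT; exact: idl_full. Qed.

Lemma proper_sub_local I : is_ideal I -> I <> [set: R] -> I `<=` m.
Proof.
by move=> Ii /(maximal_above Ii)[m' m'max Im']; case: Lm => _ /(_ _ m'max) <-.
Qed.

Lemma local_unit a : ~ m a -> exists b, b * a = 1.
Proof.
move=> ma; apply: contrapT => nu; apply: ma.
apply: (@proper_sub_local (principal a)) (principal_self a) => //.
  exact: is_ideal_principal.
move=> aT; have : principal a 1 by rewrite aT.
by move=> [b _ ba]; apply: nu; exists b.
Qed.

Lemma local_unitB a : m a -> exists b, b * (1 - a) = 1.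
Proof.
move=> ma; apply: local_unit => m1a; apply: local_proper.
by rewrite -[1](subrK a); apply: idlD ma => //; exact: local_ideal.
Qed.

Lemma nakayama M J : is_ideal M -> is_ideal J ->
  M `<=` ideal_add J (ideal_mul m M) -> M `<=` J.
Proof.
move=> Mi Ji MJ; have [s sM] := finitely_generated Mi.
rewrite sM; apply: span_sub => //.
apply: (nakayama_seq local_ideal Ji local_unitB) => x xs.
have [|j Jj [y yM <-]] := MJ x; first by rewrite sM; exact: mem_span.
exists j => //; exists y => //.
by apply: (mul_span_comb local_ideal); rewrite -sM.
Qed.

Lemma nakayama0 M : is_ideal M -> M `<=` ideal_mul m M -> M = [set 0].
Proof.
move=> Mi MM; apply/seteqP; split; last by move=> _ ->; exact: idl0.
apply: nakayama => //; first exact: is_ideal0.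
by move=> x /MM; apply: ideal_addr; exact: is_ideal0.
Qed.

(** A chain of ideals from 0 to R in which each member is J + Rx, with m x inside
    the preceding member J, is obtained by refining the chain of the powers of m. *)
Lemma nilpotent_ind (P : set R -> Prop) n : ideal_pow m n = [set 0] ->
  P [set 0] ->
  (forall J x, is_ideal J -> P J -> (forall a, m a -> J (a * x)) ->
     P (ideal_add J (principal x))) ->
  P [set: R].
Proof.
move=> mn0 P0 PS; have mi := local_ideal.
suff H k : (k <= n)%N -> P (ideal_pow m (n - k)).
  by have := H n (leqnn n); rewrite subnn.
elim: k => [|k IHk] kn; first by rewrite subn0 mn0.
have {IHk} := IHk (ltnW kn).
have -> : (n - k = (n - k.+1).+1)%N by lia.
set i := (n - k.+1)%N => Pi.
have [s sE] := finitely_generated (is_ideal_pow i mi).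
have subs : {subset s <= s} by [].
have step s' : {subset s' <= s} ->
    is_ideal (ideal_add (ideal_pow m i.+1) (span s')) /\
    P (ideal_add (ideal_pow m i.+1) (span s')).
  have Ii1 := is_ideal_pow i.+1 mi.
  elim: s' => [|a s' IH] ss'.
    suff -> : ideal_add (ideal_pow m i.+1) (span [::]) = ideal_pow m i.+1 by [].
    apply/seteqP; split=> x; last by apply: ideal_addl; exact: is_ideal0.
    by move=> [y My [_ -> <-]]; rewrite addr0.
  have [|Ji PJ] := IH; first by move=> x xs; apply: ss'; rewrite inE xs orbT.
  suff -> : ideal_add (ideal_pow m i.+1) (span (a :: s')) =
      ideal_add (ideal_add (ideal_pow m i.+1) (span s')) (principal a).
    split; first by apply: is_ideal_add => //; exact: is_ideal_principal.
    apply: PS => // c mc; apply: ideal_addl; first exact: is_ideal_span.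
    by apply: ideal_powSl => //; rewrite sE; apply/mem_span/ss'/mem_head.
  apply/seteqP; split=> x.
    move=> [u Mu [_ [c _ [y Sy <-]] <-]]; exists (u + y).
      by exists u => //; exists y.
    by exists (c * a); [exists c|rewrite addrAC addrA].
  move=> [_ [u Mu [y Sy <-]] [_ [c _ <-] <-]]; exists u => //.
  by exists (c * a + y); [exists c => //; exists y|rewrite addrA addrAC].
have [_] := step s subs.
suff -> : ideal_add (ideal_pow m i.+1) (span s) = ideal_pow m i by [].
rewrite -sE; apply/seteqP; split.
  by apply: ideal_add_sub => //; [exact: is_ideal_pow|exact: ideal_pow_le].
exact/ideal_addr/is_ideal_pow.
Qed.

(** Stationarity of the traces of F on J passes to J + Rx: either some F n meets
    J + Rx inside J, or all of them contain an element j + x with j in J. *)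
Lemma nilpotent_artinian n : ideal_pow m n = [set 0] -> artinian R.
Proof.
move=> mn0 F Fi Fdec.
have mono i j : (i <= j)%N -> F j `<=` F i.
  move=> /subnK <-; elim: (j - i)%N => // d IHd.
  by rewrite addSn; exact: subset_trans (Fdec _) IHd.
suff [N NP] : exists N, forall n, (N <= n)%N -> F n `&` [set: R] = F N `&` [set: R].
  by exists N => k Nk; have := NP k Nk; rewrite !setIT.
apply: (nilpotent_ind (P := fun J => exists N, forall n, (N <= n)%N ->
  F n `&` J = F N `&` J) mn0).
  exists 0%N => k _; rewrite ![F _ `&` _]setIC.
  by apply/seteqP; split=> x [/= -> _]; split=> //; exact: idl0.
move=> J x Ji [N NP] mxJ.
have Ai : is_ideal (ideal_add J (principal x)).
  by apply: is_ideal_add => //; exact: is_ideal_principal.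
have JA : J `<=` ideal_add J (principal x).
  exact/ideal_addl/is_ideal_principal.
have [[N' sub]|H] := pselect (exists N', F N' `&` ideal_add J (principal x) `<=` J).
  exists (maxn N N') => k; rewrite geq_max => /andP[Nk N'k].
  have E l : (N' <= l)%N -> F l `&` ideal_add J (principal x) = F l `&` J.
    move=> N'l; apply/seteqP; split=> y [Fy Jy]; split=> //; last exact: JA.
    by apply: sub; split=> //; exact: mono Fy.
  by rewrite !E ?leq_maxr // NP // NP // leq_maxl.
exists N => k Nk; apply/seteqP; split=> z [Fz Az]; split=> //; first exact: mono Fz.
have [j Jj Fjx] : exists2 j, J j & F k (j + x).
  apply: contrapT => nF; apply: H; exists k => y [Fy [j Jj [_ [c _ <-] jc]]].
  have [mc|/local_unit[b bc]] := pselect (m c).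
    by rewrite -jc; apply: idlD => //; exact: mxJ.
  case: nF; exists (b * j); first exact: idlM.
  by have := idlM b (Fi k) Fy; rewrite -jc mulrDr mulrA bc mul1r.
case: Az => j' Jj' [_ [c _ <-] zE].
have FN : F N (z - c * (j + x)).
  by apply: idlB => //; apply: idlM => //; exact: mono Fjx.
have Jd : J (z - c * (j + x)).
  have -> : z - c * (j + x) = j' - c * j by rewrite -zE; ring.
  by apply: idlB => //; exact: idlM.
have : (F k `&` J) (z - c * (j + x)) by rewrite NP.
by move=> [Fkd _]; rewrite -(subrK (c * (j + x)) z); apply: idlD => //; exact: idlM.
Qed.

Lemma finite_of_residue n (X : set R) : ideal_pow m n = [set 0] ->
  finite_set X -> (forall r, exists2 c, X c & m (r - c)) ->
  finite_set [set: R].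
Proof.
move=> mn0 fX XP; apply: (nilpotent_ind (P := fun J => finite_set J) mn0).
  exact: finite_set1.
move=> J x Ji fJ mxJ.
apply: (@sub_finite_set _ _ [set j + c * x | j in J & c in X]).
  move=> _ [j Jj [_ [r _ <-] <-]]; have [c Xc mrc] := XP r.
  exists (j + (r - c) * x); first by apply: idlD => //; exact: mxJ.
  by exists c => //; rewrite mulrBl; ring.
exact: finite_image2.
Qed.

(** Otherwise finitely many elements represent all residue classes, and R is
    finite by finite_of_residue. *)
Lemma infinite_residues n : ideal_pow m n = [set 0] -> infinite_set [set: R] ->
  exists rho : nat -> R, forall i j, (i < j)%N -> ~ m (rho j - rho i).
Proof.
move=> mn0 infR.
have [|f [h [_ _ hP fh]]] := @history_choice R
  (fun s x => forall y, y \in s -> ~ m (x - y)).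
  move=> s; apply: contrapT => H; apply: infR.
  apply: (finite_of_residue (X := [set` s]) mn0); first exact: finite_seq.
  move=> r; apply: contrapT => nc; apply: H; exists r => y ys my.
  by apply: nc; exists y.
by exists f => i j ij; apply: hP; exact: fh.
Qed.

End Local.

End Noetherian.

(** * Ideals killed by three others *)

Lemma vertex_val_inj (R : comNzRingType) (u v : vertex (AG R)) : sval u = sval v -> u = v.
Proof. by case: u v => [I ?] [J ?] /= E; exact: eq_exist. Qed.

Section Killers.
Variables (K : realType) (R : comNzRingType).
Variable fingenus : finite_genus K (AG R).
Implicit Types (I J L M m : set R) (a b x y : R).

Lemma annihilating_vertex I J : is_ideal I -> is_ideal J ->
  I <> [set 0] -> J <> [set 0] -> (forall a b, I a -> J b -> a * b = 0) ->
  AG_vertex I.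
Proof.
move=> Ii Ji I0 J0 IJ; split=> //; split=> //; exists J; split=> //.
exact: ideal_mul_eq0.
Qed.

(** The three ideals are adjacent in AG(R) to all but finitely many ideals of the
    family, so that AG(R) contains K_{3,n} for every n. *)
Lemma three_killers A1 A2 A3 (F : nat -> set R) :
  is_ideal A1 -> is_ideal A2 -> is_ideal A3 ->
  A1 <> [set 0] -> A2 <> [set 0] -> A3 <> [set 0] ->
  A1 <> A2 -> A1 <> A3 -> A2 <> A3 ->
  (forall n, is_ideal (F n)) -> injective F ->
  (forall n a b, A1 a \/ A2 a \/ A3 a -> F n b -> a * b = 0) -> False.
Proof.
move=> i1 i2 i3 n1 n2 n3 d12 d13 d23 Fi Finj kill.
have avoid T : exists N, forall n, (N <= n)%N -> F n <> T.
  have [[n0 <-]|no] := pselect (exists n, F n = T).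
    by exists n0.+1 => n n0n /Finj E; rewrite E ltnn in n0n.
  by exists 0%N => n _ FT; apply: no; exists n.
have [[N0 P0] [N1 P1]] := (avoid [set 0], avoid A1).
have [[N2 P2] [N3 P3]] := (avoid A2, avoid A3).
pose N := (N0 + N1 + N2 + N3)%N.
have [g [emb _]] := fingenus.
have [n /(_ emb) bound] := embeds_links_bound K (AG R) g.
pose A (i : 'I_3) := nth A1 [:: A1; A2; A3] i.
have Ai i : is_ideal (A i) by case: i => [[|[|[|]]]].
have A0 i : A i <> [set 0] by case: i => [[|[|[|]]]].
have Ainj : injective A.
  move=> [[|[|[|//]]] ?] [[|[|[|//]]] ?]; rewrite /A /= => E; apply: val_inj => //=;
    by move: E; do ?[move/d12|move/d13|move/d23|move/esym/d12|move/esym/d13|move/esym/d23].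
have AF i k a b : A i a -> F k b -> a * b = 0.
  move=> Aa; apply: kill; move: Aa.
  by case: i => [[|[|[|//]]]] ? /=; [left|right; left|right; right].
have F0 (j : 'I_n) : F (j + N)%N <> [set 0] by apply: P0; lia.
have FA (j : 'I_n) i : F (j + N)%N <> A i.
  by case: i => [[|[|[|//]]]] ? /=; [apply: P1|apply: P2|apply: P3]; lia.
have Av i : AG_vertex (A i).
  apply: (@annihilating_vertex _ (F N)) => //; last exact: AF.
  by apply: P0; lia.
have Fv (j : 'I_n) : AG_vertex (F (j + N)%N).
  apply: (@annihilating_vertex _ A1) => // a b Fa A1b.
  by rewrite mulrC; apply: (kill (j + N)%N) => //; left.
pose x i : vertex (AG R) := exist _ (A i) (Av i).
pose y (j : 'I_n) : vertex (AG R) := exist _ (F (j + N)%N) (Fv j).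
apply: (bound x y (fun i j => [set x i; y j])).
- by move=> i j; rewrite finite_setU; split; exact: finite_set1.
- move=> i j; apply: link_edge; [by left|by right|split].
    by move=> /(congr1 sval) /= /esym; exact: FA.
  by apply: ideal_mul_eq0 => a b /= ; exact: AF.
- move=> i j k l ik jl; rewrite -subset0 => v [] [->|->] [] /(congr1 sval) /=.
  + by move=> /Ainj E; rewrite E eqxx in ik.
  + by move=> /esym; exact: FA.
  + exact: FA.
  + by move=> /Finj/eqP; rewrite eqn_add2r => /eqP/val_inj E; rewrite E eqxx in jl.
Qed.

Lemma infinite_setE (T : pointedType) (A : set T) : infinite_set A ->
  exists2 f : nat -> T, injective f & forall n, A (f n).
Proof.
move=> /infiniteP/pcard_leP[f]; exists f => [i j|n].
  by apply: 'inj_f; rewrite inE.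
exact: funS.
Qed.

Definition subideals L : set (set R) := [set J | is_ideal J /\ J `<=` L].

Lemma finite_killed A1 A2 A3 L :
  is_ideal A1 -> is_ideal A2 -> is_ideal A3 ->
  A1 <> [set 0] -> A2 <> [set 0] -> A3 <> [set 0] ->
  A1 <> A2 -> A1 <> A3 -> A2 <> A3 ->
  (forall a b, A1 a \/ A2 a \/ A3 a -> L b -> a * b = 0) ->
  finite_set (subideals L).
Proof.
move=> i1 i2 i3 n1 n2 n3 d12 d13 d23 kill; apply: contrapT.
move=> /infinite_setE[F Finj Fsub].
apply: (@three_killers A1 A2 A3 F) => // [n|n a b Aa Fb].
  by case: (Fsub n).
by apply: kill => //; case: (Fsub n) => _; apply.
Qed.

End Killers.

(** * Rings that are not local *)

Section NonLocal.
Variables (K : realType) (R : comNzRingType).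
Hypothesis noethR : noetherian R.
Hypothesis all_vertices : forall I : set R,
  is_ideal I -> I <> [set 0] -> I <> [set: R] -> AG_vertex I.
Hypothesis fingenus : finite_genus K (AG R).
Implicit Types (I J L M m : set R) (a b x y : R).

Lemma vertex_annihilator I : AG_vertex I -> exists2 x, x <> 0 & annihilator I x.
Proof.
move=> [[Ii [J [Ji /(idl_neq0 Ji)[x Jx x0] IJ]]] I0].
by exists x => // a Ia; rewrite mulrC (ideal_mul0 IJ Ia Jx).
Qed.

Lemma maximal_comaximal m1 m2 : maximal_ideal m1 -> maximal_ideal m2 ->
  m1 <> m2 -> ideal_add m1 m2 = [set: R].
Proof.
move=> [i1 p1 M1] [i2 p2 M2] d; apply: contrapT => nT.
have Ai := is_ideal_add i1 i2.
have E1 := M1 _ Ai (@ideal_addl _ m1 m2 i2) nT.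
have E2 := M2 _ Ai (@ideal_addr _ m1 m2 i1) nT.
by apply: d; rewrite -E1 -{2}E2.
Qed.

Lemma comaximal_split I J L : is_ideal I -> is_ideal J -> is_ideal L ->
  ideal_add J L = [set: R] -> I `&` L `<=` J -> I `<=` J.
Proof.
move=> Ii Ji Li JL ILJ x Ix.
have [j Jj [l Ll jl]] : ideal_add J L 1 by rewrite JL.
rewrite -[x]mulr1 -jl mulrDr; apply: idlD => //; first exact: idlM.
by apply: ILJ; split; [exact: idlMr|exact: idlM].
Qed.

(** For maximal ideals m1 and m2, the annihilators S1 and S2 are nonzero and meet
    in 0, since m1 + m2 = R; therefore S1, S2 and S1 + S2 are distinct and they kill
    P, the intersection of m1 and m2, which has finitely many subideals.  An ideal I
    is recovered from its trace on P and from the inclusions of I in m1 and in m2: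
    when I is not inside m_i it is comaximal with it, and comaximal_split applies. *)
Lemma nonlocal_finite : ~ is_local R -> finite_set [set I : set R | is_ideal I].
Proof.
move=> nloc.
have zero_proper : [set (0 : R)] <> [set: R].
  move=> E; have : [set (0 : R)] 1 by rewrite E.
  by move=> /= /eqP; rewrite oner_eq0.
have [m1 max1 _] := maximal_above noethR (is_ideal0 R) zero_proper.
have [m2 max2 d] : exists2 m2, maximal_ideal m2 & m1 <> m2.
  apply: contrapT => H; apply: nloc; exists m1; split=> // m' max'.
  by apply: contrapT => d; apply: H; exists m' => // /esym.
have [i1 p1 M1] := max1; have [i2 p2 M2] := max2.
have m10 : m1 <> [set 0].
  move=> E; apply: d; apply/esym/M1 => //; rewrite E => _ ->; exact: idl0.
have m20 : m2 <> [set 0].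
  move=> E; apply: d; apply/M2 => //; rewrite E => _ ->; exact: idl0.
have co := maximal_comaximal max1 max2 d.
pose S1 := annihilator m1; pose S2 := annihilator m2.
have [x1 x10 S1x] := vertex_annihilator (all_vertices i1 m10 p1).
have [x2 x20 S2x] := vertex_annihilator (all_vertices i2 m20 p2).
have Si1 : is_ideal S1 := is_ideal_annihilator m1.
have Si2 : is_ideal S2 := is_ideal_annihilator m2.
have S12 x : S1 x -> S2 x -> x = 0.
  move=> H1 H2; have [a ma [b mb ab]] : ideal_add m1 m2 1 by rewrite co.
  by rewrite -[x]mulr1 -ab mulrDr H1 // H2 // addr0.
pose P := m1 `&` m2.
have Pi : is_ideal P by exact: is_ideal_cap.
have fP : finite_set (subideals P).
  apply: (@finite_killed K R fingenus S1 S2 (ideal_add S1 S2)) => //.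
  - exact: is_ideal_add.
  - exact: neq0_idl S1x x10.
  - exact: neq0_idl S2x x20.
  - by apply: (@neq0_idl _ _ x1) => //; exact: ideal_addl.
  - by move=> E; apply: x10; apply: S12 => //; rewrite -E.
  - move=> E; apply: x20; apply: S12 => //; rewrite E; exact: ideal_addr.
  - move=> E; apply: x10; apply: S12 => //; rewrite E; exact: ideal_addl.
  - move=> a b + [b1 b2]; case=> [H|[H|[u H1 [v H2 <-]]]].
    + exact: H.
    + exact: H.
    + by rewrite mulrDl H1 // H2 // addr0.
pose code I : set R * (bool * bool) := (I `&` P, (`[< I `<=` m1 >], `[< I `<=` m2 >])).
have code_inj : set_inj [set I : set R | is_ideal I] code.
  suff H I J : is_ideal I -> is_ideal J -> code I = code J -> I `<=` J.
    move=> I J; rewrite !inE => Ii Ji E; apply/seteqP; split; exact: H.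
  move=> Ii Ji [EP E1 E2].
  have e1 : J `<=` m1 -> I `<=` m1 by move=> /asboolP; rewrite -E1 => /asboolP.
  have e2 : J `<=` m2 -> I `<=` m2 by move=> /asboolP; rewrite -E2 => /asboolP.
  have sub_or_co L m : maximal_ideal m -> is_ideal L -> L `<=` m \/ ideal_add L m = [set: R].
    move=> [mi mT mm] Li; have [?|nLm] := pselect (L `<=` m); [by left|right].
    apply: contrapT => nT; apply: nLm.
    rewrite -(mm _ (is_ideal_add Li mi) (@ideal_addr _ L m Li) nT).
    exact: ideal_addl.
  have IPJ : I `&` P `<=` J by rewrite EP => x [].
  case: (sub_or_co J m1 max1 Ji) => [J1|J1]; case: (sub_or_co J m2 max2 Ji) => [J2|J2].
  - move=> x Ix; apply: IPJ; split=> //; split; [exact: e1 J1 _ Ix|exact: e2 J2 _ Ix].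
  - apply: (comaximal_split Ii Ji i2 J2) => x [Ix m2x].
    by apply: IPJ; split=> //; split=> //; exact: e1 J1 _ Ix.
  - apply: (comaximal_split Ii Ji i1 J1) => x [Ix m1x].
    by apply: IPJ; split=> //; split=> //; exact: e2 J2 _ Ix.
  - apply: (comaximal_split Ii Ji i1 J1) => x [Ix m1x].
    apply: (@comaximal_split (I `&` m1) J m2) => //; first exact: is_ideal_cap.
    by move=> z [[Iz m1z] m2z]; apply: IPJ.
rewrite -(eq_finite_set (inj_card_eq code_inj)).
apply: (@sub_finite_set _ _ (subideals P `*` [set: bool * bool])).
  by move=> _ [I Ii <-]; split=> //=; split; [exact: is_ideal_cap|move=> x []].
by apply: finite_setX => //; exact: finite_finset.
Qed.

End NonLocal.

(** * Linear algebra over the residue field *)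

Section ResidueAlgebra.
Variables (R : comNzRingType) (noethR : noetherian R).
Variables (m : set R) (Lm : local_with m).
Implicit Types (I J L M : set R) (a b c r q x y : R).

Let mi : is_ideal m := local_ideal Lm.

(** Linear independence over R/m of the classes modulo J. *)
Definition indep2 J a b : Prop :=
  forall r q, J (r * a + q * b) -> m r /\ m q.

Definition indep3 J a b c : Prop :=
  forall r q p, J (r * a + q * b + p * c) -> [/\ m r, m q & m p].

Lemma indep2C J a b : indep2 J a b -> indep2 J b a.
Proof. by move=> ab r q; rewrite addrC => /ab[]. Qed.

Lemma indep2l J a b : indep2 J a b -> ~ J a.
Proof.
move=> ab Ja; apply: (local_proper Lm).
by have [] : m 1 /\ m 0 by apply: ab; rewrite mul1r mul0r addr0.
Qed.

Lemma indep3_2 J a b c : indep3 J a b c -> indep2 J a b.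
Proof.
by move=> abc r q H; have [] : [/\ m r, m q & m 0] by apply: abc; rewrite mul0r addr0.
Qed.

Lemma indep3_rot J a b c : indep3 J a b c -> indep3 J b c a.
Proof. by move=> abc r q p; rewrite addrC addrA => /abc[]. Qed.

Lemma indep2_intro J a b : is_ideal J -> ~ J a ->
  (forall c, m c -> J (c * b)) -> ~ ideal_add J (principal a) b -> indep2 J a b.
Proof.
move=> Ji Ja mb nb r q Jrq.
have mq : m q.
  apply: contrapT => /(local_unit noethR Lm)[u uq]; apply: nb.
  exists (u * (r * a + q * b)); first exact: idlM.
  exists (- (u * r) * a); first by exists (- (u * r)).
  by rewrite mulrDr [u * (q * b)]mulrA uq; ring.
split=> //; apply: contrapT => /(local_unit noethR Lm)[u ur]; apply: Ja.
have -> : a = u * ((r * a + q * b) - q * b) by rewrite addrK mulrA ur mul1r.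
by apply: idlM => //; apply: idlB => //; exact: mb.
Qed.

Lemma indep3_intro J a b c : is_ideal J -> indep2 J a b ->
  (forall e, m e -> J (e * c)) ->
  ~ ideal_add J (ideal_add (principal a) (principal b)) c -> indep3 J a b c.
Proof.
move=> Ji ab mc nc r q p Jrqp.
have mp : m p.
  apply: contrapT => /(local_unit noethR Lm)[u up]; apply: nc.
  exists (u * (r * a + q * b + p * c)); first exact: idlM.
  exists (- (u * r) * a + - (u * q) * b).
    exists (- (u * r) * a); first by exists (- (u * r)).
    by exists (- (u * q) * b) => //; exists (- (u * q)).
  by rewrite mulrDr [u * (p * c)]mulrA up; ring.
have [] : m r /\ m q; last by [].
apply: ab; have -> : r * a + q * b = (r * a + q * b + p * c) - p * c by rewrite addrK.
by apply: idlB => //; exact: mc.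
Qed.

(** For J, a and b fixed and r running through representatives of R/m, these ideals
    form a pencil. *)
Definition line J a b r : set R := ideal_add J (principal (a + r * b)).

Lemma line_sub J L a b r : is_ideal L -> J `<=` L -> L a -> L b -> line J a b r `<=` L.
Proof.
move=> Li JL La Lb; apply: ideal_add_sub => //; apply: principal_sub => //.
by apply: idlD => //; exact: idlM.
Qed.

Lemma is_ideal_line J a b r : is_ideal J -> is_ideal (line J a b r).
Proof. by move=> Ji; apply: is_ideal_add => //; exact: is_ideal_principal. Qed.

(** Two members of the pencil that coincide contain (rho j - rho i) b, hence b. *)
Lemma line_inj J a b (rho : nat -> R) : is_ideal J -> indep2 J a b ->
  (forall i j, (i < j)%N -> ~ m (rho j - rho i)) ->
  injective (fun n => line J a b (rho n)).
Proof.
move=> Ji ab rhoP.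
suff H i j : (i < j)%N -> line J a b (rho i) <> line J a b (rho j).
  by move=> i j E; have [/H|/H|//] := ltngtP i j; rewrite E.
move=> ij E; have [u uP] := local_unit noethR Lm (rhoP i j ij).
have Li := is_ideal_line a b (rho i) Ji.
have Lb : line J a b (rho i) b.
  have bE : u * ((a + rho j * b) - (a + rho i * b)) = b.
    by rewrite -[RHS]mul1r -uP; ring.
  rewrite -[X in line _ _ _ _ X]bE; apply: (idlM u Li); apply: (idlB Li).
    by rewrite E; apply: ideal_addr => //; exact: principal_self.
  by apply: ideal_addr => //; exact: principal_self.
case: Lb => y Jy [_ [c _ <-] yE].
have [|mc m1] := ab (- c) (1 - c * rho i).
  have -> : - c * a + (1 - c * rho i) * b = b - c * (a + rho i * b) by ring.
  by rewrite -{1}yE addrK.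
apply: (local_proper Lm).
have -> : 1 = (1 - c * rho i) - (- c) * rho i by ring.
by apply: idlB => //; exact: idlMr.
Qed.

(** Multiplication by x is a linear form when its values lie in a line Rs
    killed by m: its kernel meets a plane, and meets a 3-space in a plane. *)
Lemma kernel2 J a b s x : indep2 J a b -> (forall c, m c -> c * s = 0) ->
  principal s (x * a) -> principal s (x * b) ->
  exists d, [/\ x * d = 0, ~ J d & forall L, is_ideal L -> L a -> L b -> L d].
Proof.
move=> ab ms [al _ ae] [be _ bE].
have [mal|/(local_unit noethR Lm)[u uP]] := pselect (m al).
  by exists a; rewrite -ae ms //; split=> //; exact: indep2l ab.
exists (b - be * u * a); split.
- have -> : x * (b - be * u * a) = x * b - be * u * (x * a) by ring.
  by rewrite -ae -bE mulrA -[be * u * al]mulrA uP mulr1 subrr.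
- move=> Jd; apply: (local_proper Lm).
  have [] // : m (- (be * u)) /\ m 1.
  by apply: ab; have -> : - (be * u) * a + 1 * b = b - be * u * a by ring.
- by move=> L Li La Lb; apply: idlB => //; exact: idlM.
Qed.

Lemma kernel3 J a b c s x : indep3 J a b c -> (forall c, m c -> c * s = 0) ->
  principal s (x * a) -> principal s (x * b) -> principal s (x * c) ->
  exists d e, [/\ x * d = 0, x * e = 0, indep2 J d e &
    forall L, is_ideal L -> L a -> L b -> L c -> L d /\ L e].
Proof.
move=> abc ms.
have pivot a' b' c' al : indep3 J a' b' c' -> x * a' = al * s -> ~ m al ->
    principal s (x * b') -> principal s (x * c') ->
    exists d e, [/\ x * d = 0, x * e = 0, indep2 J d e &
      forall L, is_ideal L -> L a' -> L b' -> L c' -> L d /\ L e].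
  move=> abc' ae /(local_unit noethR Lm)[u uP] [be _ bE] [ga _ gE].
  exists (b' - be * u * a'), (c' - ga * u * a'); split.
  - have -> : x * (b' - be * u * a') = x * b' - be * u * (x * a') by ring.
    by rewrite ae -bE mulrA -[be * u * al]mulrA uP mulr1 subrr.
  - have -> : x * (c' - ga * u * a') = x * c' - ga * u * (x * a') by ring.
    by rewrite ae -gE mulrA -[ga * u * al]mulrA uP mulr1 subrr.
  - move=> r q H.
    have [] // : [/\ m (- (r * be * u + q * ga * u)), m r & m q].
    apply: abc'; move: H; congr (J _); ring.
  - by move=> L Li La Lb Lc; split; apply: idlB => //; exact: idlM.
move=> [al _ ae] [be _ bE] [ga _ gE].
have [mal|nal] := pselect (m al); last first.
  apply: (pivot a b c al) => //; [by exists be|by exists ga].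
have [mbe|nbe] := pselect (m be); last first.
  have [d [e [xd xe de H]]] : exists d e, [/\ x * d = 0, x * e = 0, indep2 J d e &
      forall L, is_ideal L -> L b -> L c -> L a -> L d /\ L e].
    apply: (pivot b c a be) => //; [exact: indep3_rot|by exists ga|by exists al].
  by exists d, e; split=> // L Li La Lb Lc; exact: H.
exists a, b; split; rewrite -?ae -?bE ?ms //.
exact: indep3_2 abc.
Qed.

Lemma nilpotency_index n : ideal_pow m n = [set 0] ->
  exists t, ideal_pow m t <> [set 0] /\ ideal_pow m t.+1 = [set 0].
Proof.
elim: n => [E|n IHn E].
  have : ideal_pow m 0 1 by [].
  by rewrite E => /= /eqP; rewrite oner_eq0.
by have [/IHn//|n0] := pselect (ideal_pow m n = [set 0]); exists n.
Qed.

Lemma pow_stable_nilpotent n :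
  ideal_pow m n = ideal_pow m n.+1 -> ideal_pow m n = [set 0].
Proof.
move=> E; apply: (nakayama0 noethR Lm); first exact: is_ideal_pow.
by rewrite {1}E.
Qed.

Lemma pow_injective : (forall n, (0 < n)%N -> ideal_pow m n <> ideal_pow m n.+1) ->
  injective (fun n => ideal_pow m n.+1).
Proof.
move=> strict; suff H i j : (i < j)%N -> ideal_pow m i.+1 <> ideal_pow m j.+1.
  by move=> i j E; have [/H|/H|//] := ltngtP i j; rewrite E.
move=> ij E; apply: (strict i.+1) => //; apply/seteqP; split.
  by rewrite E; exact: ideal_pow_le.
exact: ideal_pow_le.
Qed.

Lemma socle_sub : m <> [set 0] -> annihilator m `<=` m.
Proof.
move=> m0; apply: (proper_sub_local noethR Lm); first exact: is_ideal_annihilator.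
move=> ST; apply: m0; apply/seteqP; split; last by move=> _ ->; exact: idl0.
move=> x mx /=; rewrite -[x]mul1r; have : annihilator m 1 by rewrite ST.
exact.
Qed.

End ResidueAlgebra.

(** * Socles that are not simple *)

Section SocleNotSimple.
Variables (K : realType) (R : comNzRingType) (noethR : noetherian R).
Hypothesis fingenus : finite_genus K (AG R).
Variables (m : set R) (Lm : local_with m).

(** The ideals Rs, Rb and R(s + b) kill m, which thus has finitely many subideals:
    the powers of m stop decreasing, and R/m is finite because the pencil spanned
    by s and b is. *)
Lemma socle_not_simple_finite s b : m <> [set 0] ->
  annihilator m s -> s <> 0 -> annihilator m b -> ~ principal s b ->
  finite_set [set: R] /\ exists n, ideal_pow m n = [set 0].
Proof.
move=> m0 Ss s0 Sb nsb; have mi := local_ideal Lm.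
have Si := is_ideal_annihilator m.
have Sm := socle_sub noethR Lm m0.
have ns' : ~ principal b s.
  move=> [c _ cb]; have [mc|/(local_unit noethR Lm)[u uc]] := pselect (m c).
    by apply: s0; rewrite -cb mulrC Sb.
  by apply: nsb; exists u => //; rewrite -cb mulrA uc mul1r.
have b0 : b <> 0 by move=> E; apply: nsb; exists 0; rewrite // mul0r.
have fm : finite_set (subideals m).
  apply: (@finite_killed K R fingenus (principal s) (principal b) (principal (s + b)));
    do ?exact: is_ideal_principal; do ?exact: principal_neq0.
  - apply: principal_neq0 => sb; apply: nsb; exists (-1) => //.
    by rewrite mulN1r; apply/eqP; rewrite eq_sym -addr_eq0 addrC sb.
  - by move=> E; apply: nsb; rewrite E; exact: principal_self.
  - move=> E; apply: nsb.
    have sb : principal s (s + b) by rewrite E; exact: principal_self.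
    have := idlB (is_ideal_principal s) sb (principal_self s).
    by rewrite addrAC subrr add0r.
  - move=> E; apply: ns'.
    have sb : principal b (s + b) by rewrite E; exact: principal_self.
    have := idlB (is_ideal_principal b) sb (principal_self b).
    by rewrite addrK.
  - move=> x y H my; suff : annihilator m x by apply.
    case: H => [H|[H|H]]; first exact: (principal_sub Si Ss H).
      exact: (principal_sub Si Sb H).
    exact: (principal_sub Si (idlD Si Ss Sb) H).
have [n mn0] : exists n, ideal_pow m n = [set 0].
  apply: contrapT => H.
  have strict n : (0 < n)%N -> ideal_pow m n <> ideal_pow m n.+1.
    by move=> _ /(pow_stable_nilpotent noethR Lm) E; apply: H; exists n.
  apply: infinite_nat; rewrite -(eq_finite_set (inj_card_eq (in2W (pow_injective Lm strict)))).
  apply: sub_finite_set fm => _ [n _ <-]; split; first exact: is_ideal_pow.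
  by rewrite -[X in _ `<=` X](ideal_pow1 mi); exact: ideal_pow_le.
split; last by exists n.
apply: contrapT => /(infinite_residues noethR Lm mn0)[rho rhoP].
have ind : indep2 m [set 0] s b.
  apply: (indep2_intro noethR Lm) => //; first exact: is_ideal0.
    by move=> c mc /=; rewrite mulrC Sb.
  by move=> [_ -> [y sy yb]]; apply: nsb; rewrite -yb add0r.
have linj := line_inj noethR Lm (is_ideal0 R) ind rhoP.
apply: infinite_nat; rewrite -(eq_finite_set (inj_card_eq (in2W linj))).
apply: sub_finite_set fm => _ [k _ <-]; split; first exact/is_ideal_line/is_ideal0.
apply: subset_trans Sm; apply: line_sub => // _ ->; exact: idl0.
Qed.

End SocleNotSimple.

(** * Simple socle and strictly decreasing powers *)

Section SimpleSocle.
Variables (R : comNzRingType) (noethR : noetherian R).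
Variables (m : set R) (Lm : local_with m).
Implicit Types (I J L M : set R) (a b c r q x y : R).

Let mi : is_ideal m := local_ideal Lm.

Lemma simple_socle s I : annihilator m = principal s -> is_ideal I ->
  I `<=` annihilator m -> I <> [set 0] -> I = annihilator m.
Proof.
move=> Ss Ii IS I0; apply/seteqP; split=> //.
have [x Ix x0] := idl_neq0 Ii I0.
have : principal s x by rewrite -Ss; exact: IS.
move=> [c _ cx]; rewrite Ss; apply: principal_sub => //.
have [mc|/(local_unit noethR Lm)[u uc]] := pselect (m c).
  have sS : annihilator m s by rewrite Ss; exact: principal_self.
  by case: x0; rewrite -cx mulrC sS.
have -> : s = u * x by rewrite -cx mulrA uc mul1r.
exact: idlM.
Qed.

Lemma vertex_ideal I : AG_vertex I -> is_ideal I. Proof. by move=> [[]]. Qed.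

Lemma vertex_proper I : AG_vertex I -> I `<=` m.
Proof.
move=> [[Ii [J [Ji J0 IJ]]] _]; apply: (proper_sub_local noethR Lm) => // IT.
apply: J0; apply/seteqP; split; last by move=> _ ->; exact: idl0.
by move=> x Jx /=; rewrite -[x]mul1r (ideal_mul0 IJ) // IT.
Qed.

Lemma gorenstein_simple s : annihilator m = principal s -> s <> 0 -> gorenstein m.
Proof.
move=> Ss s0; split=> //; exists (fun=> s); split.
- by move=> _; rewrite Ss; exact: principal_self.
- move=> x; rewrite Ss => -[c _ <-]; exists (fun=> c).
  by rewrite big_ord1 /= subrr.
- move=> a; rewrite big_ord1 /= => as0 i; rewrite ord1.
  apply: contrapT => /(local_unit noethR Lm)[u ua]; apply: s0.
  by rewrite -[s]mul1r -ua -mulrA as0 mulr0.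
Qed.

End SimpleSocle.

Section DecreasingPowers.
Variables (K : realType) (R : comNzRingType) (noethR : noetherian R).
Hypothesis all_vertices : forall I : set R,
  is_ideal I -> I <> [set 0] -> I <> [set: R] -> AG_vertex I.
Hypothesis fingenus : finite_genus K (AG R).
Variables (m : set R) (Lm : local_with m) (s : R).
Hypothesis socleE : annihilator m = principal s.
Hypothesis s0 : s <> 0.
Hypothesis strict : forall n, (0 < n)%N -> ideal_pow m n <> ideal_pow m n.+1.
Implicit Types (I J L M : set R) (a b c r q x y : R).

Let mi : is_ideal m := local_ideal Lm.
Let S := annihilator m.
Let Si : is_ideal S := is_ideal_annihilator m.

Definition large I : Prop := exists A1 A2 A3,
  [/\ [/\ is_ideal A1, is_ideal A2 & is_ideal A3],
      [/\ A1 <> [set 0], A2 <> [set 0] & A3 <> [set 0]],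
      [/\ A1 <> A2, A1 <> A3 & A2 <> A3] &
      [/\ A1 `<=` I, A2 `<=` I & A3 `<=` I]].

Lemma large_killed I L : large I -> (forall a b, I a -> L b -> a * b = 0) ->
  finite_set (subideals L).
Proof.
move=> [A1 [A2 [A3 [[i1 i2 i3] [n1 n2 n3] [d1 d2 d3] [s1 s2 s3]]]]] kill.
apply: (finite_killed fingenus i1 i2 i3 n1 n2 n3 d1 d2 d3) => a b Aa.
by apply: kill; case: Aa => [/s1|[/s2|/s3]].
Qed.

(** The powers of m beyond the k-th one are infinitely many ideals inside L. *)
Lemma infinite_above_pow L k : ideal_pow m k `<=` L -> ~ finite_set (subideals L).
Proof.
move=> kL fL; apply: infinite_nat.
have inj : injective (fun n => ideal_pow m (n + k).+1).
  by move=> i j /(pow_injective Lm strict)/addIn.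
rewrite -(eq_finite_set (inj_card_eq (in2W inj))).
apply: sub_finite_set fL => _ [n _ <-]; split; first exact: is_ideal_pow.
by apply: subset_trans kL; apply: ideal_pow_le => //; rewrite -addSn leq_addl.
Qed.

(** If I and J are both large, then J and Ann(J) have finitely many subideals.  So the
    ideals m^n J stop decreasing, that is m^n J = 0 for some n, and Ann(J) contains
    m^n, against infinite_above_pow. *)
Lemma edge_not_large I J : is_ideal I -> is_ideal J ->
  (forall a b, I a -> J b -> a * b = 0) -> large I -> large J -> False.
Proof.
move=> Ii Ji IJ lI lJ; have fJ := large_killed lI IJ.
have fA : finite_set (subideals (annihilator J)).
  by apply: (large_killed lJ) => a b Ja; rewrite mulrC; apply.
pose G n := iter n (ideal_mul m) J.
have Gi n : is_ideal (G n) by case: n => [|n] //; exact: is_ideal_mul.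
have Gdec n : G n.+1 `<=` G n.
  by apply: ideal_mul_sub => // a b _; exact: idlM.
have Gmono i j : (i <= j)%N -> G j `<=` G i.
  move=> /subnK <-; elim: (j - i)%N => // d IHd.
  by rewrite addSn; exact: subset_trans (Gdec _) IHd.
have [n Gn] : exists n, G n = [set 0].
  apply: contrapT => H.
  have Gne n : G n <> G n.+1.
    move=> E; apply: H; exists n; apply: (nakayama0 noethR Lm) => //.
    by rewrite {1}E.
  have inj : injective G.
    suff ne i j : (i < j)%N -> G i <> G j.
      by move=> i j E; have [/ne|/ne|//] := ltngtP i j; rewrite E.
    move=> ij E; apply: (Gne i); apply/seteqP; split; last exact: Gdec.
    by rewrite E; exact: Gmono.
  apply: infinite_nat; rewrite -(eq_finite_set (inj_card_eq (in2W inj))).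
  by apply: sub_finite_set fJ => _ [n _ <-]; split=> //; exact: (Gmono 0%N).
apply: (@infinite_above_pow _ n) fA => a Pa b Jb.
suff : G n (a * b) by rewrite Gn.
have H k x : ideal_pow m k x -> G k (x * b).
  elim: k x => [|k IHk] x; first by move=> _; exact: idlM.
  have Li : is_ideal [set z | G k.+1 (z * b)].
    have Gk := Gi k.+1.
    split=> /= [|u v Hu Hv|c u Hu]; rewrite ?mul0r ?mulrDl -?mulrA.
    - exact: (idl0 Gk).
    - exact: (idlD Gk).
    - exact: (idlM c Gk).
  apply: (ideal_mul_sub Li) => u v mu Pv /=.
  by rewrite -mulrA; apply: mem_ideal_mul => //; exact: IHk.
exact: H.
Qed.

(** I, m I and m^2 I decrease strictly until they vanish, and they are not three
    nonzero ideals, so that m^2 I = 0; the last nonzero one is killed by m, and it is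
    S because S is simple. *)
Lemma small_socle I : is_ideal I -> I <> [set 0] -> ~ large I ->
  S `<=` I /\ (forall a b x, m a -> m b -> I x -> a * b * x = 0).
Proof.
move=> Ii I0 small.
pose I1 := ideal_mul m I; pose I2 := ideal_mul m I1.
have I1i : is_ideal I1 by exact: is_ideal_mul.
have I2i : is_ideal I2 by exact: is_ideal_mul.
have sub1 : I1 `<=` I by apply: ideal_mul_sub => // a b _; exact: idlM.
have sub2 : I2 `<=` I1 by apply: ideal_mul_sub => // a b _; exact: idlM.
have I20 : I2 = [set 0].
  apply: contrapT => n2; apply: small; exists I, I1, I2; split=> //; split=> //.
  - move=> E; apply: n2; apply/seteqP; split; last by move=> _ ->; exact: idl0.
    by rewrite -E.
  - by move=> E; apply: I0; apply: (nakayama0 noethR Lm) => //; rewrite {1}E.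
  - by move=> E; apply: I0; apply: (nakayama0 noethR Lm) => //; rewrite {1}E.
  - move=> E; have E1 : I1 = [set 0].
      by apply: (nakayama0 noethR Lm) => //; rewrite {1}E.
    by apply: n2; rewrite -E.
  - exact: subset_trans sub1.
split; last first.
  move=> a b x ma mb Ix; have : I2 (a * (b * x)).
    by apply: mem_ideal_mul => //; exact: mem_ideal_mul.
  by rewrite I20 mulrA.
have [E1|n1] := pselect (I1 = [set 0]).
  rewrite /S -(simple_socle noethR Lm socleE Ii) // => x Ix a ma.
  by have := mem_ideal_mul ma Ix; rewrite -/I1 E1 mulrC.
rewrite /S -(simple_socle noethR Lm socleE I1i) // => x Ix a ma.
by have := mem_ideal_mul ma Ix; rewrite -/I2 I20 mulrC.
Qed.

Lemma socle_neq0 : S <> [set 0].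
Proof. by apply: (@neq0_idl _ _ s) => //; rewrite /S socleE; exact: principal_self. Qed.

(** If they were distinct, I + J would be large, because of S, I and J; but it is
    killed by m^2, which contains infinitely many ideals. *)
Lemma small_unique I J : is_ideal I -> is_ideal J -> I <> [set 0] -> J <> [set 0] ->
  ~ large I -> ~ large J -> I <> S -> J <> S -> I = J.
Proof.
move=> Ii Ji I0 J0 lI lJ IS JS; apply: contrapT => IJ.
have [SI kI] := small_socle Ii I0 lI; have [SJ kJ] := small_socle Ji J0 lJ.
have lX : large (ideal_add I J).
  exists S, I, J; split; split=> //; do ?[exact: socle_neq0|exact: nesym].
  - by apply: subset_trans SI _; exact: ideal_addl.
  - exact: ideal_addl.
  - exact: ideal_addr.
apply: (@infinite_above_pow (ideal_pow m 2) 2) => //.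
apply: (large_killed lX) => _ b [x Ix [y Jy <-]] Pb.
have kill L : (forall a b x, m a -> m b -> L x -> a * b * x = 0) ->
    ideal_pow m 2 `<=` annihilator L.
  move=> H; apply: ideal_mul_sub; first exact: is_ideal_annihilator.
  move=> u v mu mv w; apply: H => //.
  by rewrite -(ideal_pow1 mi); exact: mv.
by rewrite mulrC mulrDr (kill I) // (kill J) // addr0.
Qed.

Lemma m_neq0 : m <> [set 0].
Proof.
move=> m0; apply: (strict (n := 1)) => //.
have P1 : ideal_pow m 1 = [set 0] by rewrite ideal_pow1.
have P2 : ideal_pow m 2 = [set 0].
  by apply: ideal_mul_eq0 => a b; rewrite m0 => -> _; rewrite mul0r.
by rewrite P1 P2.
Qed.

(** An ideal other than S that is not large is principal, since it has no nonzero subideals except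
    S and itself; when there is none, any element of m outside S will do for x. *)
Lemma second_vertex : exists x, [/\ m x, principal x <> S, x <> 0 &
  forall I, is_ideal I -> I <> [set 0] -> ~ large I -> I = S \/ I = principal x].
Proof.
have [[I [Ii I0 lI IS]]|no] := pselect (exists I,
    [/\ is_ideal I, I <> [set 0], ~ large I & I <> S]).
  have [SI _] := small_socle Ii I0 lI.
  have [x Ix Sx] : exists2 x, I x & ~ S x.
    apply: contrapT => H; apply: IS; apply/seteqP; split=> // x Ix.
    by apply: contrapT => Sx; apply: H; exists x.
  have x0 : x <> 0 by move=> E; apply: Sx; rewrite E; exact: idl0.
  have xS : principal x <> S by move=> E; apply: Sx; rewrite -E; exact: principal_self.
  have xI : principal x = I.
    apply: contrapT => ne; apply: lI; exists S, (principal x), I.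
    split; split=> //; do ?[exact: socle_neq0|exact: is_ideal_principal|
      exact: principal_neq0|exact: nesym|exact: principal_sub].
  exists x; split=> //.
    apply: (proper_sub_local noethR Lm (I := I)) => // IT; apply: lI.
    have e1 := strict (n := 1) isT.
    exists I, S, m; split; split=> //; do ?[exact: socle_neq0|exact: m_neq0|by rewrite IT].
    + by move=> E; case: Lm => -[_ + _] _; rewrite -E.
    + move=> E; apply: (strict (n := 2)) => //.
      have z k : ideal_pow m k.+2 = [set 0].
        apply: ideal_mul_eq0 => a b ma Pb.
        have : S a by rewrite E.
        apply; rewrite -(ideal_pow1 mi); exact: (ideal_pow_le mi (n := 1) (k := k.+1)) Pb.
      by rewrite !z.
  move=> J Ji J0 lJ; have [->|JS] := pselect (J = S); first by left.
  by right; rewrite xI; apply: small_unique.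
have [x mx Sx] : exists2 x, m x & ~ S x.
  apply: contrapT => H; apply: (strict (n := 2)) => //.
  have mS : m `<=` S by move=> x mx; apply: contrapT => Sx; apply: H; exists x.
  have z k : ideal_pow m k.+2 = [set 0].
    apply: ideal_mul_eq0 => a b /mS Sa Pb; apply: Sa.
    rewrite -(ideal_pow1 mi); exact: (ideal_pow_le mi (n := 1) (k := k.+1)) Pb.
  by rewrite !z.
exists x; split=> //.
- by move=> E; apply: Sx; rewrite -E; exact: principal_self.
- by move=> E; apply: Sx; rewrite E; exact: idl0.
- move=> I Ii I0 lI; left; apply: contrapT => IS; apply: no; exists I; split=> //.
Qed.

(** By edge_not_large each edge has an end that is S or Rx: the other vertices are
    adjacent to these two at most, and fit into the family of common neighbours of
    the two centres. *)
Lemma decreasing_powers_fig1 : AG_in_fig1 m.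
Proof.
have [x [mx xS x0 smallP]] := second_vertex.
have Rxi := is_ideal_principal x.
have Rx0 := principal_neq0 x0.
have vS : AG_vertex S.
  apply: all_vertices => //; first exact: socle_neq0.
  move=> ST; apply: (local_proper Lm); apply: (socle_sub noethR Lm m_neq0).
  by rewrite -/S ST.
have vx : AG_vertex (principal x).
  apply: all_vertices => // xT; apply: (local_proper Lm).
  by apply: (principal_sub mi mx); rewrite xT.
pose f (v : vertex (AG R)) : fig1_vertex (set R) void :=
  if `[< sval v = S >] then F1c else
  if `[< sval v = principal x >] then F1d else @F1cd (set R) void (sval v).
have fS v : sval v = S -> f v = F1c by move=> E; rewrite /f asboolT.
have fcd v : sval v <> S -> sval v <> principal x -> f v = @F1cd _ void (sval v).
  by move=> n1 n2; rewrite /f !asboolF.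
have fx v : sval v = principal x -> f v = F1d.
  by move=> E; rewrite /f asboolF ?asboolT // E.
exists (set R), void, f, x; split.
- pose back (w : fig1_vertex (set R) void) : set R := match w with
    | F1d => principal x | F1cd J => J | _ => S end.
  have backK v : back (f v) = sval v.
    by rewrite /f; case: asboolP => [->//|_]; case: asboolP => [->|].
  split=> [u v E|u v [uv IJ]].
    by apply: vertex_val_inj; rewrite -(backK u) E backK.
  have : ~ (large (sval u) /\ large (sval v)).
    move=> [lu lv]; apply: (edge_not_large _ _ _ lu lv).
    + exact: vertex_ideal (svalP u).
    + exact: vertex_ideal (svalP v).
    + by move=> a b; exact: ideal_mul0.
  have small (w : vertex (AG R)) : ~ large (sval w) -> sval w = S \/ sval w = principal x.
    by apply: smallP; [exact: (vertex_ideal (svalP w))|case: (svalP w)].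
  move=> nl; have cls (w : vertex (AG R)) : [\/ sval w = S, sval w = principal x |
      [/\ sval w <> S, sval w <> principal x & large (sval w)]].
    have [?|n1] := pselect (sval w = S); first by constructor 1.
    have [?|n2] := pselect (sval w = principal x); first by constructor 2.
    by constructor 3; split=> //; apply: contrapT => /small[].
  case: (cls u) => [uS|ux|[u1 u2 lu]]; case: (cls v) => [vS'|vx'|[v1 v2 lv]];
    rewrite ?(fS _ uS) ?(fx _ ux) ?(fcd _ u1 u2) ?(fS _ vS') ?(fx _ vx') ?(fcd _ v1 v2) //=.
  + by apply: uv; apply: vertex_val_inj; rewrite uS.
  + by apply: uv; apply: vertex_val_inj; rewrite ux.
  + by apply: nl.
- by exists (exist _ S vS); split=> //; exact: fS.
- by exists (exist _ (principal x) vx); split=> //; exact: fx.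
Qed.

End DecreasingPowers.

Lemma AG_fig1_planar (K : realType) (R : comNzRingType) (m : set R) :
  AG_in_fig1 m -> has_genus K (AG R) 0.
Proof.
move=> [A [B [f [x [fP _ _]]]]]; apply: (@planar_of_fig3 K void A B).
by apply: subgraph_trans (@fig1_fig3 A B); exists f.
Qed.

(** * Nilpotent maximal ideals *)

Lemma mem_pow2 (R : comNzRingType) (M : set R) x y : is_ideal M ->
  M x -> M y -> ideal_pow M 2 (x * y).
Proof.
move=> Mi Mx My; have My1 : ideal_pow M 1 y by rewrite ideal_pow1.
exact: ideal_powSl Mx My1.
Qed.

Section Nilpotent.
Variables (R : comNzRingType) (noethR : noetherian R).
Variables (m : set R) (Lm : local_with m).
Implicit Types (I J L M : set R) (a b c r q x y : R).

Let mi : is_ideal m := local_ideal Lm.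

Lemma pow_top s t : annihilator m = principal s ->
  ideal_pow m t <> [set 0] -> ideal_pow m t.+1 = [set 0] ->
  ideal_pow m t = annihilator m.
Proof.
move=> Ss t0 t1; apply: (simple_socle noethR Lm Ss) => //; first exact: is_ideal_pow.
by move=> x Px y my; have := ideal_powSl my Px; rewrite t1 mulrC.
Qed.

(** Every element is u x^k with u a unit or k = n, hence an ideal is generated by the
    smallest power of x that it contains. *)
Lemma principal_maximal_spir x n : m = principal x -> ideal_pow m n = [set 0] ->
  special_principal_ideal_ring R.
Proof.
move=> mx mn0; split; [by exists m|exact: nilpotent_artinian noethR _ Lm _ mn0|].
have xn0 : x ^+ n = 0.
  suff H k : ideal_pow m k (x ^+ k) by have := H n; rewrite mn0.
  elim: k => // k IHk; rewrite exprS; apply: ideal_powSl => //.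
  by rewrite mx; exact: principal_self.
have form r : exists k u, (k <= n)%N /\ r = u * x ^+ k /\ ((k < n)%N -> ~ m u).
  suff H j : exists k u, (k <= j)%N /\ r = u * x ^+ k /\ ((k < j)%N -> ~ m u) by exact: H.
  elim: j => [|j [k [u [kj [ru mu]]]]]; first by exists 0%N, r; rewrite mulr1.
  have [lt|eqj] := ltnP k j; first by exists k, u; split; [exact: leqW|split=> // _; exact: mu].
  have [umx|nu] := pselect (m u).
    have kE : k = j by apply/eqP; rewrite eqn_leq kj.
    subst k; move: umx; rewrite mx => -[v _ vu]; exists j.+1, v.
    split=> //; split; first by rewrite ru -vu exprS mulrA.
    by rewrite ltnn.
  by exists k, u; split; [exact: leqW|split].
move=> I Ii.
have ex : exists k, `[< I (x ^+ k) >] by exists n; apply/asboolP; rewrite xn0; exact: idl0.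
exists (x ^+ (ex_minn ex)).
case: ex_minnP => k /asboolP Ik kmin; apply/seteqP; split; last exact: principal_sub.
move=> r Ir; have [j [u [jn [ru mu]]]] := form r.
suff kj : (k <= j)%N.
  by rewrite ru -(subnK kj) exprD mulrA; exists (u * x ^+ (j - k)).
move: jn; rewrite leq_eqVlt => /orP[/eqP ->|/mu/(local_unit noethR Lm)[v vu]].
  by apply: kmin; apply/asboolP; rewrite xn0; exact: idl0.
apply: kmin; apply/asboolP.
by have := idlM v Ii Ir; rewrite ru mulrA vu mul1r.
Qed.

(** By the lemma of Nakayama: a generates m if m = m^2 + Ra. *)
Lemma two_generators : (forall x, m <> principal x) ->
  exists a b, [/\ m a, m b & indep2 m (ideal_pow m 2) a b].
Proof.
move=> np; have Pi := is_ideal_pow 2 mi.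
have P2 : ideal_pow m 2 = ideal_mul m m.
  by congr (ideal_mul _ _); exact: ideal_pow1.
have [a ma Pa] : exists2 a, m a & ~ ideal_pow m 2 a.
  apply: contrapT => H; apply: (np 0); have -> : m = [set 0].
    apply: (nakayama0 noethR Lm) => // x mx; rewrite -P2.
    by apply: contrapT => Px; apply: H; exists x.
  apply/seteqP; split=> [x ->|_ [c _ <-]]; first exact: principal_self.
  by rewrite mulr0.
have [b mb Pb] : exists2 b, m b & ~ ideal_add (ideal_pow m 2) (principal a) b.
  apply: contrapT => H; apply: (np a); apply/seteqP; split; last exact: principal_sub.
  apply: (nakayama noethR Lm) => //; first exact: is_ideal_principal.
  move=> x mx; rewrite -P2; have [p Pp [y ay <-]] :
      ideal_add (ideal_pow m 2) (principal a) x.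
    by apply: contrapT => Px; apply: H; exists x.
  by exists y => //; exists p => //; rewrite addrC.
exists a, b; split=> //; apply: (indep2_intro noethR Lm) => // c mc.
by rewrite P2; exact: mem_ideal_mul.
Qed.

(** By Cramer's rule: the determinant of p and q in the basis a, b of the plane m/J
    is a unit, since they are independent. *)
Lemma basis_exchange J a b p q : is_ideal J ->
  (forall x y, m x -> m y -> J (x * y)) ->
  (forall x, m x -> exists r e, J (x - (r * a + e * b))) -> m a -> m b ->
  m p -> m q -> indep2 m J p q ->
  forall I, is_ideal I -> J `<=` I -> I p -> I q -> m `<=` I.
Proof.
move=> Ji mm gen ma mb.
move=> mp mq pq I Ii JI Ip Iq.
have [r1 [q1 H1]] := gen p mp; have [r2 [q2 H2]] := gen q mq.
set s1 := p - _ in H1; set s2 := q - _ in H2.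
have pE : p = r1 * a + q1 * b + s1 by rewrite /s1; ring.
have qE : q = r2 * a + q2 * b + s2 by rewrite /s2; ring.
have [mD|/(local_unit noethR Lm)[u uD]] := pselect (m (r1 * q2 - r2 * q1)).
  have [mq2 mq1] : m q2 /\ m (- q1).
    apply: pq; have -> : q2 * p + - q1 * q = (r1 * q2 - r2 * q1) * a + (q2 * s1 - q1 * s2).
      by rewrite {1}pE {1}qE; ring.
    apply: (idlD Ji); first exact: mm.
    exact: (idlB Ji (idlM q2 Ji H1) (idlM q1 Ji H2)).
  have [mr2 mr1] : m r2 /\ m (- r1).
    apply: pq; have -> : r2 * p + - r1 * q = (r2 * q1 - r1 * q2) * b + (r2 * s1 - r1 * s2).
      by rewrite {1}pE {1}qE; ring.
    apply: (idlD Ji); last exact: (idlB Ji (idlM r2 Ji H1) (idlM r1 Ji H2)).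
    by apply: mm => //; rewrite -opprB; exact: idlN.
  case: (indep2l Lm pq); rewrite pE; apply: (idlD Ji) => //; apply: (idlD Ji); apply: mm => //.
    by rewrite -[r1]opprK; exact: idlN.
  by rewrite -[q1]opprK; exact: idlN.
have Ia : I a.
  have -> : a = u * (q2 * p - q1 * q - (q2 * s1 - q1 * s2)).
    by rewrite -[LHS]mul1r -uD pE qE; ring.
  apply: idlM => //; apply: idlB => //; apply: idlB => //; apply: idlM => //; exact: JI.
have Ib : I b.
  have -> : b = u * (r1 * q - r2 * p - (r1 * s2 - r2 * s1)).
    by rewrite -[LHS]mul1r -uD pE qE; ring.
  apply: idlM => //; apply: idlB => //; apply: idlB => //; apply: idlM => //; exact: JI.
move=> x mx; have [r [e H]] := gen x mx.
rewrite -(subrK (r * a + e * b) x); apply: idlD => //; first exact: JI.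
by apply: idlD => //; exact: idlM.
Qed.

Lemma residue_dim2 a b : m a -> m b -> indep2 m (ideal_pow m 2) a b ->
  (forall c, m c -> ~ indep3 m (ideal_pow m 2) a b c) ->
  residue_dim m m (ideal_pow m 2) 2 /\
  forall x, m x -> exists r q, ideal_pow m 2 (x - (r * a + q * b)).
Proof.
move=> ma mb ab n3.
have gen x : m x -> exists r q, ideal_pow m 2 (x - (r * a + q * b)).
  move=> mx; apply: contrapT => H; apply: (n3 x mx).
  apply: (indep3_intro noethR Lm) => //; first exact: is_ideal_pow.
    by move=> c mc; exact: mem_pow2.
  move=> [p Pp [_ [_ [r _ <-] [_ [q _ <-] <-]] pE]]; apply: H.
  by exists r, q; rewrite -pE addrK.
split=> //; exists (fun i => if i == 0 then a else b); split.
- by move=> i; case: ifP.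
- move=> x mx; have [r [q H]] := gen x mx.
  exists (fun i => if i == 0 then r else q).
  by rewrite big_ord_recl big_ord1 /=.
- move=> c; rewrite big_ord_recl big_ord1 /= => /ab[m0 m1] i.
  by case: (unliftP ord0 i) => [j ->|->] //; rewrite (ord1 j).
Qed.

End Nilpotent.

Lemma eventually_avoid (T : eqType) (P : T -> nat -> Prop) (s : seq T) :
  (forall x i j, x \in s -> (i < j)%N -> P x i -> P x j -> False) ->
  exists N, forall i, (N <= i)%N -> forall x, x \in s -> ~ P x i.
Proof.
elim: s => [|x s IH] H; first by exists 0%N.
have [|N NP] := IH; first by move=> y i j ys; apply: H; rewrite inE ys orbT.
have [N' N'P] : exists N', forall i, (N' <= i)%N -> ~ P x i.
  have [[k Pk]|no] := pselect (exists k, P x k); last first.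
    by exists 0%N => i _ Pi; apply: no; exists i.
  by exists k.+1 => i ki Pi; apply: (H x k i); rewrite ?mem_head.
exists (maxn N N') => i; rewrite geq_max => /andP[Ni N'i] y.
by rewrite inE => /orP[/eqP ->|]; [exact: N'P|exact: NP].
Qed.

(** Over an infinite residue field an ideal M is not covered by finitely many ideals
    W that do not contain it: if v avoids the first ones and u avoids the last one,
    each ideal contains v + rho i u for at most one i. *)
Lemma avoid_ideals (R : comNzRingType) (noethR : noetherian R) (m : set R)
    (Lm : local_with m) (rho : nat -> R) (M : set R) (s : seq (set R)) :
  (forall i j, (i < j)%N -> ~ m (rho j - rho i)) -> is_ideal M ->
  (forall W, W \in s -> is_ideal W /\ exists2 v, M v & ~ W v) ->
  exists2 v, M v & forall W, W \in s -> ~ W v.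
Proof.
move=> rhoP Mi; elim: s => [|W s IH] H; first by exists 0 => //; exact: idl0.
have [|v Mv vs] := IH; first by move=> W' W's; apply: H; rewrite inE W's orbT.
have [Wi [u Mu Wu]] := H W (mem_head _ _).
have [Wv|nWv] := pselect (W v); last first.
  by exists v => // W'; rewrite inE => /orP[/eqP ->|/vs].
have mi := local_ideal Lm.
have unitdiff I i j x y : is_ideal I -> (i < j)%N ->
    I (x + rho i * y) -> I (x + rho j * y) -> I y.
  move=> Ii ij I1 I2; have [w wP] := local_unit noethR Lm (rhoP i j ij).
  have -> : y = w * ((x + rho j * y) - (x + rho i * y)).
    by rewrite -[LHS]mul1r -wP; ring.
  by apply: idlM => //; exact: idlB.
have [|N NP] := @eventually_avoid (set R)
    (fun W' i => W' (v + rho i * u)) (W :: s).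
  move=> W' i j; rewrite inE => /orP[/eqP ->|W's] ij I1 I2.
    exact/Wu/(unitdiff W i j v u).
  have [W'i _] := H W' (mem_behead (s := W :: s) W's).
  apply: (vs W' W's); have uW' := unitdiff W' i j v u W'i ij I1 I2.
  by rewrite -(addrK (rho i * u) v); apply: idlB => //; exact: idlM.
exists (v + rho N * u); last exact: (NP N (leqnn N)).
by apply: idlD => //; exact: idlM.
Qed.

(** * Maximal ideals with m^3 = 0 *)

Section IndexTwo.
Variables (K : realType) (R : comNzRingType) (noethR : noetherian R).
Hypothesis fingenus : finite_genus K (AG R).
Variables (m : set R) (Lm : local_with m) (s : R).
Hypothesis socleE : annihilator m = principal s.
Hypothesis s0 : s <> 0.
Hypothesis socle2 : ideal_pow m 2 = annihilator m.
Implicit Types (I J L M : set R) (a b c r q x y z f : R).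

Let mi : is_ideal m := local_ideal Lm.
Let S := annihilator m.
Let Si : is_ideal S := is_ideal_annihilator m.

Lemma mul_in_socle x y : m x -> m y -> S (x * y).
Proof. by move=> mx my; rewrite /S -socle2; exact: mem_pow2. Qed.

Lemma socle_sub_max : S `<=` m.
Proof.
by rewrite /S -socle2 -[X in _ `<=` X](ideal_pow1 mi); exact: ideal_pow_le.
Qed.

Lemma socle_gen : S s. Proof. by rewrite /S socleE; exact: principal_self. Qed.

Lemma mul_socle_gen c : m c -> c * s = 0. Proof. by move=> mc; rewrite mulrC socle_gen. Qed.

(** As m^2 = S = Rs, multiplication is a symmetric bilinear form on m/S with values
    in the line S; ray_ideal f is the line of f in m/S. *)
Definition ray_ideal f : set R := ideal_add S (principal f).

Lemma ray_ideal_is_ideal f : is_ideal (ray_ideal f).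
Proof. by apply: is_ideal_add => //; exact: is_ideal_principal. Qed.

Lemma ray_ideal_gen f : ray_ideal f f.
Proof. by apply: ideal_addr => //; exact: principal_self. Qed.

Lemma ray_ideal_sub I f : is_ideal I -> S `<=` I -> I f -> ray_ideal f `<=` I.
Proof. by move=> Ii SI If; apply: ideal_add_sub => //; exact: principal_sub. Qed.

Lemma mul_ray f f' x y : m f -> m f' -> f * f' = 0 ->
  ray_ideal f x -> ray_ideal f' y -> x * y = 0.
Proof.
move=> mf mf' ff [p Sp [_ [c _ <-] <-]] [q Sq [_ [e _ <-] <-]].
rewrite mulrDl Sp; last by apply: idlD => //; [exact: socle_sub_max|exact: idlM].
by rewrite mulrDr mulrACA ff mulr0 addr0 mulrC Sq ?addr0 //; exact: idlM.
Qed.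

Lemma ray_ideal_neq f f' y : m y -> y * f = 0 -> y * f' <> 0 ->
  ray_ideal f <> ray_ideal f'.
Proof.
move=> my yf yf' E; apply: yf'; have : ray_ideal f f' by rewrite E; exact: ray_ideal_gen.
move=> [p Sp [_ [c _ <-] <-]].
by rewrite mulrDr mulrCA yf mulr0 addr0 mulrC Sp.
Qed.

Lemma ray_ideal_neq0 f : ray_ideal f <> [set 0].
Proof.
by apply: (@neq0_idl _ _ s) => //; apply: ideal_addl; [exact: is_ideal_principal|exact: socle_gen].
Qed.

Lemma ray_vertex f : m f -> AG_vertex (ray_ideal f).
Proof.
move=> mf; apply: (@annihilating_vertex _ _ S) => //; first exact: ray_ideal_is_ideal.
- exact: ray_ideal_neq0.
- exact: neq0_idl socle_gen s0.
- move=> x y fx Sy; rewrite mulrC Sy //.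
  apply: (ray_ideal_sub mi socle_sub_max mf) fx.
Qed.

Variable rho : nat -> R.
Hypothesis rhoP : forall i j, (i < j)%N -> ~ m (rho j - rho i).

Definition orth f : set R := [set x | x * f = 0].

Lemma orth_ideal f : is_ideal (orth f).
Proof.
rewrite /orth; split=> /= [|x y xf yf|a x xf]; first by rewrite mul0r.
  by rewrite mulrDl xf yf addr0.
by rewrite -mulrA xf mulr0.
Qed.

(** In dimension at least 3 the form leaves enough room for a subdivided K_{3,n},
    with a, b and 0 (that is, S) as the class of three vertices.  For each j, choose
    y outside the lines and the orthogonals of a, b and of all vectors chosen
    before, which is possible because R/m is infinite, then z1 orthogonal to a and y
    and z2 orthogonal to b and y.  The vertex y_j is the line of y, joined to S by an
    edge, to a through z1 and to b through z2.  As y is orthogonal to z1 and z2 but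
    to no earlier vector, the lines of z1 and z2 are new as well. *)
Lemma no_three_dimensions a b c : m a -> m b -> m c ->
  ~ indep3 m S a b c.
Proof.
move=> ma mb mc abc; have ab := indep3_2 abc.
have val x y : m x -> m y -> principal s (x * y).
  by move=> mx my; rewrite -socleE; exact: mul_in_socle.
have Sa : ~ S a := indep2l Lm ab; have Sb : ~ S b := indep2l Lm (indep2C ab).
pose valid (t : R * R * R) := let: (y, z1, z2) := t in
  [/\ [/\ m y, m z1 & m z2], [/\ ~ S y, ~ S z1 & ~ S z2],
      [/\ z1 * a = 0, z1 * y = 0, z2 * b = 0 & z2 * y = 0],
      y * a <> 0 /\ y * b <> 0 & ~ ray_ideal a y /\ ~ ray_ideal b y].
pose parts (t : R * R * R) := let: (y, z1, z2) := t in [:: y; z1; z2].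
pose compat (t t' : R * R * R) := let: (y, _, _) := t' in
  forall f, f \in parts t -> ~ ray_ideal f y /\ y * f <> 0.
have [|F [h [h0 hS hP Fh]]] := @history_choice (R * R * R)%type (fun h t =>
    (forall t', t' \in h -> valid t') -> valid t /\ forall t', t' \in h -> compat t' t).
  move=> h; have [hv|] := pselect (forall t', t' \in h -> valid t'); last by exists (0, 0, 0).
  pose fs := [:: a, b & flatten (map parts h)].
  have fsP f : f \in fs -> m f /\ ~ S f.
    rewrite !inE => /or3P[/eqP ->|/eqP ->|/flatten_mapP[[[y z1] z2] /hv]] //.
    move=> [[? ? ?] [? ? ?] _ _ _].
    by rewrite !inE => /or3P[] /eqP ->.
  pose Ws : seq (set R) := map ray_ideal fs ++ map orth fs.
  have [|y my yW] := avoid_ideals noethR Lm (s := Ws) rhoP mi.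
    move=> W; rewrite mem_cat => /orP[] /mapP[f /fsP[mf Sf] ->].
      split; first exact: ray_ideal_is_ideal.
      apply: contrapT => H.
      have [fa fb] : ray_ideal f a /\ ray_ideal f b.
        by split; apply: contrapT => nf; apply: H; [exists a|exists b].
      move: fa fb => [p Sp [_ [al _ <-] aE]] [q Sq [_ [be _ <-] bE]].
      have [mbe mal] : m be /\ m (- al).
        apply: ab; have -> : be * a + - al * b = be * p - al * q.
          by rewrite -aE -bE; ring.
        exact: (idlB Si (idlM be Si Sp) (idlM al Si Sq)).
      apply: Sa; rewrite -aE; apply: (idlD Si Sp); apply: mul_in_socle => //.
      by rewrite -[al]opprK; exact: idlN.
    split; first exact: orth_ideal.
    apply: contrapT => H; apply: Sf => x mx /=; rewrite mulrC.
    by apply: contrapT => xf; apply: H; exists x.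
  have yfs f : f \in fs -> ~ ray_ideal f y /\ y * f <> 0.
    move=> ff; split; [apply: (yW (ray_ideal f))|apply: (yW (orth f))];
      by rewrite mem_cat map_f ?orbT.
  have [ya yb] : (~ ray_ideal a y /\ y * a <> 0) /\ (~ ray_ideal b y /\ y * b <> 0).
    by split; apply: yfs; rewrite !inE eqxx ?orbT.
  have orthogonal x : m x -> exists z, [/\ m z, ~ S z, z * x = 0 & z * y = 0].
    move=> mx.
    have [d [e [xd xe de H]]] := kernel3 noethR Lm abc mul_socle_gen (val x a mx ma)
      (val x b mx mb) (val x c mx mc).
    have [md me] := H m mi ma mb mc.
    have [z [yz Sz H']] := kernel2 noethR Lm de mul_socle_gen (val y d my md) (val y e my me).
    exists z; split=> //; first exact: H'.
      by apply: (H' (orth x)); [exact: orth_ideal|rewrite /orth /= mulrC|rewrite /orth /= mulrC].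
    by rewrite mulrC.
  have [z1 [mz1 Sz1 z1a z1y]] := orthogonal a ma.
  have [z2 [mz2 Sz2 z2b z2y]] := orthogonal b mb.
  exists (y, z1, z2) => _; split.
    split=> //; [split=> //|by case: ya yb => ? ? []|by case: ya yb => ? ? []].
    by move=> Sy; case: ya => + _; apply; apply: ideal_addl => //; exact: is_ideal_principal.
  move=> t th f ft; apply: yfs; rewrite !inE; apply/or3P; constructor 3.
  by apply/flatten_mapP; exists t.
have valF n : valid (F n).
  have hv : forall t, t \in h n -> valid t.
    elim: n => [|n IHn] t; first by rewrite h0.
    by rewrite hS inE => /orP[/eqP ->|/IHn//]; case: (hP n IHn).
  by case: (hP n hv).
have compF i j : (i < j)%N -> compat (F i) (F j).
  move=> ij; have hv : forall t, t \in h j -> valid t.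
    elim: (j) => [|n IHn] t; first by rewrite h0.
    by rewrite hS inE => /orP[/eqP ->|/IHn//]; case: (hP n IHn).
  by have [_] := hP j hv; apply; exact: Fh.
have mparts n f : f \in parts (F n) -> m f /\ ~ S f.
  case: (F n) (valF n) => [[y z1] z2] [[? ? ?] [? ? ?] _ _ _].
  by rewrite !inE => /or3P[] /eqP ->.
pose hub (i : 'I_3) : R := nth 0 [:: a; b; 0] i.
have mhub i : m (hub i).
  by rewrite /hub; case: i => [[|[|[|//]]] ?] //=; exact: idl0.
have ray0 f : ray_ideal 0 f -> S f.
  by move=> [p Sp [_ [e _ <-] <-]]; rewrite mulr0 addr0.
have arm_arm i j f f' : i != j -> f \in parts (F i) -> f' \in parts (F j) ->
    ray_ideal f <> ray_ideal f'.
  suff lt k l e e' : (k < l)%N -> e \in parts (F k) -> e' \in parts (F l) ->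
      ray_ideal e <> ray_ideal e'.
    rewrite neq_ltn => /orP[/lt H ff ff'|/lt H ff ff']; first exact: H.
    by apply/nesym; exact: H.
  move=> /compF + ek; case: (F l) (valF l) => [[y z1] z2] val' /(_ _ ek)[ney yne].
  case: val' => [[my _ _] _ [_ z1y _ z2y] _ _].
  rewrite !inE => /or3P[] /eqP -> E.
  - by apply: ney; rewrite E; exact: ray_ideal_gen.
  - by apply: (ray_ideal_neq my _ yne (esym E)); rewrite mulrC.
  - by apply: (ray_ideal_neq my _ yne (esym E)); rewrite mulrC.
have hub_arm i j f : f \in parts (F j) -> ray_ideal (hub i) <> ray_ideal f.
  move=> fj; have [mf Sf] := mparts j f fj.
  case: (F j) (valF j) fj => [[y z1] z2] [[my _ _] _ [_ z1y _ z2y] [ya yb] [nya nyb]].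
  have perp e : e \in [:: y; z1; z2] -> e = y \/ y * e = 0.
    rewrite !inE => /or3P[] /eqP ->; [by left|right|right]; by rewrite mulrC.
  move=> /perp fy E; rewrite /hub in E; case: i E => [[|[|[|//]]] ?] /= E; last first.
  - by apply: Sf; apply: ray0; rewrite E; exact: ray_ideal_gen.
  - case: fy => fy; last exact: (ray_ideal_neq my fy yb (esym E)).
    by apply: nyb; rewrite E fy; exact: ray_ideal_gen.
  - case: fy => fy; last exact: (ray_ideal_neq my fy ya (esym E)).
    by apply: nya; rewrite E fy; exact: ray_ideal_gen.
have hub_hub i k : i != k -> ray_ideal (hub i) <> ray_ideal (hub k).
  have nab : ray_ideal a <> ray_ideal b.
    move=> E; have : ray_ideal a b by rewrite E; exact: ray_ideal_gen.
    move=> [p Sp [_ [al _ <-] bE]]; apply: (local_proper Lm).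
    have [] // : m (- al) /\ m 1.
    by apply: ab; have -> : - al * a + 1 * b = b - al * a by [ring]; rewrite -bE addrK.
  have na0 : ray_ideal a <> ray_ideal 0.
    by move=> E; apply: Sa; apply: ray0; rewrite -E; exact: ray_ideal_gen.
  have nb0 : ray_ideal b <> ray_ideal 0.
    by move=> E; apply: Sb; apply: ray0; rewrite -E; exact: ray_ideal_gen.
  by rewrite /hub; case: i k => [[|[|[|//]]] ?] [[|[|[|//]]] ?] //= _; (assumption || exact: nesym).
pose V f (mf : m f) : vertex (AG R) := exist _ (ray_ideal f) (ray_vertex mf).
have [g [emb _]] := fingenus.
have [n /(_ emb) bound] := embeds_links_bound K (AG R) g.
have my (j : 'I_n) : m (F j).1.1.
  by have [] := mparts j (F j).1.1 => //; case: (F j) => [[y z1] z2]; exact: mem_head.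
pose ideal_of (v : vertex (AG R)) : set R := sval v.
pose B (i : 'I_3) (j : 'I_n) : set (set R) :=
  [set ray_ideal (hub i)] `|` [set ray_ideal f | f in [set` parts (F j)]].
apply: (bound (fun i => V _ (mhub i)) (fun j => V _ (my j))
  (fun i j => ideal_of @^-1` B i j)).
- move=> i j; apply: finite_preimage.
    by move=> [u ?] [v ?] _ _ /= uv; exact: eq_exist.
  rewrite finite_setU; split; first exact: finite_set1.
  exact/finite_image/finite_seq.
- have edge f f' (mf : m f) (mf' : m f') (C : set (set R)) : C (ray_ideal f) -> C (ray_ideal f') ->
      f * f' = 0 -> ray_ideal f <> ray_ideal f' -> link (ideal_of @^-1` C) (V f mf) (V f' mf').
    move=> Cf Cf' ff ne; apply: link_edge => //; split.
      by move=> /(congr1 sval).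
    by apply: ideal_mul_eq0 => u v /=; exact: mul_ray.
  move=> i j; have inB f : f \in parts (F j) -> B i j (ray_ideal f).
    by move=> fj; right; exists f.
  have hubB : B i j (ray_ideal (hub i)) by left.
  have armB := hub_arm i j.
  pose y := (F j).1.1; pose z1 := (F j).1.2; pose z2 := (F j).2.
  have [mz1 mz2] : m z1 /\ m z2.
    by rewrite /z1 /z2; case: (F j) (valF j) => [[? ?] ?] [[]].
  have [z1a z1y z2b z2y] : [/\ z1 * a = 0, z1 * y = 0, z2 * b = 0 & z2 * y = 0].
    by rewrite /y /z1 /z2; case: (F j) (valF j) => [[? ?] ?] [].
  have [ya yb] : y * a <> 0 /\ y * b <> 0.
    by rewrite /y; case: (F j) (valF j) => [[? ?] ?] [].
  have [yp z1p z2p] : [/\ y \in parts (F j), z1 \in parts (F j) & z2 \in parts (F j)].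
    by rewrite /y /z1 /z2; case: (F j) => [[? ?] ?]; rewrite !inE !eqxx !orbT.
  have := mhub i; move: hubB armB; rewrite /hub.
  case: i inB => [[|[|[|//]]] ilt] inB /= hubB armB mh.
  + apply: (@link_trans _ _ _ (V z1 mz1)).
      apply: edge => //; [exact: inB|by rewrite mulrC|exact: armB].
    apply: edge => //; [exact: inB|exact: inB|].
    by apply: (@ray_ideal_neq _ _ a) => //; rewrite mulrC.
  + apply: (@link_trans _ _ _ (V z2 mz2)).
      apply: edge => //; [exact: inB|by rewrite mulrC|exact: armB].
    apply: edge => //; [exact: inB|exact: inB|].
    by apply: (@ray_ideal_neq _ _ b) => //; rewrite mulrC.
  + by apply: edge => //; [exact: inB|rewrite mul0r|exact: armB].
- move=> i j k l ik jl; rewrite -subset0 => v [].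
  move=> [vi|[f fj vf]] [vk|[f' fl vf']].
  + by apply: (hub_hub i k ik); rewrite -vi -vk.
  + by apply: (hub_arm i l f' fl); rewrite -vi vf'.
  + by apply: (hub_arm k j f fj); rewrite -vk vf.
  + by apply: (arm_arm j l f f' jl fj fl); rewrite vf vf'.
Qed.

End IndexTwo.

Section Pairing.
Variable R : comNzRingType.
Implicit Types (I J : set R).

(** The two ideals of a pair of fig2 and fig3; pair_side chooses one of them. *)
Definition pair_of I : set (set R) := [set I; annihilator I].
Definition pair_side I : bool := `[< I = get (pair_of I) >].

Lemma pair_inj I J : pair_of I = pair_of J -> pair_side I = pair_side J -> I = J.
Proof.
move=> IJ; rewrite /pair_side IJ; case: asboolP => [IE|nI] /esym/asboolP.
  by move=> ->.
move=> nJ; have : pair_of J (get (pair_of J)).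
  by apply: (@getPex _ (pair_of J)); exists J; left.
have : pair_of J I by rewrite -IJ; left.
by case=> // IA [/esym|/esym/=]; rewrite -?IA.
Qed.

(** The condition says that the graph without its centre is a matching, where the
    partner of I is Ann(I). *)
Lemma pairs_fig2 (m : set R) : AG_vertex (annihilator m) ->
  (forall I J, AG_vertex I -> AG_vertex J -> I <> annihilator m ->
     J <> annihilator m -> ideal_mul I J = [set 0] ->
     J = annihilator I /\ I = annihilator J) ->
  AG_in_fig2 m.
Proof.
set C := annihilator m => vC pairs.
pose f (v : vertex (AG R)) : fig2_vertex (set (set R)) void :=
  if `[< sval v = C >] then F2c
  else @F2pair _ void (pair_of (sval v)) (pair_side (sval v)).
have fC v : sval v = C -> f v = F2c by move=> E; rewrite /f asboolT.
have fP v : sval v <> C -> f v = @F2pair _ void (pair_of (sval v)) (pair_side (sval v)).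
  by move=> E; rewrite /f asboolF.
exists (set (set R)), void, f; split; last by exists (exist _ C vC); split=> //; exact: fC.
split=> [u v|u v [uv IJ]].
  have [uC|uC] := pselect (sval u = C); have [vC'|vC'] := pselect (sval v = C);
    rewrite ?(fC _ uC) ?(fP _ uC) ?(fC _ vC') ?(fP _ vC') //.
    by move=> _; apply: vertex_val_inj; rewrite uC.
  by case=> /pair_inj + /[dup] => /[apply] /vertex_val_inj.
have [uC|uC] := pselect (sval u = C); have [vC'|vC'] := pselect (sval v = C);
  rewrite ?(fC _ uC) ?(fP _ uC) ?(fC _ vC') ?(fP _ vC') //=.
  by apply: uv; apply: vertex_val_inj; rewrite uC.
have [JE IE] := pairs _ _ (svalP u) (svalP v) uC vC' IJ.
have pE : pair_of (sval u) = pair_of (sval v).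
  by rewrite /pair_of -JE -IE setUC.
by split=> // /(pair_inj pE)/vertex_val_inj.
Qed.

Lemma pairs_fig3 (m : set R) : AG_vertex (annihilator m) ->
  annihilator m = ideal_pow m 3 -> AG_vertex (ideal_pow m 2) ->
  annihilator m <> ideal_pow m 2 ->
  (forall I J, AG_vertex I -> AG_vertex J -> I <> annihilator m ->
     J <> annihilator m -> I <> ideal_pow m 2 -> J <> ideal_pow m 2 ->
     ideal_mul I J = [set 0] ->
     J = annihilator I /\ I = annihilator J) ->
  AG_in_fig3 m.
Proof.
set C := annihilator m; set D := ideal_pow m 2 => vC C3 vD CD pairs.
pose f (v : vertex (AG R)) : fig3_vertex (set (set R)) void void :=
  if `[< sval v = C >] then F3c else if `[< sval v = D >] then F3d
  else @F3pair _ void void (pair_of (sval v)) (pair_side (sval v)).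
have fC v : sval v = C -> f v = F3c by move=> E; rewrite /f asboolT.
have fD v : sval v = D -> f v = F3d.
  by move=> E; rewrite /f asboolF ?asboolT // E; exact: nesym.
have fP v : sval v <> C -> sval v <> D ->
    f v = @F3pair _ void void (pair_of (sval v)) (pair_side (sval v)).
  by move=> n1 n2; rewrite /f !asboolF.
have cls (v : vertex (AG R)) : [\/ sval v = C, sval v = D | sval v <> C /\ sval v <> D].
  have [?|n1] := pselect (sval v = C); first by constructor 1.
  by have [?|n2] := pselect (sval v = D); [constructor 2|constructor 3].
exists (set (set R)), void, void, f; split=> //; last first.
- by exists (exist _ D vD); split=> //; exact: fD.
- by exists (exist _ C vC); split=> //; exact: fC.
split=> [u v|u v [uv IJ]].
  case: (cls u) => [uC|uD|[uC uD]]; case: (cls v) => [vC'|vD'|[vC' vD']];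
    rewrite ?(fC _ uC) ?(fD _ uD) ?(fP _ uC uD) ?(fC _ vC') ?(fD _ vD') ?(fP _ vC' vD') //.
  - by move=> _; apply: vertex_val_inj; rewrite uC.
  - by move=> _; apply: vertex_val_inj; rewrite uD.
  - by case=> /pair_inj + /[dup] => /[apply] /vertex_val_inj.
case: (cls u) => [uC|uD|[uC uD]]; case: (cls v) => [vC'|vD'|[vC' vD']];
  rewrite ?(fC _ uC) ?(fD _ uD) ?(fP _ uC uD) ?(fC _ vC') ?(fD _ vD') ?(fP _ vC' vD') //=.
- by apply: uv; apply: vertex_val_inj; rewrite uC.
- by apply: uv; apply: vertex_val_inj; rewrite uD.
have [JE IE] := pairs _ _ (svalP u) (svalP v) uC vC' uD vD' IJ.
have pE : pair_of (sval u) = pair_of (sval v).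
  by rewrite /pair_of -JE -IE setUC.
by split=> // /(pair_inj pE)/vertex_val_inj.
Qed.

End Pairing.

Lemma AG_fig2_planar (K : realType) (R : comNzRingType) (m : set R) :
  AG_in_fig2 m -> has_genus K (AG R) 0.
Proof.
move=> [A [B [f [fP _]]]]; apply: (@planar_of_fig3 K A void B).
by apply: subgraph_trans (@fig2_fig3 A B); exists f.
Qed.

Lemma AG_fig3_planar (K : realType) (R : comNzRingType) (m : set R) :
  AG_in_fig3 m -> has_genus K (AG R) 0.
Proof. by move=> [A [B [C [f [fP _ _ _]]]]]; apply: (@planar_of_fig3 K A B C); exists f. Qed.

Section IndexTwoPlane.
Variables (R : comNzRingType) (noethR : noetherian R).
Variables (m : set R) (Lm : local_with m) (s : R).
Implicit Types (I J L M : set R) (a b c r q x y z f : R).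

(** A proper ideal other than 0, S and m is S + Rq for any of its elements q outside
    S: with one more element it would contain a basis of m/S.  The annihilator of a
    vertex I other than S is of this kind, and an ideal J other than 0 and S that I
    kills contains such a q, so that J is all of the annihilator. *)
Lemma index_two_fig2 a b : annihilator m = principal s -> s <> 0 ->
  ideal_pow m 2 = annihilator m -> m a -> m b ->
  indep2 m (annihilator m) a b ->
  (forall x, m x -> exists r q, annihilator m (x - (r * a + q * b))) ->
  AG_in_fig2 m.
Proof.
move=> socleE s0 socle2 ma mb ab gen; have mi := local_ideal Lm.
have Si := is_ideal_annihilator m.
have mm x y : m x -> m y -> annihilator m (x * y) :=
  mul_in_socle Lm socle2 (x := x) (y := y).
have sm := socle_sub_max Lm socle2.
have sS := socle_gen socleE.
have S0 : annihilator m <> [set 0] := neq0_idl sS s0.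
have socle_in I q : is_ideal I -> I q -> m q -> ~ annihilator m q ->
    annihilator m `<=` I.
  move=> Ii Iq mq Sq.
  have [x mx qx] : exists2 x, m x & q * x <> 0.
    by apply: contrapT => H; apply: Sq => x mx; apply: contrapT => ?; apply: H; exists x.
  rewrite -(@simple_socle _ noethR _ Lm s (principal (q * x)) socleE).
  - by apply: principal_sub => //; exact: idlMr.
  - exact: is_ideal_principal.
  - by apply: principal_sub => //; exact: mm.
  - exact: principal_neq0.
have basis p q : m p -> m q -> indep2 m (annihilator m) p q ->
    forall I, is_ideal I -> annihilator m `<=` I -> I p -> I q -> m `<=` I.
  exact: (basis_exchange noethR Lm Si mm gen ma mb).
have line_max I q : is_ideal I -> I `<=` m -> I <> m -> I q -> ~ annihilator m q ->
    I `<=` ideal_add (annihilator m) (principal q).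
  move=> Ii Im nIm Iq Sq p Ip; apply: contrapT => np; apply: nIm.
  apply/seteqP; split=> //; apply: (basis q p) => //; [exact: Im|exact: Im| |].
    apply: (indep2_intro noethR Lm) => // c mc; apply: mm => //; exact: Im.
  by apply: (socle_in I q) => //; exact: Im.
have vS : AG_vertex (annihilator m).
  by apply: (annihilating_vertex Si Si) => // x y Sx Sy; apply: Sx; exact: sm.
apply: pairs_fig2 => // I J vI vJ nI nJ IJ.
have half I' J' : AG_vertex I' -> AG_vertex J' -> I' <> annihilator m ->
    J' <> annihilator m -> ideal_mul I' J' = [set 0] -> J' = annihilator I'.
  move=> vI' vJ' nI' nJ' IJ'.
  have Ii := vertex_ideal vI'; have Ji := vertex_ideal vJ'.
  have Im := vertex_proper noethR Lm vI'; have Jm := vertex_proper noethR Lm vJ'.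
  have Ai := is_ideal_annihilator I'.
  have [q Jq Sq] : exists2 q, J' q & ~ annihilator m q.
    apply: contrapT => H; apply: nJ'; apply: (simple_socle noethR Lm socleE Ji).
      by move=> x Jx; apply: contrapT => ?; apply: H; exists x.
    by case: vJ'.
  have JA : J' `<=` annihilator I'.
    by move=> x Jx y Iy; rewrite mulrC; exact: (ideal_mul0 IJ').
  apply/seteqP; split=> //.
  have An : annihilator I' <> m.
    move=> AE; apply: nI'; apply: (simple_socle noethR Lm socleE Ii); last by case: vI'.
    move=> x Ix y my; rewrite mulrC; have : annihilator I' y by rewrite AE.
    exact.
  have Am : annihilator I' `<=` m.
    apply: (proper_sub_local noethR Lm) => // AT.
    have [_ I0] := vI'; have [x Ix x0] := idl_neq0 Ii I0.
    by apply: x0; rewrite -[x]mul1r; have : annihilator I' 1 by [rewrite AT]; apply.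
  apply: subset_trans (line_max _ q Ai Am An (JA _ Jq) Sq) _.
  apply: ideal_add_sub => //; last exact: principal_sub.
  by apply: (socle_in J' q) => //; exact: Jm.
by split; apply: half => //; rewrite ideal_mulC.
Qed.

End IndexTwoPlane.

(** * Maximal ideals with m^4 = 0 *)

Section IndexThree.
Variables (K : realType) (R : comNzRingType) (noethR : noetherian R).
Hypothesis fingenus : finite_genus K (AG R).
Variables (m : set R) (Lm : local_with m) (s : R).
Hypothesis socleE : annihilator m = principal s.
Hypothesis s0 : s <> 0.
Hypothesis socle3 : ideal_pow m 3 = annihilator m.
Hypothesis pow4 : ideal_pow m 4 = [set 0].
Variable rho : nat -> R.
Hypothesis rhoP : forall i j, (i < j)%N -> ~ m (rho j - rho i).
Implicit Types (I J L M : set R) (a b c r q x y z f : R).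

Let mi : is_ideal m := local_ideal Lm.
Let S := annihilator m.
Let Q := ideal_pow m 2.
Let Si : is_ideal S := is_ideal_annihilator m.
Let Qi : is_ideal Q := is_ideal_pow 2 mi.

Lemma socle_cube : S = ideal_pow m 3. Proof. by rewrite socle3. Qed.

Lemma socle_sub_square : S `<=` Q. Proof. by rewrite socle_cube; exact: ideal_pow_le. Qed.

Lemma square_sub_max : Q `<=` m.
Proof. by rewrite -[X in _ `<=` X](ideal_pow1 mi); exact: ideal_pow_le. Qed.

Lemma mul_in_square x y : m x -> m y -> Q (x * y). Proof. exact: mem_pow2. Qed.

Lemma mul_square_in_socle x y : m x -> Q y -> S (x * y).
Proof. by move=> mx Qy; rewrite socle_cube; exact: ideal_powSl. Qed.

Lemma mul_squares0 x y : Q x -> Q y -> x * y = 0.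
Proof. by move=> Qx Qy; have := ideal_powM mi Qx Qy; rewrite pow4. Qed.

Lemma mul_socle0 x y : S x -> m y -> x * y = 0. Proof. by move=> Sx; exact: Sx. Qed.

Lemma socle_gen3 : S s. Proof. by rewrite /S socleE; exact: principal_self. Qed.

Lemma mul_socle_gen3 c : m c -> c * s = 0.
Proof. by move=> mc; rewrite mulrC; exact: socle_gen3. Qed.

Lemma socle3_neq0 : S <> [set 0]. Proof. exact: neq0_idl socle_gen3 s0. Qed.

Lemma S_generated x : S x -> x <> 0 -> S = principal x.
Proof.
move=> Sx x0; apply/esym; apply: (simple_socle noethR Lm socleE).
- exact: is_ideal_principal.
- exact: principal_sub.
- exact: principal_neq0.
Qed.

Lemma coef_in_m c x : c * x = 0 -> x <> 0 -> m c.
Proof.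
move=> cx x0; apply: contrapT => /(local_unit noethR Lm)[u uc]; apply: x0.
by rewrite -[x]mul1r -uc -mulrA cx mulr0.
Qed.

(** Two elements of m^2 that are independent modulo S would span a pencil of ideals
    inside m^2; all of them kill one another since m^4 = 0. *)
Lemma square_generator : exists w, [/\ Q w, ~ S w &
  forall p, Q p -> exists c, S (p - c * w)].
Proof.
have [w Qw Sw] : exists2 w, Q w & ~ S w.
  apply: contrapT => H; have QS : Q `<=` S.
    by move=> x Qx; apply: contrapT => Sx; apply: H; exists x.
  apply: socle3_neq0; have Q0 : Q = [set 0].
    apply: (nakayama0 noethR Lm) => // x /QS; rewrite socle_cube; exact.
  apply/seteqP; split; last by move=> _ ->; exact: idl0.
  by rewrite -Q0; exact: socle_sub_square.
exists w; split=> // p Qp; apply: contrapT => H.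
have ind : indep2 m S w p.
  apply: (indep2_intro noethR Lm) => // [c mc|]; first exact: mul_square_in_socle.
  by move=> [q Sq [_ [c _ <-] qE]]; apply: H; exists c; rewrite -qE addrK.
have linj := line_inj noethR Lm Si ind rhoP.
have lQ n : line S w p (rho n) `<=` Q by apply: line_sub => //; exact: socle_sub_square.
have li n := is_ideal_line w p (rho n) Si.
have l0 n : line S w p (rho n) <> [set 0].
  apply: (neq0_idl _ s0); apply: ideal_addl; first exact: is_ideal_principal.
  exact: socle_gen3.
have ne i j : i != j -> line S w p (rho i) <> line S w p (rho j).
  by move=> /eqP ij E; apply: ij; exact: linj.
apply: (three_killers fingenus (li 0%N) (li 1%N) (li 2%N) (l0 _) (l0 _) (l0 _)
  (ne 0%N 1%N isT) (ne 0%N 2%N isT) (ne 1%N 2%N isT) li linj) => n x y Ax Fy.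
by apply: mul_squares0; [case: Ax => [|[]]; exact: lQ|exact: lQ Fy].
Qed.

Section Generator.
Variable w : R.
Hypothesis Qw : Q w.
Hypothesis Sw : ~ S w.
Hypothesis genw : forall p, Q p -> exists c, S (p - c * w).

Lemma ortho_square x y : m x -> w * x = 0 -> Q y -> x * y = 0.
Proof.
move=> mx wx Qy; have [c Sy] := genw Qy.
rewrite -(subrK (c * w) y) mulrDr mulrCA [x * w]mulrC wx mulr0 addr0 mulrC.
exact: mul_socle0.
Qed.

Lemma ortho_mul x y : m x -> w * x = 0 -> m y -> S (x * y).
Proof.
by move=> mx wx my z mz; rewrite -mulrA; apply: ortho_square => //; exact: mul_in_square.
Qed.

(** With dim m/m^2 at least 3, the elements killed by w contain two that are
    independent modulo m^2, d and e; with w they span a 3-space modulo S, in which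
    the orthogonal of d is a plane.  The pencil of this plane is killed by S, by m^2
    and by S + Rd. *)
Lemma index_three_no_three_dimensions a b c : m a -> m b -> m c ->
  ~ indep3 m Q a b c.
Proof.
move=> ma mb mc abc.
have val x : m x -> principal s (w * x).
  by move=> mx; rewrite -socleE mulrC; exact: mul_square_in_socle.
have [d [e [wd we de H]]] := kernel3 noethR Lm abc mul_socle_gen3 (val a ma) (val b mb) (val c mc).
have [md me] := H m mi ma mb mc.
have dew : indep3 m S d e w.
  move=> r q p Srqp.
  have [mr mq] : m r /\ m q.
    apply: de; have -> : r * d + q * e = (r * d + q * e + p * w) - p * w by rewrite addrK.
    by apply: (idlB Qi (socle_sub_square Srqp)); exact: idlM.
  split=> //; apply: contrapT => /(local_unit noethR Lm)[u up]; apply: Sw.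
  have Sd : S (r * d) by rewrite mulrC; exact: ortho_mul.
  have Se : S (q * e) by rewrite mulrC; exact: ortho_mul.
  have -> : w = u * ((r * d + q * e + p * w) - (r * d + q * e)).
    by rewrite [_ + p * w]addrC addrK mulrA up mul1r.
  exact: (idlM u Si (idlB Si Srqp (idlD Si Sd Se))).
have vald x : m x -> principal s (d * x).
  by move=> mx; rewrite -socleE; exact: ortho_mul.
have [d1 [d2 [dd1 dd2 d12 H']]] := kernel3 noethR Lm dew mul_socle_gen3
  (vald d md) (vald e me) (vald w (square_sub_max Qw)).
pose N : set R := m `&` annihilator Q.
have Ni : is_ideal N by apply: is_ideal_cap => //; exact: is_ideal_annihilator.
have Nd : N d by split=> // y Qy; exact: ortho_square.
have Ne : N e by split=> // y Qy; exact: ortho_square.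
have Nw : N w by split=> [|y Qy]; [exact: square_sub_max|exact: mul_squares0].
have SN : S `<=` N by move=> x Sx; split; [exact/square_sub_max/socle_sub_square|move=> y Qy; exact/Sx/square_sub_max].
have [N1 N2] := H' N Ni Nd Ne Nw.
have linj := line_inj noethR Lm Si d12 rhoP.
pose F n := line S d1 d2 (rho n).
have Fi n : is_ideal (F n) by exact: is_ideal_line.
have FN n : F n `<=` N by apply: line_sub.
have Fd n : F n `<=` orth d.
  apply: line_sub; [exact: orth_ideal| |by rewrite /orth /= mulrC|by rewrite /orth /= mulrC].
  by move=> x Sx; exact: Sx.
have Ai : is_ideal (ideal_add S (principal d)).
  by apply: is_ideal_add => //; exact: is_ideal_principal.
have SA : S `<=` ideal_add S (principal d) by exact/ideal_addl/is_ideal_principal.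
have Ad : ideal_add S (principal d) d by apply: ideal_addr => //; exact: principal_self.
have nQd : ~ Q d := indep2l Lm de.
apply: (three_killers fingenus Si Qi Ai _ _ _ _ _ _ Fi linj).
- exact: socle3_neq0.
- exact: neq0_idl (socle_sub_square socle_gen3) s0.
- exact: neq0_idl (SA _ socle_gen3) s0.
- by move=> E; apply: Sw; rewrite E.
- by move=> E; apply: nQd; apply: socle_sub_square; rewrite E.
- by move=> E; apply: nQd; rewrite E.
move=> n x y [Sx|[Qx|[p Sp [_ [r _ <-] <-]]]] Fy.
- by apply: Sx; case: (FN n y Fy).
- by rewrite mulrC; case: (FN n y Fy) => _; apply.
- rewrite mulrDl Sp; last by case: (FN n y Fy).
  by rewrite -mulrA [d * y]mulrC (Fd n y Fy) mulr0 addr0.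
Qed.

(** With w generating m^2 modulo S, x is first chosen in the kernel of w, then made
    orthogonal to an element y that w does not kill; this yields the basis x, y of
    m/m^2.  Now S + R y^2 contains all products, so that y^2 may replace w, whence
    y^3 is not 0; and x^2 is not 0 since otherwise m x = 0. *)
Lemma normal_form a b : m a -> m b -> indep2 m Q a b ->
  (forall x, m x -> exists r q, Q (x - (r * a + q * b))) ->
  exists x y, [/\ [/\ m x, m y & x * y = 0], S = principal (x * x),
    S = principal (y * y * y), x * x <> 0 /\ y * y * y <> 0 &
    (forall p, Q p -> exists c, S (p - c * (y * y))) /\
    (forall p, m p -> exists r q, p = r * x + q * y)].
Proof.
move=> ma mb ab gen.
have val x : m x -> principal s (w * x).
  by move=> mx; rewrite -socleE mulrC; exact: mul_square_in_socle.
have [d [wd nQd Hd]] := kernel2 noethR Lm ab mul_socle_gen3 (val a ma) (val b mb).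
have md := Hd m mi ma mb.
have [y my wy] : exists2 y, m y & w * y <> 0.
  by apply: contrapT => H; apply: Sw => y my; apply: contrapT => wy; apply: H; exists y.
have Swy : S (w * y) by rewrite mulrC; exact: mul_square_in_socle.
have SE := S_generated Swy wy.
have Sdy : S (d * y) by exact: ortho_mul.
have [be _ beE] : principal (w * y) (d * y) by rewrite -SE.
pose x := d - be * w.
have mx : m x by apply: idlB => //; apply: idlM => //; exact: square_sub_max.
have wx : w * x = 0.
  by rewrite /x mulrBr wd mulrCA (mul_squares0 Qw Qw) mulr0 subrr.
have xy : x * y = 0 by rewrite /x mulrBl -beE mulrA subrr.
have ind : indep2 m Q x y.
  move=> r q H.
  have mq : m q.
    have E : q * (w * y) = w * (r * x + q * y).
      by rewrite mulrDr [w * (r * x)]mulrCA wx mulr0 add0r mulrCA.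
    by apply: (@coef_in_m q (w * y)) => //; rewrite E; exact: mul_squares0.
  split=> //; apply: contrapT => /(local_unit noethR Lm)[u ur]; apply: nQd.
  have -> : d = u * ((r * x + q * y) - q * y) + be * w.
    by rewrite addrK mulrA ur mul1r /x subrK.
  apply: (idlD Qi); last exact: idlM.
  by apply: (idlM u Qi); apply: (idlB Qi H); exact: mul_in_square.
have all I : is_ideal I -> Q `<=` I -> I x -> I y -> m `<=` I.
  exact: (basis_exchange noethR Lm Qi mul_in_square gen ma mb mx my ind).
have Sxx : S (x * x) by exact: ortho_mul.
have xx0 : x * x <> 0.
  move=> xx; apply: (indep2l Lm ind); apply: socle_sub_square => z mz; rewrite mulrC.
  apply: (all (orth x)) => //; first exact: orth_ideal.
    by move=> p Qp /=; rewrite /orth /= mulrC; exact: ortho_square.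
  by rewrite /orth /= mulrC.
have Qyy : forall p, Q p -> exists c, S (p - c * (y * y)).
  suff sub : Q `<=` ideal_add S (principal (y * y)).
    by move=> p /sub[q Sq [_ [c _ <-] <-]]; exists c; rewrite addrK.
  have Yi : is_ideal (ideal_add S (principal (y * y))).
    by apply: is_ideal_add => //; exact: is_ideal_principal.
  have SY : S `<=` ideal_add S (principal (y * y)) by exact/ideal_addl/is_ideal_principal.
  have gen2 : m `<=` ideal_add Q (ideal_add (principal x) (principal y)).
    have XYi : is_ideal (ideal_add (principal x) (principal y)).
      by apply: is_ideal_add; exact: is_ideal_principal.
    apply: all; first exact: is_ideal_add.
    - exact: ideal_addl.
    - apply: ideal_addr => //; apply: ideal_addl; first exact: is_ideal_principal.
      exact: principal_self.
    - apply: ideal_addr => //; apply: ideal_addr; first exact: is_ideal_principal.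
      exact: principal_self.
  apply: ideal_mul_sub => // u v mu mv.
  have {}mv : m v by rewrite -(ideal_pow1 mi).
  have [p Qp [_ [_ [r1 _ <-] [_ [q1 _ <-] <-]] uE]] := gen2 u mu.
  have [p' Qp' [_ [_ [r2 _ <-] [_ [q2 _ <-] <-]] vE]] := gen2 v mv.
  have -> : u * v = (v * p + (r1 * x + q1 * y) * p' + r1 * r2 * (x * x)
      + (r1 * q2 + q1 * r2) * (x * y)) + q1 * q2 * (y * y).
    by rewrite -{1}uE mulrDl [p * v]mulrC -{2}vE; ring.
  rewrite xy mulr0 addr0; apply: (idlD Yi); last first.
    by apply: (idlM _ Yi); apply: ideal_addr => //; exact: principal_self.
  apply: SY; apply: (idlD Si); last exact: (idlM _ Si Sxx).
  apply: (idlD Si); first exact: mul_square_in_socle.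
  by apply: mul_square_in_socle => //; apply: (idlD mi); exact: idlM.
have yyy0 : y * y * y <> 0.
  move=> yyy; have [c Sc] := Qyy w Qw; apply: wy.
  by rewrite -(subrK (c * (y * y)) w) mulrDl mul_socle0 // add0r -mulrA yyy mulr0.
have Syyy : S (y * y * y) by rewrite mulrC; apply: mul_square_in_socle => //; exact: mul_in_square.
exists x, y; split=> //; try exact: S_generated.
split=> // p mp.
have XYi : is_ideal (ideal_add (principal x) (principal y)).
  by apply: is_ideal_add; exact: is_ideal_principal.
have XY1 : ideal_add (principal x) (principal y) x.
  by apply: ideal_addl; [exact: is_ideal_principal|exact: principal_self].
have XY2 : ideal_add (principal x) (principal y) y.
  by apply: ideal_addr; [exact: is_ideal_principal|exact: principal_self].
have SXY : S `<=` ideal_add (principal x) (principal y).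
  by rewrite (S_generated Sxx xx0); apply: principal_sub => //; exact: idlM.
have [_ [r _ <-] [_ [q _ <-] pE]] : ideal_add (principal x) (principal y) p.
  apply: all => // z /Qyy[c Sz].
  rewrite -(subrK (c * (y * y)) z); apply: (idlD XYi); first exact: SXY.
  by apply: (idlM c XYi); exact: idlM.
by exists r, q.
Qed.

End Generator.

(** On m the product is (r x + q y) (r' x + q' y) = r r' x^2 + q q' y^2.  Hence two
    ideals of the same type have a nonzero product, and if I and J are of different
    types and I J = 0, subtracting from an element of Ann(I) a multiple of the leading
    element of J leaves a remainder in S, which lies inside J. *)
Lemma index_three_pairs x y I J : m x -> m y -> x * y = 0 ->
  S = principal (x * x) -> S = principal (y * y * y) ->
  x * x <> 0 -> y * y * y <> 0 ->
  (forall p, Q p -> exists c, S (p - c * (y * y))) ->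
  (forall p, m p -> exists r q, p = r * x + q * y) ->
  AG_vertex I -> AG_vertex J -> I <> S -> J <> S -> I <> Q -> J <> Q ->
  ideal_mul I J = [set 0] -> J = annihilator I /\ I = annihilator J.
Proof.
move=> mx my xy Sx Sy xx0 yyy0 Qyy form.
have Sxx : S (x * x) by rewrite Sx; exact: principal_self.
have Syyy : S (y * y * y) by rewrite Sy; exact: principal_self.
have prod r q r' q' : (r * x + q * y) * (r' * x + q' * y) =
    r * r' * (x * x) + q * q' * (y * y).
  have -> : (r * x + q * y) * (r' * x + q' * y) = r * r' * (x * x) +
    q * q' * (y * y) + (r * q' + q * r') * (x * y) by ring.
  by rewrite xy mulr0 addr0.
have mulmx c : m c -> S (c * x).
  move=> /form[r [q ->]]; rewrite mulrDl -!mulrA [y * x]mulrC xy mulr0 addr0.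
  exact: (idlM r Si Sxx).
have xxy : x * x * y = 0 by rewrite -mulrA xy mulr0.
(* Modulo m^2 an ideal either has an element with a unit in front of y, or all its
   elements outside m^2 are multiples of x. *)
pose ytype L := exists r q, L (r * x + q * y) /\ ~ m q.
pose xtype L := exists r q, [/\ L (r * x + q * y), ~ m r & m q].
have unitM r q : ~ m r -> ~ m q -> ~ m (r * q).
  move=> /(local_unit noethR Lm)[u ur] nq mrq; apply: nq.
  by have := idlM u mi mrq; rewrite mulrA ur mul1r.
have classify L : AG_vertex L -> L <> S -> L <> Q -> ~ ytype L -> xtype L.
  move=> vL LS LQ ny; have Li := vertex_ideal vL.
  have Lm' := vertex_proper noethR Lm vL; have [_ L0] := vL.
  apply: contrapT => nx; have LsubQ : L `<=` Q.
    move=> p Lp; have [r [q pE]] := form p (Lm' _ Lp).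
    have mq : m q by apply: contrapT => nq; apply: ny; exists r, q; rewrite -pE.
    have mr : m r by apply: contrapT => nr; apply: nx; exists r, q; rewrite -pE.
    by rewrite pE; apply: (idlD Qi); exact: mul_in_square.
  have [LsubS|] := pselect (L `<=` S).
    by apply: LS; exact: (simple_socle noethR Lm socleE).
  move=> /existsNP[p /not_implyP[Lp nSp]]; apply: LQ; apply/seteqP; split=> //.
  have [c Sc] := Qyy p (LsubQ _ Lp).
  have nc : ~ m c.
    move=> mc; apply: nSp; rewrite -(subrK (c * (y * y)) p); apply: (idlD Si Sc).
    by apply: mul_square_in_socle => //; exact: mul_in_square.
  have [u uc] := local_unit noethR Lm nc.
  have Ly : L (y * y * y).
    have -> : y * y * y = u * (p * y).
      rewrite -(subrK (c * (y * y)) p) mulrDl (mul_socle0 Sc my) add0r.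
      by rewrite -[LHS]mul1r -uc; ring.
    by apply: idlM => //; exact: idlMr.
  have SL : S `<=` L by rewrite Sy; exact: principal_sub.
  have Lyy : L (y * y).
    have -> : y * y = u * (p - (p - c * (y * y))).
      by rewrite opprB addrC subrK mulrA uc mul1r.
    by apply: idlM => //; apply: idlB => //; exact: SL.
  move=> z /Qyy[e Sz]; rewrite -(subrK (e * (y * y)) z).
  by apply: idlD => //; [exact: SL|exact: idlM].
have noYY L L' : ytype L -> ytype L' -> ideal_mul L L' <> [set 0].
  move=> [r [q [Lp nq]]] [r' [q' [Lp' nq']]] LL'.
  have := ideal_mul0 LL' Lp Lp'; rewrite prod => /(congr1 (fun z => z * y)).
  rewrite mulrDl mul0r -mulrA xxy mulr0 add0r -mulrA => /(coef_in_m)/(_ yyy0).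
  exact: unitM.
have noXX L L' : xtype L -> xtype L' -> ideal_mul L L' <> [set 0].
  move=> [r [q [Lp nr mq]]] [r' [q' [Lp' nr' mq']]] LL'.
  have := ideal_mul0 LL' Lp Lp'; rewrite prod.
  have -> : q * q' * (y * y) = 0.
    by rewrite -mulrA [q' * _]mulrC mulrA mul_socle0 //; apply: mul_square_in_socle => //; exact: mul_in_square.
  by rewrite addr0 => /coef_in_m/(_ xx0); exact: unitM.
have ann_proper L : AG_vertex L -> annihilator L `<=` m.
  move=> [[Li _] L0]; apply: (proper_sub_local noethR Lm).
    exact: is_ideal_annihilator.
  move=> AT; have [z Lz z0] := idl_neq0 Li L0; apply: z0.
  by rewrite -[z]mul1r; have : annihilator L 1 by [rewrite AT]; apply.
have XY L L' : AG_vertex L -> AG_vertex L' -> ytype L -> xtype L' ->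
    ideal_mul L L' = [set 0] -> L' = annihilator L /\ L = annihilator L'.
  move=> vL vL' [ga [de [Lp nde]]] [al [be [Lp' nal mbe]]] LL'.
  have Li := vertex_ideal vL; have Li' := vertex_ideal vL'.
  have [u ude] := local_unit noethR Lm nde.
  have [v val] := local_unit noethR Lm nal.
  set p := ga * x + de * y in Lp; set p' := al * x + be * y in Lp'.
  have xp' : x * p' = al * (x * x).
    by rewrite /p' mulrDr mulrCA [x * (be * y)]mulrCA xy mulr0 addr0.
  have yp : y * p = de * (y * y).
    by rewrite /p mulrDr mulrCA [y * x]mulrC xy mulr0 add0r mulrCA.
  have SL : S `<=` L.
    rewrite Sy; apply: principal_sub => //.
    have -> : y * y * y = u * y * (y * p).
      by rewrite yp -[LHS]mul1r -ude; ring.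
    by apply: idlM => //; exact: idlM.
  have SL' : S `<=` L'.
    rewrite Sx; apply: principal_sub => //.
    have -> : x * x = v * (x * p') by rewrite xp' mulrA val mul1r.
    by apply: idlM => //; exact: idlM.
  have pp' : p * p' = 0 := ideal_mul0 LL' Lp Lp'.
  split; apply/seteqP; split=> q Hq.
  - by move=> z Lz; rewrite mulrC; exact: (ideal_mul0 LL').
  - have [mu [nu qE]] := form q (ann_proper L vL q Hq).
    have qp : q * p = 0 := Hq p Lp.
    have mnu : m nu.
      move: qp; rewrite qE prod => /(congr1 (fun z => z * y)).
      rewrite mulrDl mul0r -mulrA xxy mulr0 add0r -mulrA => /coef_in_m/(_ yyy0) md.
      by apply: contrapT => nnu; exact: (unitM _ _ nnu nde).
    pose ka := nu - mu * v * be.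
    have kaE : q - mu * v * p' = ka * y.
      have -> : ka * y = mu * (1 - v * al) * x + ka * y by rewrite val subrr mulr0 mul0r add0r.
      by rewrite qE /ka /p'; ring.
    have mka : m ka by apply: idlB => //; exact: idlM.
    have ka0 : ka * (de * (y * y)) = 0.
      rewrite -yp mulrA -kaE mulrBl qp -[_ * p' * p]mulrA [p' * p]mulrC pp'.
      by rewrite mulr0 subrr.
    have [k1 [k2 kE]] := form ka mka.
    have kay : ka * y = k2 * (y * y).
      by rewrite kE mulrDl -[k1 * x * y]mulrA xy mulr0 add0r mulrA.
    have mk2 : m k2.
      have : k2 * (de * (y * y * y)) = 0.
        have -> : k2 * (de * (y * y * y)) = de * y * (k2 * (y * y)) by ring.
        by rewrite -kay; rewrite -ka0; ring.
      move=> /coef_in_m; apply=> dy0; apply: nde.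
      exact: coef_in_m dy0 yyy0.
    rewrite -(subrK (mu * v * p') q) kaE kay; apply: idlD => //; last exact: idlM.
    by apply: SL'; apply: mul_square_in_socle => //; exact: mul_in_square.
  - by move=> z Lz; exact: (ideal_mul0 LL').
  - have [mu [nu qE]] := form q (ann_proper L' vL' q Hq).
    have qp' : q * p' = 0 := Hq p' Lp'.
    pose ka := mu - nu * u * ga.
    have kaE : q - nu * u * p = ka * x.
      have -> : ka * x = ka * x + nu * (1 - u * de) * y.
        by rewrite ude subrr mulr0 mul0r addr0.
      by rewrite qE /ka /p; ring.
    have : ka * (al * (x * x)) = 0.
      by rewrite -xp' mulrA -kaE mulrBl qp' -[_ * p * p']mulrA pp' mulr0 subrr.
    move=> /coef_in_m mka; rewrite -(subrK (nu * u * p) q) kaE.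
    apply: idlD => //; last exact: idlM.
    by apply: SL; apply: mulmx; apply: mka => ax; apply: nal; exact: coef_in_m ax xx0.
move=> vI vJ IS JS IQ JQ IJ.
have [yI|nyI] := pselect (ytype I).
  have [yJ|nyJ] := pselect (ytype J); first by case: (noYY I J yI yJ IJ).
  by apply: XY => //; exact: classify.
have xI := classify I vI IS IQ nyI.
have [yJ|nyJ] := pselect (ytype J).
  by have [] := XY J I vJ vI yJ xI; rewrite 1?ideal_mulC.
by case: (noXX I J xI (classify J vJ JS JQ nyJ) IJ).
Qed.

Lemma index_three : (forall x, m <> principal x) ->
  [/\ residue_dim m m (ideal_pow m 2) 2,
      residue_dim m (ideal_pow m 2) (ideal_pow m 3) 1,
      residue_dim m (ideal_pow m 3) (ideal_pow m 4) 1 & AG_in_fig3 m].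
Proof.
move=> np; have [a [b [ma mb ab]]] := two_generators noethR Lm np.
have [w [Qw Sw genw]] := square_generator.
have no3 c : m c -> ~ indep3 m Q a b c.
  by move=> mc; exact: (index_three_no_three_dimensions Qw Sw genw).
have [dim2 gen] := residue_dim2 noethR Lm ma mb ab no3.
split=> //.
- exists (fun=> w); split=> //.
  + by move=> x /genw[c Sc]; exists (fun=> c); rewrite big_ord1 socle3.
  + move=> c; rewrite big_ord1 socle3 => Scw i; rewrite ord1.
    apply: contrapT => /(local_unit noethR Lm)[u uc]; apply: Sw.
    by have := idlM u Si Scw; rewrite mulrA uc mul1r.
- by rewrite socle3 pow4; case: (gorenstein_simple noethR Lm socleE s0).
have [x [y [[mx my xy] Sx Sy [xx0 yyy0] [Qyy form]]]] :=
  normal_form Qw Sw genw ma mb ab gen.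
have Sm' : S `<=` m := subset_trans socle_sub_square square_sub_max.
apply: pairs_fig3.
- by apply: (annihilating_vertex Si Si socle3_neq0 socle3_neq0) => z z' Sz Sz'; exact/Sz/Sm'.
- by rewrite socle3.
- apply: (annihilating_vertex Qi Si _ socle3_neq0); first exact: neq0_idl (socle_sub_square socle_gen3) s0.
  by move=> z z' Qz Sz'; rewrite mulrC; exact/Sz'/square_sub_max.
- by move=> E; apply: Sw; rewrite /S E.
move=> I J vI vJ IS JS IQ JQ.
exact: (index_three_pairs mx my xy Sx Sy xx0 yyy0 Qyy form).
Qed.

End IndexThree.

(** * Double annihilators *)

Section Duality.
Variables (R : comNzRingType) (noethR : noetherian R).
Variables (m : set R) (Lm : local_with m) (s : R).
Hypothesis socleE : annihilator m = principal s.
Implicit Types (I J M : set R) (a b c u x y z : R).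

Let mi : is_ideal m := local_ideal Lm.

(** If u is in Ann(J) but not in Ann(I), where I = J + Rx, then x u generates S, so
    that z u = c x u for any z in Ann(Ann(I)), with some c; and z - c x kills not only
    u and Ann(I) but all of Ann(J), for Ann(J)/Ann(I) is spanned by u. *)
Lemma double_annihilator_step J x : is_ideal J -> J = annihilator (annihilator J) ->
  (forall a, m a -> J (a * x)) ->
  annihilator (annihilator (ideal_add J (principal x))) `<=` ideal_add J (principal x).
Proof.
move=> Ji JE mx; set I := ideal_add J (principal x).
have Pi := is_ideal_principal x.
have Ii : is_ideal I by exact: is_ideal_add.
have JI : J `<=` I by exact: ideal_addl.
have Ix : I x by apply: ideal_addr => //; exact: principal_self.
have [Jx|nJx] := pselect (J x).
  have IE : I `<=` J by apply: ideal_add_sub => //; exact: principal_sub.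
  have -> : I = J by apply/seteqP.
  by rewrite -JE.
have [u Ju ux] : exists2 u, annihilator J u & x * u <> 0.
  apply: contrapT => H; apply: nJx; rewrite JE => u Ju.
  by apply: contrapT => xu; apply: H; exists u.
have Iann v : annihilator J v -> v * x = 0 -> annihilator I v.
  move=> Jv vx _ [j Jj [_ [c _ <-] <-]].
  by rewrite mulrDr (Jv j Jj) add0r mulrCA vx mulr0.
have socv v : annihilator J v -> annihilator m (x * v).
  by move=> Jv a ma; rewrite mulrC mulrA mulrC (Jv _ (mx a ma)).
have SE : annihilator m = principal (x * u).
  apply/esym; apply: (simple_socle noethR Lm socleE).
  - exact: is_ideal_principal.
  - by apply: principal_sub; [exact: is_ideal_annihilator|exact: socv].
  - exact: principal_neq0.
move=> z Iz; have : annihilator m (z * u).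
  move=> a ma; rewrite -mulrA; apply: Iz; apply: Iann.
    by move=> j Jj; rewrite mulrAC (Ju j Jj) mul0r.
  by rewrite -mulrA Ju //; exact: mx.
rewrite SE => -[c _ cE].
rewrite -(subrK (c * x) z); apply: (idlD Ii); last exact: (idlM c Ii Ix).
apply: JI; rewrite JE => v Jv.
have := socv v Jv; rewrite SE => -[e _ eE].
have /Iz zv : annihilator I (v - e * u).
  have AJ := is_ideal_annihilator J.
  apply: Iann; first exact: (idlB AJ Jv (idlM e AJ Ju)).
  by rewrite mulrBl [v * x]mulrC -eE; ring.
have -> : (z - c * x) * v = z * (v - e * u) + e * (z * u) - c * (x * v) by ring.
by rewrite zv -cE -eE; ring.
Qed.

(** The duality of Gorenstein rings.  The intersections with M of the members of a
    chain from 0 to R with simple quotients form a chain from 0 to M of the same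
    kind, along which double_annihilator_step applies. *)
Lemma double_annihilator M n : ideal_pow m n = [set 0] -> is_ideal M ->
  annihilator (annihilator M) `<=` M.
Proof.
move=> mn Mi; pose closed J := annihilator (annihilator J) `<=` J.
have closedE J : closed J -> J = annihilator (annihilator J).
  by move=> cJ; apply/seteqP; split=> // z Jz a Ja; rewrite mulrC; exact: Ja.
suff : closed ([set: R] `&` M) by rewrite setTI.
apply: (nilpotent_ind noethR Lm (P := fun J => closed (J `&` M)) mn).
  move=> z zA; have A1 : annihilator ([set 0] `&` M) 1.
    by move=> x [-> _]; rewrite mulr0.
  by have := zA 1 A1; rewrite mulr1 => ->; split=> //; exact: idl0.
move=> J x Ji cJM mx; set I := ideal_add J (principal x).
have Pi := is_ideal_principal x.
have Ii : is_ideal I by exact: is_ideal_add.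
have JI : J `<=` I by exact: ideal_addl.
have Ix : I x by apply: ideal_addr => //; exact: principal_self.
have JMi : is_ideal (J `&` M) by exact: is_ideal_cap.
have mIJ a z : m a -> I z -> J (a * z).
  move=> ma [j Jj [_ [c _ <-] <-]]; rewrite mulrDr mulrCA.
  by apply: (idlD Ji); apply: (idlM _ Ji) => //; exact: mx.
have [sub|/existsNP[z /not_implyP[[Iz Mz] nz]]] :=
    pselect (I `&` M `<=` J `&` M).
  have -> // : I `&` M = J `&` M.
  by apply/seteqP; split=> // w [Jw Mw]; split=> //; exact: JI.
have -> : I `&` M = ideal_add (J `&` M) (principal z).
  apply/seteqP; split; last first.
    apply: ideal_add_sub; first exact: is_ideal_cap.
      by move=> w [Jw Mw]; split=> //; exact: JI.
    by apply: principal_sub; [exact: is_ideal_cap|].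
  move=> w [Iw Mw]; have nJz : ~ J z by move=> Jz; apply: nz.
  have [j Jj [_ [c _ <-] zE]] := Iz; have [j' Jj' [_ [d _ <-] wE]] := Iw.
  have nc : ~ m c.
    by move=> mc; apply: nJz; rewrite -zE; apply: (idlD Ji) => //; exact: mx.
  have [u uc] := local_unit noethR Lm nc.
  have wz : w - d * u * z = j' - d * u * j.
    have dx : d * u * (c * x) = d * x by rewrite mulrA -(mulrA d) uc mulr1.
    have -> : w - d * u * z = j' - d * u * j + (d * x - d * u * (c * x)).
      by rewrite -wE -zE; ring.
    by rewrite dx subrr addr0.
  exists (w - d * u * z); last first.
    by exists (d * u * z); [exists (d * u)|rewrite subrK].
  split; first by rewrite wz; apply: (idlB Ji Jj'); exact: (idlM _ Ji).
  by apply: (idlB Mi Mw); exact: (idlM _ Mi).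
apply: double_annihilator_step => // [|a ma]; first exact: closedE.
by split; [exact: mIJ|exact: idlM].
Qed.

End Duality.

(** As t >= 4, the powers m^2, m^3 and m^4 are distinct and nonzero; they kill every
    pencil inside Ann(m^2).  Hence Ann(m^2) = S + Rw.  If m/m^2 had dimension at least
    2, some d outside m^2 would be killed by w, and by S: it would belong to
    Ann(Ann(m^2)) = m^2. *)
Lemma index_ge_four (K : realType) (R : comNzRingType) (m : set R) (s : R)
    (t : nat) (rho : nat -> R) : noetherian R -> finite_genus K (AG R) ->
  local_with m -> annihilator m = principal s -> (4 <= t)%N ->
  ideal_pow m t <> [set 0] -> ideal_pow m t.+1 = [set 0] ->
  (forall i j, (i < j)%N -> ~ m (rho j - rho i)) ->
  exists x, m = principal x.
Proof.
move=> noethR fingenus Lm socleE t4 mt0 mt1 rhoP.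
have mi := local_ideal Lm; have Pi k := is_ideal_pow k mi.
have ptop := pow_top noethR Lm socleE mt0 mt1.
set S := annihilator m in ptop.
have Si : is_ideal S by exact: is_ideal_annihilator.
have Pm : ideal_pow m 1 = m by exact: ideal_pow1.
have strict i j : (i < j)%N -> (i <= t)%N -> ideal_pow m i <> ideal_pow m j.
  move=> ij it E; apply: mt0; apply/seteqP; split; last by move=> _ ->; exact: idl0.
  have <- : ideal_pow m i = [set 0].
    apply: (pow_stable_nilpotent noethR Lm); apply/seteqP; split.
      by rewrite E; exact: ideal_pow_le.
    exact: ideal_pow_le.
  exact: ideal_pow_le.
have nz i : (i <= t)%N -> ideal_pow m i <> [set 0].
  by move=> it E; apply: (strict i t.+1) => //; rewrite E mt1.
have narrow a b : annihilator (ideal_pow m 2) a -> annihilator (ideal_pow m 2) b ->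
    ~ indep2 m S a b.
  move=> Aa Ab ab; have linj := line_inj noethR Lm Si ab rhoP.
  have AP : is_ideal (annihilator (ideal_pow m 2)) by exact: is_ideal_annihilator.
  have P2m : ideal_pow m 2 `<=` m by rewrite -[X in _ `<=` X]Pm; exact: ideal_pow_le.
  apply: (three_killers fingenus (Pi 2%N) (Pi 3%N) (Pi 4%N) _ _ _ _ _ _ _ linj).
  - by apply: nz; lia.
  - by apply: nz; lia.
  - by apply: nz; lia.
  - by apply: strict => //; lia.
  - by apply: strict => //; lia.
  - by apply: strict => //; lia.
  - by move=> n; exact: is_ideal_line.
  move=> n x y Ax; have {Ax} P2x : ideal_pow m 2 x.
    by case: Ax => [|[]] //; exact: ideal_pow_le.
  have lA : line S a b (rho n) `<=` annihilator (ideal_pow m 2).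
    apply: line_sub => // z Sz w /P2m; exact: Sz.
  by move=> /lA; rewrite mulrC; apply.
apply: contrapT => np.
have [a [b [ma mb ab]]] : exists a b, [/\ m a, m b & indep2 m (ideal_pow m 2) a b].
  by apply: (two_generators noethR Lm) => x E; apply: np; exists x.
have [w Pw nSw] : exists2 w, ideal_pow m t.-1 w & ~ S w.
  apply: contrapT => H; apply: (strict t.-1 t); [lia|lia|].
  apply/seteqP; split; last by apply: ideal_pow_le => //; lia.
  by move=> x Px; rewrite ptop; apply: contrapT => nSx; apply: H; exists x.
have mw x : m x -> S (x * w).
  by move=> mx; rewrite -ptop -(prednK (ltn_trans _ t4)) //; exact: ideal_powSl.
have Aw : annihilator (ideal_pow m 2) w.
  move=> x Px; rewrite mulrC; have := ideal_powM mi Px Pw.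
  have -> : (2 + t.-1 = t.+1)%N by lia.
  by rewrite mt1.
have wide z : annihilator (ideal_pow m 2) z -> ideal_add S (principal w) z.
  move=> Az; apply: contrapT => nz'; apply: (narrow w z Aw Az).
  apply: (indep2_intro noethR Lm) => // c mc e me.
  by rewrite mulrAC mulrC; apply: Az; exact: mem_pow2.
have ms c : m c -> c * s = 0.
  have : S s by rewrite /S socleE; exact: principal_self.
  by move=> Ss mc; rewrite mulrC; exact: Ss.
have wS x : m x -> principal s (w * x).
  by move=> mx; rewrite -socleE mulrC; exact: mw.
have [d [wd nd Hd]] := kernel2 noethR Lm ab ms (wS a ma) (wS b mb).
apply: nd; apply: (double_annihilator noethR Lm socleE mt1 (Pi 2%N)) => z /wide.
move=> [p Sp [_ [c _ <-] <-]].
by rewrite mulrDr mulrCA [d * w]mulrC wd mulr0 addr0 mulrC Sp //; exact: Hd.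
Qed.

(** * The classification *)

Lemma injective_infinite (T : Type) (A : set T) (F : nat -> T) :
  injective F -> (forall n, A (F n)) -> infinite_set A.
Proof.
move=> inj FA fA; apply: infinite_nat.
rewrite -(eq_finite_set (inj_card_eq (in2W inj))).
by apply: sub_finite_set fA => _ [n _ <-].
Qed.

Lemma finitely_many_ideals_artinian (R : comNzRingType) :
  finite_set [set I : set R | is_ideal I] -> artinian R.
Proof.
move=> fin F Fi Fdec; apply: contrapT => H.
have dec i j : (i <= j)%N -> F j `<=` F i.
  by move/subnK <-; elim: (j - i)%N => //= k IH; exact: subset_trans (Fdec _) IH.
have next N : exists n, (N <= n)%N /\ F n <> F N.
  apply: contrapT => nN; apply: H; exists N => n Nn.
  by apply: contrapT => ne; apply: nN; exists n.
have [g gP] := choice next; pose G k := F (iter k g 0%N).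
have mono i j : (i <= j)%N -> (iter i g 0 <= iter j g 0)%N.
  move/subnK <-; elim: (j - i)%N => //= k IH.
  by apply: leq_trans IH _; case: (gP (iter (k + i) g 0%N)).
have Gneq i j : (i < j)%N -> G i <> G j.
  move=> ij E; have [le ne] := gP (iter i g 0%N); apply: ne; apply/seteqP; split.
    exact: dec.
  by rewrite -/(G i) E; apply: dec; exact: (mono i.+1 j).
apply: (@injective_infinite _ [set I | is_ideal I] G) fin => [i j E|n]; last exact: Fi.
by have [/Gneq|/Gneq|//] := ltngtP i j; rewrite E.
Qed.

Lemma lines_infinite (R : comNzRingType) (m J : set R) (a b : R) (rho : nat -> R) :
  noetherian R -> local_with m -> is_ideal J -> indep2 m J a b ->
  (forall i j, (i < j)%N -> ~ m (rho j - rho i)) ->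
  infinite_set [set I : set R | is_ideal I].
Proof.
move=> noethR Lm Ji ab rhoP.
apply: (injective_infinite (line_inj noethR Lm Ji ab rhoP)) => n.
exact: is_ideal_line.
Qed.

Theorem theorem3p4 (K : realType) (R : comNzRingType)
  (noethR : noetherian R)
  (all_vertices : forall I : set R,
     is_ideal I -> I <> [set 0] -> I <> [set: R] -> AG_vertex I)
  (finite_genusR : finite_genus K (AG R)) :
  (~ is_local R -> artinian R /\ finite_set [set I : set R | is_ideal I])
  /\
  (forall m : set R, local_with m ->
     [/\ gorenstein m,
         forall n : nat, (0 < n)%N -> ideal_pow m n <> ideal_pow m n.+1,
         AG_in_fig1 m & has_genus K (AG R) 0]
     \/
     (artinian R /\
      exists t : nat,
        ideal_pow m t <> [set 0] /\ ideal_pow m t.+1 = [set 0] /\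
        [/\ t = 1%N ->
              finite_set [set: R] \/ special_principal_ideal_ring R,
            t = 2%N ->
              [\/ finite_set [set: R],
                  special_principal_ideal_ring R |
                  residue_dim m (ideal_pow m 2) (ideal_pow m 3) 1 /\
                  residue_dim m m (ideal_pow m 2) 2 /\
                  infinite_set [set I : set R | is_ideal I] /\
                  AG_in_fig2 m /\
                  has_genus K (AG R) 0],
            t = 3%N ->
              [\/ finite_set [set: R],
                  special_principal_ideal_ring R |
                  residue_dim m m (ideal_pow m 2) 2 /\
                  residue_dim m (ideal_pow m 2) (ideal_pow m 3) 1 /\
                  residue_dim m (ideal_pow m 3) (ideal_pow m 4) 1 /\
                  infinite_set [set I : set R | is_ideal I] /\
                  AG_in_fig3 m /\
                  has_genus K (AG R) 0] &
            (4 <= t)%N ->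
              finite_set [set: R] \/ special_principal_ideal_ring R])).
Proof.
split=> [nloc|m Lm].
  have fin := nonlocal_finite noethR all_vertices finite_genusR nloc.
  by split=> //; exact: finitely_many_ideals_artinian.
have mi := local_ideal Lm.
have [m0|m0] := pselect (m = [set 0]).
  right; split.
    by apply: (nilpotent_artinian noethR Lm (n := 1)); rewrite ideal_pow1.
  exists 0%N; split; last by rewrite ideal_pow1.
  move=> E; have : ideal_pow m 0 1 by [].
  by rewrite E => /= /eqP; rewrite oner_eq0.
have mT : m <> [set: R] by case: Lm => -[].
have [s s0 Ss] := vertex_annihilator (all_vertices m mi m0 mT).
have [[socleE strict]|nA] := pselect (annihilator m = principal s /\
    forall n, (0 < n)%N -> ideal_pow m n <> ideal_pow m n.+1).
  left; have fig := decreasing_powers_fig1 noethR all_vertices finite_genusR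
    Lm socleE s0 strict.
  by split=> //; [exact: gorenstein_simple socleE s0|exact: AG_fig1_planar fig].
right; have [n [mn]] : exists n, ideal_pow m n = [set 0] /\
    (finite_set [set: R] \/ annihilator m = principal s).
  have [sub|/existsNP[b /not_implyP[Sb nb]]] :=
      pselect (annihilator m `<=` principal s); last first.
    have [fin [n mn]] :=
      socle_not_simple_finite noethR finite_genusR Lm m0 Ss s0 Sb nb.
    by exists n; split=> //; left.
  have socleE : annihilator m = principal s.
    by apply/seteqP; split=> //; apply: principal_sub => //; exact: is_ideal_annihilator.
  have /existsNP[n /not_implyP[_ /contrapT stable]] :
    ~ forall n, (0 < n)%N -> ideal_pow m n <> ideal_pow m n.+1.
    by move=> strict; apply: nA.
  by exists n; split; [exact: (pow_stable_nilpotent noethR Lm stable)|right].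
move=> fin_or_simple; split; first exact: (nilpotent_artinian noethR Lm mn).
have [t [t0 t1]] := nilpotency_index mn; exists t; split=> //; split=> //.
have [fin|inf] := pselect (finite_set [set: R]).
  by split=> _; [left|apply: Or31|apply: Or31|left].
have socleE : annihilator m = principal s by case: fin_or_simple.
have [rho rhoP] := infinite_residues noethR Lm mn inf.
have ptop := pow_top noethR Lm socleE t0 t1.
have [[x mx]|np] := pselect (exists x, m = principal x).
  have spir := principal_maximal_spir noethR Lm mx mn.
  by split=> _; [right|apply: Or32|apply: Or32|right].
have {} np x : m <> principal x by move=> mx; apply: np; exists x.
have [a [b [ma mb ab]]] := two_generators noethR Lm np.
have infI := lines_infinite noethR Lm (is_ideal_pow 2 mi) ab rhoP.
split=> tE.
- by case: (np s); rewrite -socleE -ptop tE ideal_pow1.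
- apply: Or33; rewrite tE in t1 ptop.
  have no3 c : m c -> ~ indep3 m (ideal_pow m 2) a b c.
    move=> mc; rewrite ptop.
    exact: (no_three_dimensions noethR finite_genusR Lm socleE s0 ptop rhoP).
  have [dim2 gen] := residue_dim2 noethR Lm ma mb ab no3.
  rewrite ptop in ab gen.
  have fig := index_two_fig2 noethR Lm socleE s0 ptop ma mb ab gen.
  split; first by rewrite t1 ptop; case: (gorenstein_simple noethR Lm socleE s0).
  by split=> //; split=> //; split=> //; exact: AG_fig2_planar fig.
- apply: Or33; rewrite tE in t1 ptop.
  have [d1 d2 d3 fig] := index_three noethR finite_genusR Lm socleE s0 ptop t1 rhoP np.
  have planar := AG_fig3_planar K fig.
  by split=> //; split=> //; split=> //; split.
- by have [x mx] := index_ge_four noethR finite_genusR Lm socleE tE t0 t1 rhoP; case: (np x).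
Qed.
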